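(* Let $G$ be a finite-dimensional $p$-adic Lie group, let $W$ be an admissible $\mathbb{Q}_p$-Banach space representation of $G$ with unit ball $W^o$, and let $A$ be a ring such that $W$ is equipped with an $A$-module structure commuting with the action of $G$. Assume that $W^o$ is $A[K_0]$-stable for some open subgroup $K_0$ of $G$. Let $K$ be an open subgroup of $G$, sufficiently small so that $W^o$ is $K$-stable and it makes sense to talk about analytic functions on $K$. Then the action of $A$ on the space $W^{K\text{-}\mathrm{an}}$ of $K$-analytic vectors is locally analytic.
   Context: Locally analytic action: let $A$ be a ring and $W$ a $p$-adic Banach space over $\mathbb{Q}_p$ equipped with an $A$-module structure. The action of $A$ on $W$ is locally analytic if there exists an $A$-stable open and bounded lattice $\mathcal{L}\subseteq W$ such that the image of $A\to\mathrm{End}(\mathcal{L}/p^n\mathcal{L})$ is finite for every $n\ge 1$. Admissible: for any open compact subgroup $K$ of $G$ and any open bounded $K$-stable lattice $\mathcal{L}\subseteq W$, the $\mathbb{F}_p$-dimension of $(\mathcal{L}/p\mathcal{L})^K$ is finite. Analytic functions and vectors: ''it makes sense to talk about analytic functions on $K$'' means that $K$ is a sufficiently small compact open (uniform pro-$p$) subgroup with global coordinates $\mathbb{Z}_p^d\cong K$, $(c_1,\dots,c_d)\mapsto g_1^{c_1}\cdots g_d^{c_d}$ for an ordered basis $g_1,\dots,g_d$. $\mathscr{C}^{\mathrm{an}}(K,\mathbb{Q}_p)$ is the Banach space of functions $K\to\mathbb{Q}_p$ given in these coordinates by power series with coefficients in $\mathbb{Q}_p$ tending to zero, with unit ball $\mathscr{C}^{\mathrm{an}}(K,\mathbb{Q}_p)^o$.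 A vector $w\in W$ is $K$-analytic if its orbit map $g\mapsto g\cdot w$ lies in $W\widehat\otimes_{\mathbb{Q}_p}\mathscr{C}^{\mathrm{an}}(K,\mathbb{Q}_p)$. The subspace $W^{K\text{-}\mathrm{an}}\subseteq W$ of $K$-analytic vectors is identified with $(W\widehat\otimes_{\mathbb{Q}_p}\mathscr{C}^{\mathrm{an}}(K,\mathbb{Q}_p))^K$ (a natural action of $K$ on both factors, by translation on functions); it is a $\mathbb{Q}_p$-Banach space with unit ball $(W^o\widehat\otimes_{\mathbb{Z}_p}\mathscr{C}^{\mathrm{an}}(K,\mathbb{Q}_p)^o)^K$, and an $A$-module. *)

(* Defs.v *)
From HB Require Import structures.
From mathcomp Require Import all_boot all_order all_algebra finmap.
From mathcomp Require Import all_classical all_reals all_analysis.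
From mathcomp.analysis.showcase Require Import summability.

Set Implicit Arguments.
Unset Strict Implicit.
Unset Printing Implicit Defensive.

Import Order.TTheory GRing.Theory Num.Theory numFieldNormedType.Exports.

Local Open Scope classical_set_scope.
Local Open Scope ring_scope.

(* The field of p-adic numbers, as the completion of the rationals for the
   p-adic absolute value normalised by |p| = 1/p: a complete valued field in
   which the rationals are dense and carry that absolute value. This
   determines the valued field up to a unique isomorphism. *)
HB.mixin Record isPadicField (R : realType) (p : nat) F
    & GRing.Field F & Uniform F := {
  padic_abs : F -> R;
  padic_abs_eq0 : forall x : F, padic_abs x = 0 <-> x = 0;
  padic_absM : forall x y : F, padic_abs (x * y) = padic_abs x * padic_abs y;
  padic_absD : forall x y : F,
    padic_abs (x + y) <= Num.max (padic_abs x) (padic_abs y);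
  padic_abs_nat : forall n : nat, (0 < n)%N ->
    padic_abs n%:R = (p%:R ^+ logn p n)^-1;
  padic_entourageE :
    entourage = entourage_ (fun x r => [set y : F | padic_abs (x - y) < r]);
  padic_rat_dense : dense (range (ratr : rat -> F));
  padic_complete : forall U : set_system F,
    ProperFilter U -> cauchy U -> exists x : F, U --> x
}.

#[short(type="padicFieldType")]
HB.structure Definition PadicField (R : realType) (p : nat) :=
  { F of GRing.Field F & Uniform F & isPadicField R p F }.

(* The normed and topological modules of the library require an ordered field
   of scalars, so the topology of a p-adic Banach space is expressed directly
   by its norm. *)
HB.mixin Record isPadicBanach (R : realType) (p : nat)
    (Qp : padicFieldType R p) W & GRing.Lmodule Qp W := {
  bnorm : W -> R;
  bnorm_eq0 : forall w : W, bnorm w = 0 -> w = 0;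
  bnormZ : forall (a : Qp) (w : W), bnorm (a *: w) = padic_abs a * bnorm w;
  bnormD : forall v w : W, bnorm (v + w) <= Num.max (bnorm v) (bnorm w);
  bnorm_complete : forall u : nat -> W,
    (forall e : R, 0 < e -> exists N, forall m n, (N <= m)%N -> (N <= n)%N ->
      bnorm (u m - u n) < e) ->
    exists w : W, bnorm (u n - w) @[n --> \oo] --> (0 : R)
}.

#[short(type="padicBanachType")]
HB.structure Definition PadicBanach (R : realType) (p : nat)
    (Qp : padicFieldType R p) :=
  { W of GRing.Lmodule Qp W & isPadicBanach R p Qp W }.

HB.mixin Record isTopologicalGroup G & Topological G & Group G := {
  mulg_continuous : continuous (fun x : G * G => (x.1 * x.2)%g);
  invg_continuous : continuous (fun x : G => (x^-1)%g)
}.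

#[short(type="topologicalGroupType")]
HB.structure Definition TopologicalGroup :=
  { G of Topological G & Group G & isTopologicalGroup G }.

Section TopologicalGroups.
Variable G : topologicalGroupType.
Implicit Types (H K N X : set G).
Local Open Scope group_scope.

Definition subgroup H : Prop :=
  [/\ H 1, forall x y, H x -> H y -> H (x * y) & forall x, H x -> H x^-1].

Definition generated X : set G := closure (smallest subgroup X).

Definition left_cosets N K : set (set G) :=
  [set [set x * y | y in N] | x in K].

(* An open subgroup K of G that is a pro-p group. As K is open, a subset of K
   is open in K if and only if it is open in G. *)
Definition open_pro_p (p : nat) K : Prop :=
  [/\ subgroup K, open K /\ compact K,
      forall U, nbhs (1 : G) U ->
        exists N, [/\ open N, subgroup N & N `<=` U `&` K] &
      forall N, open N -> subgroup N -> N `<=` K ->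
        (forall x y, N x -> K y -> N (x ^ y)) ->
        exists n : nat, (left_cosets N K #= `I_(p ^ n))%card].

Fixpoint lower_p_series (p : nat) K (n : nat) : set G :=
  if n is m.+1 then
    let P := lower_p_series p K m in
    generated ([set x ^+ p | x in P] `|` [set [~ x, y] | x in P & y in K])
  else K.

Definition powerful (p : nat) K : Prop :=
  forall x y, K x -> K y ->
    generated [set z ^+ (if p == 2 then 4 else p)%N | z in K] [~ x, y].

(* The series is P_1 = K, P_2, ... in the literature, shifted here to start
   at 0. *)
Definition open_uniform (p : nat) K : Prop :=
  [/\ open_pro_p p K,
      exists X, [/\ finite_set X, X `<=` K & generated X = K],
      powerful p K &
      forall i, (left_cosets (lower_p_series p K i.+1) (lower_p_series p K i)
                 #= left_cosets (lower_p_series p K 1) K)%card].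

End TopologicalGroups.

Definition homeomorphic_on (S T : topologicalType) (U : set S) (V : set T)
    (f : S -> T) : Prop :=
  [/\ open U, open V, set_bij U V f &
      forall B, B `<=` U -> (open B <-> open (f @` B))].

Section PadicAnalysis.
Variables (R : realType) (p : nat) (Qp : padicFieldType R p).

Definition Zp : set Qp := [set x | padic_abs x <= 1].

Definition Zp_vec d : set 'rV[Qp]_d := [set z | forall i, Zp (z 0 i)].

Definition multi_index d := {ffun 'I_d -> nat}.

Definition mdegree d (k : multi_index d) : nat := (\sum_i k i)%N.

Definition monomial d (z : 'rV[Qp]_d) (k : multi_index d) : Qp :=
  \prod_i z 0 i ^+ k i.

Definition null_family (I : Type) (u : I -> R) : Prop :=
  forall e, 0 < e -> finite_set [set i | e <= u i].

Definition has_sum (I : choiceType) (u : I -> Qp) (s : Qp) : Prop :=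
  partial_sum u @ totally --> s.

(* On D, the map v is a locally analytic function of u: near every point of D
   it is given by power series in the coordinates of u, convergent on a closed
   polydisc. *)
Definition locally_analytic_fun (S : Type) (D : set S) m n
    (u : S -> 'rV[Qp]_m) (v : S -> 'rV[Qp]_n) : Prop :=
  forall s, D s -> exists2 r : R, 0 < r &
  forall j, exists2 c : multi_index m -> Qp,
    null_family (fun k => padic_abs (c k) * r ^+ mdegree k) &
    forall t, D t -> (forall i, padic_abs (u t 0 i - u s 0 i) <= r) ->
      has_sum (fun k => c k * monomial (u t - u s) k) (v t 0 j).

Definition padic_chart d (G : topologicalType)
    (c : set G * (G -> 'rV[Qp]_d)) : Prop :=
  homeomorphic_on c.1 (c.2 @` c.1) c.2.

Definition padic_lie_group d (G : topologicalGroupType) : Prop :=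
  hausdorff_space G /\
  exists A : set (set G * (G -> 'rV[Qp]_d)),
    [/\ forall c, A c -> padic_chart c,
        \bigcup_(c in A) c.1 = setT,
        forall a b, A a -> A b -> locally_analytic_fun (a.1 `&` b.1) a.2 b.2,
        forall a b c, A a -> A b -> A c ->
          locally_analytic_fun
            [set x : G * G | [/\ a.1 x.1, b.1 x.2 & c.1 (x.1 * x.2)%g]]
            (fun x => row_mx (a.2 x.1) (b.2 x.2))
            (fun x => c.2 (x.1 * x.2)%g) &
        forall a b, A a -> A b ->
          locally_analytic_fun [set x : G | a.1 x /\ b.1 (x^-1)%g]
            a.2 (fun x => b.2 (x^-1)%g)].

Section Coordinates.
Variables (G : topologicalGroupType) (d : nat) (g : 'I_d -> G).

(* The filter of sets of natural numbers that contain all the naturals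
   sufficiently close to x. *)
Definition nat_near (x : Qp) : set_system nat :=
  filter_from (nbhs x) (fun U => [set n : nat | U n%:R]).

(* h^x is the limit of the powers h^n as the natural number n tends p-adically
   to x in Zp; it exists for h in a pro-p group. *)
Definition padic_exp (h : G) (x : Qp) : G :=
  xget 1%g [set y : G | (h ^+ n)%g @[n --> nat_near x] --> y].

Definition coordinates (z : 'rV[Qp]_d) : G :=
  (\prod_(i < d) padic_exp (g i) (z 0 i))%g.

Definition ordered_basis (K : set G) : Prop :=
  (forall i, K (g i)) /\ homeomorphic_on (@Zp_vec d) K coordinates.

(* Functions on K, the image of Zp_vec under the coordinates, are represented
   by functions on G whose values outside K are irrelevant. The space of
   analytic functions on K enters through its unit ball, the power series with
   coefficients in Zp tending to zero. *)
Definition Can_ball (f : G -> Qp) : Prop :=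
  exists2 c : multi_index d -> Qp,
    null_family (fun k => padic_abs (c k)) /\ (forall k, Zp (c k)) &
    forall z, Zp_vec z ->
      has_sum (fun k => c k * monomial z k) (f (coordinates z)).

End Coordinates.

Section Banach.
Variable W : padicBanachType Qp.

Definition unit_ball : set W := [set w | bnorm w <= 1].

(* In the next definitions V is a linear subspace of W and B is a subset of V,
   the unit ball of a Banach space structure on V: the multiples a *: B with
   a != 0 form a base of neighbourhoods of 0. For W itself take V := setT and
   B := unit_ball. *)

Definition lattice (V L : set W) : Prop :=
  [/\ L `<=` V, L 0, forall x y, L x -> L y -> L (x + y),
      forall (a : Qp) x, Zp a -> L x -> L (a *: x) &
      forall v, V v -> exists2 a : Qp, a != 0 & L (a *: v)].

Definition open_for (B U : set W) : Prop :=
  forall x, U x -> exists2 a : Qp, a != 0 & forall b, B b -> U (x + a *: b).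

Definition bounded_for (B U : set W) : Prop :=
  exists a : Qp, U `<=` [set a *: b | b in B].

Definition open_bounded_lattice (V B L : set W) : Prop :=
  [/\ lattice V L, open_for B L & bounded_for B L].

Definition residue_class (L : set W) (n : nat) (x : W) : set W :=
  [set x + (p%:R ^+ n : Qp) *: y | y in L].

Definition lattice_quotient (L : set W) (n : nat) : set (set W) :=
  [set residue_class L n x | x in L].

(* The endomorphism of L / p^n L induced by an additive map f that preserves
   L. *)
Definition induced_map (L : set W) (n : nat) (f : W -> W)
    (C : lattice_quotient L n) : set W :=
  \bigcup_(x in set_val C) residue_class L n (f x).

Section Actions.
Variables (A : pzRingType) (act : A -> W -> W).

Definition module_action : Prop :=
  [/\ forall w, act 1 w = w, forall a b w, act (a * b) w = act a (act b w),
      forall a b w, act (a + b) w = act a w + act b w &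
      forall a v w, act a (v + w) = act a v + act a w].

Definition stable_under (L : set W) : Prop :=
  forall a w, L w -> L (act a w).

Definition locally_analytic_action (V B : set W) : Prop :=
  stable_under V /\
  exists L, [/\ open_bounded_lattice V B L, stable_under L &
    forall n, (1 <= n)%N ->
      finite_set (range (fun a : A => @induced_map L n (act a)))].

End Actions.

Section Representations.
Variables (G : topologicalGroupType) (rho : G -> W -> W).

Definition banach_representation : Prop :=
  [/\ forall w, rho 1%g w = w,
      forall g h w, rho (g * h)%g w = rho g (rho h w),
      forall g (a : Qp) v w, rho g (a *: v + w) = a *: rho g v + rho g w &
      forall g w (e : R), 0 < e -> exists2 r : R, 0 < r &
        \forall h \near g, forall v, bnorm (v - w) < r ->
          bnorm (rho h v - rho g w) < e].

Definition subgroup_stable (K : set G) (L : set W) : Prop :=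
  forall k w, K k -> L w -> L (rho k w).

Definition quotient_invariant (K : set G) (L : set W) (x : W) : Prop :=
  L x /\ forall k, K k -> residue_class L 1 (rho k x) = residue_class L 1 x.

(* The quotient L / p L is killed by p, so a natural number suffices to
   represent a scalar of F_p. *)
Definition fin_dim_quotient_invariants (K : set G) (L : set W) : Prop :=
  exists (m : nat) (v : 'I_m -> W),
    (forall j, quotient_invariant K L (v j)) /\
    forall x, quotient_invariant K L x -> exists c : 'I_m -> nat,
      residue_class L 1 x = residue_class L 1 (\sum_(j < m) v j *+ c j).

Definition admissible : Prop :=
  forall (K : set G) (L : set W), subgroup K -> open K -> compact K ->
    open_bounded_lattice setT unit_ball L -> subgroup_stable K L ->
    fin_dim_quotient_invariants K L.

Variables (d : nat) (g : 'I_d -> G) (K : set G).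

Definition tensor_ball (F : G -> W) : Prop :=
  exists (m : nat) (f : 'I_m -> G -> Qp) (w : 'I_m -> W),
    [/\ forall j, Can_ball g (f j), forall j, unit_ball (w j) &
        forall x, K x -> F x = \sum_(j < m) f j x *: w j].

(* The unit ball of the completed tensor product of W and Can, that is the
   p-adic completion of the tensor product of their unit balls, realised as a
   space of functions from K to W: its elements are the sums of the series of
   general term p^n F_n with F_n in the tensor product. *)
Definition ctensor_ball (F : G -> W) : Prop :=
  exists2 t : nat -> G -> W, forall n, tensor_ball (t n) &
    forall x, K x ->
      bnorm (F x - \sum_(0 <= i < n) (p%:R ^+ i : Qp) *: t i x)
        @[n --> \oo] --> (0 : R).

Definition ctensor (F : G -> W) : Prop :=
  exists n : nat, ctensor_ball (fun x => (p%:R ^+ n : Qp) *: F x).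

(* A vector is identified with its orbit map, which is a K-equivariant
   function from K to W. *)

Definition analytic_vectors : set W := [set w | ctensor (fun x => rho x w)].

Definition analytic_vectors_ball : set W :=
  [set w | ctensor_ball (fun x => rho x w)].

End Representations.

End Banach.

End PadicAnalysis.

Arguments unit_ball {R p Qp} W.

(* Main.v *)
(* The lattice is the unit ball B of the space of analytic vectors. Expand the
   orbit map of w in B in falling factorials of the coordinates of K: its
   coefficients are the finite differences at 0 divided by factorials, they lie
   in the unit ball of W, and w lies in p^n B as soon as they vanish modulo p^n.
   All these coefficients are fixed modulo p^n by an open subgroup N of K that
   depends only on n. By admissibility and devissage, the vectors of the unit
   ball fixed by N modulo p^n form finitely many classes modulo p^n, so A acts
   on B / p^n B through finitely many maps.

   The subgroup N exists because translation by h near 1 changes the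
   coordinates by p^n times power series with integral coefficients tending to
   zero. By Mahler's theorem it is enough that the finite differences of order
   k of the coordinates be divisible by p^(beta |k|), with beta = 1, or beta = 2
   if p = 2, since this beats k!. This is proved in the group ring of a finite
   quotient of K, where p has weight 1 and the augmentation ideal weight beta.
   As K is powerful, the commutators of the g_i - 1 are divisible by p^beta up
   to terms of higher weight, so an element of weight m is a combination of
   ordered monomials p^a (g_1 - 1)^k_1 ... (g_d - 1)^k_d with a + beta |k| >= m,
   up to arbitrarily high weight. A coordinate function, extended linearly,
   vanishes on all ordered monomials but one, and it is small on elements of
   high weight because the augmentation ideal of a p-group is nilpotent
   modulo p. *)

Require Import Defs.
From HB Require Import structures.
From mathcomp Require Import all_boot all_order all_algebra finmap.
From mathcomp Require Import all_fingroup all_solvable all_character.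
From mathcomp Require Import all_classical all_reals all_analysis.
From mathcomp.analysis.showcase Require Import summability.
From mathcomp Require Import zify ring lra.

Set Implicit Arguments.
Unset Strict Implicit.
Unset Printing Implicit Defensive.
Import Order.TTheory GRing.Theory Num.Theory numFieldNormedType.Exports.
Local Open Scope ring_scope.

(** * Straightening in the augmentation filtration *)

(** The obstacle is uniformity: [N] may depend on [n] alone, not on the vector or on the index of
    the coefficient. Two facts secure it. Coefficients in falling factorials are finite combinations
    of values, so they commute with [rho h] and with [A]; and [rho h] applied to an orbit map is
    that orbit map composed with a translation of the coordinates, which does not involve the
    vector. Moreover the estimate on the differences of the translated coordinates holds for all h
    in K at once and, after division by k!, keeps a surplus of at least |k|/2. Only finitely many
    coefficients are then left to be made small by taking h close to 1.

    The weights are chosen so that swapping two letters respects them: the leading part of a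
    commutator is p^beta times an element of the augmentation ideal, of weight 2 beta like the
    product of two letters. The extra factor h - 1 of a translation has weight beta, exactly what is
    lost on the words of length one, the only ones that the coordinate functional sees. *)

Inductive int_span (V : zmodType) (P : V -> Prop) : V -> Prop :=
| int_span_gen x : P x -> int_span P x
| int_span0 : int_span P 0
| int_spanB x y : int_span P x -> int_span P y -> int_span P (x - y).

Section IntSpan.
Variable V : zmodType.
Implicit Types (P Q : V -> Prop) (x y : V).

Lemma int_spanN P x : int_span P x -> int_span P (- x).
Proof. by move=> Px; rewrite -sub0r; apply: int_spanB => //; apply: int_span0. Qed.

Lemma int_spanD P x y : int_span P x -> int_span P y -> int_span P (x + y).
Proof. by move=> Px Py; rewrite -[y]opprK; apply/int_spanB/int_spanN. Qed.

Lemma int_span_bind P Q (f : {additive V -> V}) x :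
  (forall y, P y -> int_span Q (f y)) -> int_span P x -> int_span Q (f x).
Proof.
move=> PQ; elim=> [y /PQ //||y z _ IHy _ IHz].
  by rewrite raddf0; apply: int_span0.
by rewrite raddfB; apply: int_spanB.
Qed.

Lemma int_span_sub P Q x :
  (forall y, P y -> int_span Q y) -> int_span P x -> int_span Q x.
Proof. exact: (@int_span_bind _ _ idfun). Qed.

Lemma int_span_mulrn P x n : int_span P x -> int_span P (x *+ n).
Proof.
move=> Px; elim: n => [|n IHn]; first by rewrite mulr0n; apply: int_span0.
by rewrite mulrS; apply: int_spanD.
Qed.

Lemma int_spanU P Q x : int_span (fun y => P y \/ Q y) x ->
  exists y z, [/\ int_span P y, int_span Q z & x = y + z].
Proof.
elim=> [y [Py|Qy]||y z _ [y1 [y2 [Py1 Qy2 ->]]] _ [z1 [z2 [Pz1 Qz2 ->]]]].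
- exists y, 0; rewrite addr0.
  by split=> //; [apply: int_span_gen | apply: int_span0].
- exists 0, y; rewrite add0r.
  by split=> //; [apply: int_span0 | apply: int_span_gen].
- by exists 0, 0; rewrite addr0; split=> //; apply: int_span0.
exists (y1 - z1), (y2 - z2); split; try exact: int_spanB.
by rewrite opprD addrACA.
Qed.

End IntSpan.

Lemma int_spanM (R : pzRingType) (P Q T : R -> Prop) (x y : R) :
  (forall a b, P a -> Q b -> int_span T (a * b)) ->
  int_span P x -> int_span Q y -> int_span T (x * y).
Proof.
move=> PQ; elim=> [a Pa Qy||a b _ IHa _ IHb Qy].
- elim: Qy => [b /(PQ _ _ Pa)//||b c _ IHb _ IHc].
    by rewrite mulr0; apply: int_span0.
  by rewrite mulrBr; apply: int_spanB.
- by move=> _; rewrite mul0r; apply: int_span0.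
by rewrite mulrBl; apply: int_spanB; [apply: IHa | apply: IHb].
Qed.

Lemma commB1 (R : pzRingType) (a b : R) :
  (a - 1) * (b - 1) - (b - 1) * (a - 1) = a * b - b * a.
Proof.
rewrite (mulrBr (a - 1) b) (mulrBl (a - 1) b) mulr1 mul1r.
rewrite [- (b * _ - _)]opprB addrA subrK mulrBl mul1r mulrBr mulr1.
by rewrite opprB addrA subrK.
Qed.

Section Straightening.
Variables (gT : finGroupType) (H : {group gT}) (R : pzRingType) (u : gT -> R).
Hypotheses (u1 : u 1%g = 1) (uM : {morph u : x y / (x * y)%g >-> x * y}).
Variables (p beta : nat) (d : nat) (g : 'I_d -> gT).
(* In the group ring, [p] has weight 1 and the augmentation ideal has weight
   [beta], where [p ^ beta] is the exponent in the definition of powerful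
   groups: [aug m] is the ideal of elements of weight at least [m]. *)
Definition aug_word (s : seq gT) : R := \prod_(h <- s) (u h - 1).

Definition aug_gen m (x : R) : Prop := exists a (s : seq gT),
  [/\ all (mem H) s, (m <= a + beta * size s)%N & x = aug_word s *+ p ^ a].

Definition aug m : R -> Prop := int_span (aug_gen m).

Definition basis_word (s : seq 'I_d) : R := aug_word (map g s).

(** A weakly increasing list of indices stands for an ordered monomial in the [u (g i) - 1]; the
    multiplicities are the exponents. *)
Definition ordered_gen m (x : R) : Prop := exists a (s : seq 'I_d),
  [/\ sorted leq (map val s), (m <= a + beta * size s)%N &
      x = basis_word s *+ p ^ a].

Lemma aug_leq m n x : (n <= m)%N -> aug m x -> aug n x.
Proof.
move=> le_nm; apply: int_span_sub => y [a [s [Hs le_m ->]]]; apply: int_span_gen.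
by exists a, s; split=> //; apply: leq_trans le_m.
Qed.

Lemma aug_wordH s : all (mem H) s -> aug (beta * size s) (aug_word s).
Proof. by move=> Hs; apply: int_span_gen; exists 0, s; rewrite expn0 mulr1n. Qed.

Lemma aug_mulrn m a x : aug m x -> aug (m + a) (x *+ p ^ a).
Proof.
elim=> [y [b [s [Hs le_m ->]]]||y z _ IHy _ IHz].
- apply: int_span_gen; exists (b + a)%N, s; split=> //; first by lia.
  by rewrite -mulrnA expnD.
- by rewrite mul0rn; apply: int_span0.
- by rewrite mulrnBl; apply: int_spanB.
Qed.

Lemma augM m n x y : aug m x -> aug n y -> aug (m + n) (x * y).
Proof.
apply: int_spanM => _ _ [a [s [Hs le_m ->]]] [b [t [Ht le_n ->]]].
apply: int_span_gen.
exists (a + b)%N, (s ++ t); split; first by rewrite all_cat Hs.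
  by rewrite size_cat; nia.
by rewrite mulrnAl mulrnAr -mulrnA /aug_word big_cat expnD mulnC.
Qed.

Lemma augB1 h : h \in H -> aug beta (u h - 1).
Proof.
move=> Hh; have := @aug_wordH [:: h]; rewrite /aug_word big_seq1 muln1 /=.
by apply; rewrite Hh.
Qed.

Lemma aug1 : aug 0 1.
Proof. by have := @aug_wordH [::]; rewrite /aug_word big_nil muln0; apply. Qed.

Lemma aug_u h : h \in H -> aug 0 (u h).
Proof.
move=> Hh; rewrite -[u h](subrK 1); apply: int_spanD aug1.
exact: aug_leq (augB1 Hh).
Qed.

Hypotheses (beta_gt0 : (0 < beta)%N) (p_dvd : (p %| 'C(p ^ beta, 2))%N).
Hypothesis gH : forall i, g i \in H.
Hypothesis gen_g :
  forall x, x \in H -> exists n : 'I_d -> nat, x = (\prod_(i < d) g i ^+ n i)%g.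
Hypothesis comm_q : forall x y, x \in H -> y \in H ->
  [~ x, y]%g \in <<[set (z ^+ (p ^ beta))%g | z in H]>>%g.

(* Commutators [u x * u y - u y * u x] are of this form: their leading term is
   divisible by [p ^ beta], hence a shorter word. *)
Definition near_comm (x : R) : Prop :=
  exists y z, [/\ aug beta y, aug (2 * beta).+1 z & x = y *+ p ^ beta + z].

Lemma near_commD x y : near_comm x -> near_comm y -> near_comm (x + y).
Proof.
case=> a [b [Ja Jb ->]] [a' [b' [Ja' Jb' ->]]]; exists (a + a'), (b + b').
by split; [apply: int_spanD|apply: int_spanD| rewrite mulrnDl addrACA].
Qed.

Lemma near_commMl x y : aug 0 x -> near_comm y -> near_comm (x * y).
Proof.
move=> Jx [a [b [Ja Jb ->]]]; exists (x * a), (x * b).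
split; first by have := augM Jx Ja.
  by have := augM Jx Jb.
by rewrite mulrDr mulrnAr.
Qed.

(** Expand [(1 + c) ^+ (p ^ beta)] with c = u z - 1. The quadratic term gains a factor [p] from
    [p_dvd] and the remainder has weight at least 3 beta, so both have weight at least 2 beta + 1.
    For p = 2 the choice beta = 1 would fail here, as 'C(2, 2) = 1. *)
Lemma near_comm_pow z : z \in H -> near_comm (u (z ^+ (p ^ beta))%g - 1).
Proof.
move=> Hz; have uX n : u (z ^+ n)%g = u z ^+ n.
  by elim: n => [|n IHn]; rewrite ?expg0 // expgS uM IHn exprS.
have Euz : u z = 1 + (u z - 1) by rewrite addrC subrK.
move: (augB1 Hz) Euz; move: (u z - 1) => c Jc Euz.
have powJ n : aug 0 (c ^+ n).
  elim: n => [|n IHn]; first exact: aug1.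
  by rewrite exprS; apply: aug_leq (augM Jc IHn).
have [r [Jr ->]] : exists r, aug 0 r /\ u (z ^+ (p ^ beta))%g =
    1 + c *+ p ^ beta + c * c *+ 'C(p ^ beta, 2) + c * c * c * r.
  rewrite uX Euz.
  elim: (p ^ beta)%N => [|n [r [Jr IHn]]].
    exists 0; split; first exact: int_span0.
    by rewrite expr0 mulr0 !mulr0n !addr0.
  exists (r + c * r + 1 *+ 'C(n, 2)); split.
    apply: int_spanD; last exact/int_span_mulrn/aug1.
    by apply: int_spanD => //; apply: aug_leq (augM Jc Jr).
  rewrite exprS IHn binS bin1 mulrDl mul1r mulrS mulrnDr !mulrDr !mulr1.
  rewrite !mulrnAr !mulrA ?mulr1 !addrA.
  by rewrite [LHS](ACl (1*5*2*3*6*4*8*7)%AC).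
exists c, (c * c *+ 'C(p ^ beta, 2) + c * c * c * r); split=> //; last first.
  by rewrite -!addrA addrC -!addrA addNr addr0.
apply: int_spanD; last first.
  by apply: aug_leq (augM (augM (augM Jc Jc) Jc) Jr); lia.
case/dvdnP: p_dvd => k ->; rewrite mulrnA -[X in _ *+ X]expn1.
have := aug_mulrn 1 (int_span_mulrn k (augM Jc Jc)).
by apply: aug_leq; lia.
Qed.

(** The identity u (x y) - 1 = u x (u y - 1) + (u x - 1) passes from generators to products, because
    [near_comm] is stable under sums and under left multiplication by elements of weight 0. *)
Lemma near_comm_gen h :
  h \in <<[set (z ^+ (p ^ beta))%g | z in H]>>%g -> near_comm (u h - 1).
Proof.
have sub x : x \in <<[set (z ^+ (p ^ beta))%g | z in H]>>%g -> x \in H.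
  apply/fintype.subsetP; rewrite gen_subG.
  apply/fintype.subsetP => _ /imsetP[z Hz ->].
  exact: groupX.
case/gen_prodgP => n [c Hc ->].
elim: n c Hc => [|n IHn] c Hc.
  rewrite big_ord0 u1 subrr; exists 0, 0; rewrite mul0rn addr0.
  by split=> //; apply: int_span0.
rewrite big_ord_recl uM; set x := c ord0; set y := (\prod_(i < n) _)%g.
have -> : u x * u y - 1 = u x * (u y - 1) + (u x - 1).
  by rewrite mulrBr mulr1 addrA subrK.
have Hx : near_comm (u x - 1).
  by have /imsetP[z Hz Ez] := Hc ord0; rewrite /x Ez; apply: near_comm_pow.
apply: near_commD Hx; apply: near_commMl.
  by apply/aug_u/sub/mem_gen/Hc.
by apply: (IHn (fun i => c (lift ord0 i))) => i; apply: Hc.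
Qed.

Lemma near_comm_swap x y : x \in H -> y \in H ->
  near_comm ((u x - 1) * (u y - 1) - (u y - 1) * (u x - 1)).
Proof.
move=> Hx Hy.
have -> : (u x - 1) * (u y - 1) - (u y - 1) * (u x - 1) =
    u (y * x)%g * (u [~ x, y]%g - 1).
  rewrite [RHS]mulrBr mulr1 -uM commgEl conjgE !mulgA mulgK mulgV mul1g !uM.
  exact: commB1.
apply: near_commMl; first by apply/aug_u/groupM.
exact/near_comm_gen/comm_q.
Qed.

Definition ordered_or_aug m : R -> Prop :=
  int_span (fun x => ordered_gen m x \/ aug_gen m.+1 x).

Lemma aug_ordered m x : aug m.+1 x -> ordered_or_aug m x.
Proof. by apply: int_span_sub => y Jy; apply: int_span_gen; right. Qed.

(** Up to products of two letters, h |-> u h - 1 is additive, since u (x y) - 1 = (u x - 1) + (u y -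
    1) + (u x - 1)(u y - 1). Each letter is thus a sum of letters u (g i) - 1, up to weight 2
    beta. *)
Lemma aug_word_expand s : all (mem H) s ->
  int_span (fun x => (exists t, size t = size s /\ x = basis_word t) \/
    aug_gen (beta * (size s).+1) x) (aug_word s).
Proof.
elim: s => [_|h s IHs /= /andP[Hh Hs]].
  by apply: int_span_gen; left; exists [::].
rewrite /aug_word big_cons -/(aug_word s).
have [y [z [By Jz ->]]] := int_spanU (IHs Hs).
rewrite mulrDr; apply: int_spanD; last first.
  apply: (@int_span_sub _ (aug_gen (beta * (size s).+2))).
    by move=> r Jr; apply: int_span_gen; right.
  by apply: aug_leq (augM (augB1 Hh) Jz); rewrite -mulnS.
have [v [w [Bv Jw ->]]] : exists v w, [/\
    int_span (fun x => exists i, x = u (g i) - 1) v, aug (2 * beta) w &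
    u h - 1 = v + w].
  have [n ->] := gen_g Hh.
  pose lin x := x \in H /\ exists v w, [/\
    int_span (fun x => exists i, x = u (g i) - 1) v, aug (2 * beta) w &
    u x - 1 = v + w].
  suff [] : lin (\prod_(i < d) g i ^+ n i)%g by [].
  have lin1 : lin 1%g.
    split=> //; exists 0, 0; rewrite u1 subrr addr0.
    by split=> //; apply: int_span0.
  have linM x1 x2 : lin x1 -> lin x2 -> lin (x1 * x2)%g.
    case=> Hx1 [v1 [w1 [Bv1 Jw1 E1]]] [Hx2 [v2 [w2 [Bv2 Jw2 E2]]]].
    split; first exact: groupM.
    exists (v1 + v2), ((u x1 - 1) * (u x2 - 1) + (w1 + w2)).
    split; first exact: int_spanD.
      apply: int_spanD; last exact: int_spanD.
      by apply: aug_leq (augM (augB1 Hx1) (augB1 Hx2)); lia.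
    rewrite addrCA addrACA -E1 -E2 uM mulrBr mulr1 [(u x1 - 1) * _]mulrBl mul1r.
    by rewrite [in RHS]addrA subrK addrA subrK.
  elim/big_ind: _ => // i _; elim: (n i) => [|k IHk]; first by rewrite expg0.
  rewrite expgS; apply: linM => //; split; first exact: gH.
  exists (u (g i) - 1), 0; rewrite addr0; split=> //; last exact: int_span0.
  by apply: int_span_gen; exists i.
rewrite mulrDl; apply: int_spanD; last first.
  apply: (@int_span_sub _ (aug_gen (beta * (size s).+2))).
    by move=> r Jr; apply: int_span_gen; right.
  have Jy : aug (beta * size s) y.
    apply: int_span_sub By => _ [t [<- ->]].
    rewrite -(size_map g); apply: aug_wordH.
    by apply/allP => _ /mapP[i _ ->]; apply: gH.
  by apply: aug_leq (augM Jw Jy); lia.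
apply: int_spanM Bv By => _ _ [i ->] [t [<- ->]]; apply: int_span_gen; left.
by exists (i :: t); rewrite /basis_word /aug_word /= big_cons.
Qed.

(* The straightening is an induction on the length [k] of the words: relations
   produce shorter words with extra factors [p], or terms of higher weight. *)
Definition straight k (x : R) : Prop :=
  forall a m, (m <= a + beta * k)%N -> ordered_or_aug m (x *+ p ^ a).

Lemma straightD k x y : straight k x -> straight k y -> straight k (x + y).
Proof.
move=> Sx Sy a m le_m; rewrite mulrnDl.
by apply: int_spanD; [exact: Sx | exact: Sy].
Qed.

Lemma straight_word k s : all (mem H) s ->
  (forall t : seq 'I_d, size t = size s -> straight k (basis_word t)) ->
  (k <= size s)%N -> straight k (aug_word s).
Proof.
move=> Hs St le_ks a m le_m.
have [y [z [By Jz ->]]] := int_spanU (aug_word_expand Hs).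
rewrite mulrnDl; apply: int_spanD; last first.
  by apply: aug_ordered; apply: aug_leq (aug_mulrn a Jz); nia.
elim: By => [_ [t [Et ->]]||v w _ IHv _ IHw].
- exact: St.
- by rewrite mul0rn; apply: int_span0.
- by rewrite mulrnBl; apply: int_spanB.
Qed.

Lemma basis_word_aug s : aug (beta * size s) (basis_word s).
Proof.
rewrite -(size_map g); apply: aug_wordH.
by apply/allP => _ /mapP[i _ ->]; apply: gH.
Qed.

Section Sorting.
Variable k : nat.
Hypothesis IHk : forall s : seq 'I_d, (size s < k)%N ->
  straight (size s) (basis_word s).

(** A word shorter than [k] is covered by [IHk]; for a longer one the positive power of [p] already
    gives a strictly higher weight. *)
Lemma straight_long b s : all (mem H) s -> (beta * k <= b + beta * size s)%N ->
  (0 < b)%N -> straight k (aug_word s *+ p ^ b).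
Proof.
move=> Hs le_b b_gt0 a m le_m; rewrite -mulrnA -expnD addnC.
case: (ltnP (size s) k) => [lt_sk | le_ks].
  apply: (@straight_word (size s) s) => //; last by lia.
  by move=> t Et; rewrite -Et; apply: IHk; rewrite Et.
by apply: aug_ordered; apply: aug_leq (aug_mulrn _ (aug_wordH Hs)); nia.
Qed.

(** In [near_comm_swap] the term with p^beta keeps the weight and carries a positive power of [p],
    which is the case of [straight_long]; the other term has higher weight. *)
Lemma straight_swap s i j t : size s + (size t).+2 = k ->
  straight k (basis_word (s ++ i :: j :: t) - basis_word (s ++ j :: i :: t)).
Proof.
move=> Ek; have [y [z [Jy Jz Eyz]]] := near_comm_swap (gH i) (gH j).
have -> : basis_word (s ++ i :: j :: t) - basis_word (s ++ j :: i :: t) =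
    basis_word s * y * basis_word t *+ p ^ beta
    + basis_word s * z * basis_word t.
  have E a b : basis_word (s ++ a :: b :: t) =
      basis_word s * ((u (g a) - 1) * (u (g b) - 1)) * basis_word t.
    by rewrite /basis_word /aug_word map_cat big_cat /= !big_cons !mulrA.
  by rewrite !E -mulrBl -mulrBr Eyz mulrDr mulrDl mulrnAr mulrnAl.
apply: straightD; last first.
  move=> a m le_m; apply: aug_ordered.
  have := aug_mulrn a (augM (augM (basis_word_aug s) Jz) (basis_word_aug t)).
  by apply: aug_leq; nia.
elim: Jy => [x [c [r [Hr le_r ->]]]||v w _ IHv _ IHw].
- rewrite mulrnAr mulrnAl -mulrnA -expnD.
  have -> : basis_word s * aug_word r * basis_word t =
      aug_word (map g s ++ r ++ map g t).
    by rewrite /basis_word /aug_word !big_cat /= mulrA.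
  have Hg w : all (mem H) (map g w).
    by apply/allP => _ /mapP[l _ ->]; apply: gH.
  apply: straight_long; first by rewrite !all_cat !Hg Hr.
    rewrite !size_cat !size_map -Ek !mulnDr !mulnS.
    by move: (beta * _)%N (beta * _)%N (beta * _)%N le_r => *; lia.
  by lia.
- rewrite mulr0 mul0r mul0rn => a m _; rewrite mul0rn; exact: int_span0.
- rewrite mulrBr mulrBl mulrnBl => a m le_m; rewrite mulrnBl.
  by apply: int_spanB; [apply: IHv | apply: IHw].
Qed.

(** One round of an insertion sort: [i] moves right past the smaller letters, which join the prefix
    [s]. *)
Lemma straight_insert i t s : size s + (size t).+1 = k ->
  sorted leq (map val t) -> exists r, [/\ sorted leq (map val r),
    perm_eq r (i :: t) &
    straight k (basis_word (s ++ i :: t) - basis_word (s ++ r))].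
Proof.
elim: t s => [|j t IHt] s Ek St.
  exists [:: i]; split=> //.
  by rewrite subrr => a m _; rewrite mul0rn; apply: int_span0.
case: (leqP i j) => [le_ij | lt_ji].
  exists [:: i, j & t]; split=> //; first by rewrite /= le_ij.
  by rewrite subrr => a m _; rewrite mul0rn; apply: int_span0.
have [||r [Sr Pr Dr]] := IHt (rcons s j).
- rewrite size_rcons -Ek /=; lia.
- exact: path_sorted St.
exists (j :: r); split.
- rewrite /= path_min_sorted //; apply/allP => _ /mapP[l + ->].
  rewrite (perm_mem Pr) inE => /orP[/eqP-> | lt]; first exact: ltnW.
  have /allP := order_path_min leq_trans St; apply.
  exact: map_f.
- rewrite -(perm_cons j) in Pr; apply: (perm_trans Pr).
  exact/permPl/(perm_catCA [:: j] [:: i] t).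
- have := straightD (straight_swap i j Ek) Dr.
  by rewrite !cat_rcons addrA subrK.
Qed.

Lemma straight_sort t s : size s + size t = k -> exists r,
  [/\ sorted leq (map val r), perm_eq r t &
      straight k (basis_word (s ++ t) - basis_word (s ++ r))].
Proof.
elim: t s => [|i t IHt] s Ek.
  exists [::]; split=> //.
  by rewrite subrr => a m _; rewrite mul0rn; apply: int_span0.
have [|r [Sr Pr Dr]] := IHt (rcons s i).
  rewrite size_rcons -Ek /=; lia.
have [|q [Sq Pq Dq]] := @straight_insert i r s _ Sr.
  by rewrite (perm_size Pr).
exists q; split=> //; first by rewrite (perm_trans Pq) // perm_cons.
have := straightD Dr Dq.
by rewrite !cat_rcons addrA subrK.
Qed.

End Sorting.

Lemma straight_basis_word s : straight (size s) (basis_word s).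
Proof.
have [k] := ubnP (size s); elim: k s => // k IHk s lt_sk.
have [|t [St Pt Dt]] := @straight_sort (size s) _ s [::] (erefl _).
  by move=> r lt_rs; apply: IHk; apply: leq_trans lt_rs _.
rewrite -[basis_word s](subrK (basis_word t)); apply: straightD => // a m le_m.
apply: int_span_gen; left; exists a, t; split=> //.
by rewrite (perm_size Pt).
Qed.

(** One straightening pass raises the weight of the error by one, so it is repeated [t] times. The
    error is never removed; [aug_dvd] makes it p-adically small. *)
Theorem aug_straighten m t x : aug m x -> exists y z,
  [/\ int_span (ordered_gen m) y, aug (m + t) z & x = y + z].
Proof.
elim: t x => [|t IHt] x Jx.
  by exists 0, x; rewrite add0r addn0; split=> //; apply: int_span0.
have [y [z [Sy Jz ->]]] := IHt x Jx.
have /int_spanU[v [w [Sv Jw ->]]] : ordered_or_aug (m + t) z.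
  apply: int_span_sub Jz => _ [a [s [Hs le_m ->]]].
  apply: (@straight_word (size s) s) => // r <-.
  exact: straight_basis_word.
exists (y + v), w; rewrite addrA addnS; split=> //; apply: int_spanD => //.
apply: int_span_sub Sv => _ [a [s [Ss le_m ->]]]; apply: int_span_gen.
by exists a, s; split=> //; apply: leq_trans le_m; apply: leq_addr.
Qed.

End Straightening.

(** In characteristic p a p-group fixes a nonzero vector in every nonzero module. Hence a proper
    submodule killed by all long products can be enlarged, until it is the whole space. *)
Lemma pgroup_unipotent (F : fieldType) (p : nat) (gT : finGroupType)
    (G : {group gT}) n (rG : mx_representation F G n) :
  p \in [pchar F] -> (p.-group G)%g ->
  exists N, forall s, all (mem G) s -> (N <= size s)%N ->
    \prod_(h <- s) (rG h - 1 : 'M[F]_n) = 0.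
Proof.
move=> chFp pG.
suff [U [N [modU fullU UN]]] : exists (U : 'M[F]_n) N,
    [/\ mxmodule rG U, (n <= \rank U)%N & forall s, all (mem G) s ->
      (N <= size s)%N -> U *m \prod_(h <- s) (rG h - 1 : 'M[F]_n) = 0].
  exists N => s Gs le_N; have fU : row_full U by rewrite -col_leq_rank.
  by apply: (row_full_inj fU); rewrite UN // mulmx0.
suff: forall r, (r <= n)%N -> exists (U : 'M[F]_n) N,
    [/\ mxmodule rG U, (r <= \rank U)%N & forall s, all (mem G) s ->
      (N <= size s)%N -> U *m \prod_(h <- s) (rG h - 1 : 'M[F]_n) = 0].
  exact.
elim=> [_|r IHr lt_rn].
  by exists 0, 0; rewrite mxmodule0; split=> // s _ _; rewrite mul0mx.
have [U [N [modU le_rU UN]]] := IHr (ltnW lt_rn).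
case: (ltnP r (\rank U)) => [lt_rU | le_Ur]; first by exists U, N.
pose W := rfix_mx (factmod_repr modU) G.
have nzW : W != 0.
  apply: (rfix_pgroup_pchar chFp) => //.
  by rewrite mxrank_coker subn_gt0 (leq_ltn_trans le_Ur).
(* [Y] is the preimage of the fixed vectors of the quotient by [U], so each [rG h - 1] maps it into
   [U]: one more factor is enough. *)
pose Y := (U + val_factmod W)%MS; exists Y, N.+1.
have WU h : h \in G -> (val_factmod W *m (rG h - 1) <= U)%MS.
  move=> Gh; rewrite -in_factmod_eq0 mulmxBr mulmx1 linearB /= in_factmodJ //.
  rewrite val_factmodK -[factmod_mx _ h]/(factmod_repr modU h).
  by have /rfix_mxP-> := submx_refl W; rewrite ?subrr.
have YU h : h \in G -> (Y *m (rG h - 1) <= U)%MS.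
  move=> Gh; rewrite addsmxMr addsmx_sub WU // andbT mulmxBr mulmx1.
  by rewrite addmx_sub ?eqmx_opp ?(mxmoduleP modU).
split.
- apply/mxmoduleP => h Gh; rewrite -[rG h](subrK 1) mulmxDr mulmx1.
  by rewrite addmx_sub // (submx_trans (YU h Gh)) ?addsmxSl.
- apply: leq_ltn_trans le_rU _; apply: rank_ltmx.
  rewrite ltmxE addsmxSl addsmx_sub submx_refl /=.
  by rewrite -in_factmod_eq0 val_factmodK.
- case=> // h s /= /andP[Gh Gs] le_N; rewrite big_cons mulmxA.
  by have /submxP[D ->] := YU h Gh; rewrite -mulmxA UN ?mulmx0.
Qed.

(** * Finite differences *)

(* The sign is [(-1) ^+ (k - l)], without truncated subtraction. *)
Definition dcoef (k l : nat) : int := (-1) ^+ (k + l) * 'C(k, l)%:Z.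

Lemma expr_sub1 (R : pzRingType) (x : R) k N : (k < N)%N ->
  (x - 1) ^+ k = \sum_(l < N) x ^+ l *~ dcoef k l.
Proof.
move=> lt_kN; have cx1 : GRing.comm x (-1) by rewrite /GRing.comm mulrN1 mulN1r.
rewrite addrC exprDn_comm; last exact/commr_sym.
rewrite -(big_mkord xpredT (fun l => x ^+ l *~ dcoef k l)).
rewrite (big_cat_nat (n := k.+1)) //=.
rewrite [X in _ = _ + X]big1_seq ?addr0; last first.
  by move=> l /andP[_]; rewrite mem_index_iota => /andP[lt_kl _];
    rewrite /dcoef bin_small // mulr0 mulr0z.
rewrite big_mkord; apply: eq_bigr => l _; rewrite /dcoef.
have le_lk : (l <= k)%N by rewrite -ltnS.
rewrite mulrzA -pmulrn; congr (_ *+ _).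
rewrite -[in LHS]signr_odd -[in RHS]signr_odd oddB // oddD.
case: (odd k (+) odd l).
  by rewrite !expr1 mulN1r mulrN1z.
by rewrite !expr0 mul1r mulr1z.
Qed.

Lemma coef_XD1n (l m : nat) : (('X + 1 : {poly int}) ^+ l)`_m = 'C(l, m)%:Z.
Proof.
rewrite exprD1n.
under eq_bigr => i _ do rewrite -scaler_nat.
rewrite -(poly_def l.+1 (fun i => 'C(l, i)%:R : int)) coef_poly ltnS.
by case: leqP => [_|lt_lm]; rewrite ?natz // bin_small.
Qed.

(** Compare the coefficients of X^m in X^k = ((X + 1) - 1)^k. With [bin_dcoef], from X^l = ((X - 1)
    + 1)^l, this makes the binomial matrix and its signed version inverse to each other. *)
Lemma dcoef_bin (k m N : nat) : (k < N)%N ->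
  \sum_(l < N) dcoef k l * 'C(l, m)%:Z = (k == m)%:Z.
Proof.
move=> lt_kN; have := expr_sub1 ('X + 1 : {poly int}) lt_kN.
rewrite addrK => /(congr1 (fun q : {poly int} => q`_m)).
rewrite coefXn eq_sym coef_sum natz => ->; apply: eq_bigr => l _.
by rewrite coefMrz coef_XD1n mulrzz mulrC.
Qed.

Lemma bin_dcoef (l m N : nat) : (l < N)%N ->
  \sum_(k < N) 'C(l, k)%:Z * dcoef k m = (l == m)%:Z.
Proof.
move=> lt_lN; case: (ltnP m N) => [lt_mN | le_Nm]; last first.
  rewrite (ltn_eqF (leq_trans lt_lN le_Nm)) big1 // => k _.
  by rewrite /dcoef (@bin_small k) ?mulr0 // (leq_trans (ltn_ord k)).
have : 'X^l = \sum_(k < N) ('X - 1 : {poly int}) ^+ k *~ 'C(l, k)%:Z.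
  transitivity (\sum_(0 <= k < N) ('X - 1 : {poly int}) ^+ k *~ 'C(l, k)%:Z);
    last by rewrite big_mkord.
  rewrite -[X in X ^+ l](subrK 1) exprD1n.
  rewrite (big_cat_nat (n := l.+1)) //= [X in _ = _ + X]big1_seq ?addr0.
    by rewrite big_mkord.
  by move=> k /andP[_]; rewrite mem_index_iota => /andP[lt_lk _]; rewrite bin_small.
move=> /(congr1 (fun q : {poly int} => q`_m)).
rewrite coefXn eq_sym coef_sum natz => ->; apply: eq_bigr => k _.
rewrite coefMrz mulrzz mulrC; congr (_ * _).
rewrite (expr_sub1 _ (ltn_ord k)) coef_sum (bigD1 (Ordinal lt_mN)) //=.
rewrite coefMrz coefXn eqxx mulrzz mul1r big1 ?addr0 // => i ne_im.
rewrite coefMrz coefXn (_ : m == i = false) ?mul0rz //.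
by apply: contraNF ne_im => /eqP E; apply/eqP/val_inj.
Qed.

Section MultiIndex.
Variable d : nat.
Implicit Types k l m : {ffun 'I_d -> nat}.

Definition box N : seq {ffun 'I_d -> nat} :=
  [seq [ffun i => val (f i)] | f : {ffun 'I_d -> 'I_N}].

Lemma mem_box N k : (k \in box N) = [forall i, k i < N]%N.
Proof.
apply/mapP/forallP => [[f _ ->] i | lt_kN]; first by rewrite ffunE ltn_ord.
exists [ffun i => Ordinal (lt_kN i)]; first by rewrite mem_enum inE.
by apply/ffunP => i; rewrite !ffunE.
Qed.

Lemma box_uniq N : uniq (box N).
Proof.
rewrite map_inj_uniq ?enum_uniq // => f1 f2 /ffunP E.
by apply/ffunP => i; apply: val_inj; have := E i; rewrite !ffunE.
Qed.

Lemma sum_box (V : zmodType) N (F : {ffun 'I_d -> nat} -> V) :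
  \sum_(k <- box N) F k =
  \sum_(f : {ffun 'I_d -> 'I_N}) F [ffun i => val (f i)].
Proof. by rewrite /box /image_mem big_map big_enum. Qed.

Lemma prod_sum_box (R : pzRingType) N (F : 'I_d -> nat -> R) :
  \prod_i \sum_(j < N) F i j = \sum_(k <- box N) \prod_i F i (k i).
Proof.
rewrite bigA_distr_bigA sum_box; apply: eq_bigr => f _.
by apply: eq_bigr => i _; rewrite ffunE.
Qed.

Lemma sum_box_widen (V : zmodType) M N (F : {ffun 'I_d -> nat} -> V) :
  (M <= N)%N -> (forall k, k \notin box M -> F k = 0) ->
  \sum_(k <- box N) F k = \sum_(k <- box M) F k.
Proof.
move=> le_MN F0; rewrite (bigID (mem (box M))) /= [X in _ + X]big1 ?addr0 //.
rewrite -big_filter; apply: perm_big; apply: uniq_perm => [||k].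
- exact/filter_uniq/box_uniq.
- exact: box_uniq.
rewrite mem_filter andb_idr // !mem_box => /forallP lt_kM; apply/forallP => i.
exact: leq_trans (lt_kM i) le_MN.
Qed.

Definition mcoef k l : int := \prod_i dcoef (k i) (l i).

Definition mbin l k : nat := \prod_i 'C(l i, k i).

Definition mfact k : nat := \prod_i (k i)`!.

Lemma leq_mdegree k i : (k i <= mdegree k)%N.
Proof. by rewrite /mdegree (bigD1 i) //= leq_addr. Qed.

Lemma mem_box_mdegree k : k \in box (mdegree k).+1.
Proof. by rewrite mem_box; apply/forallP => i; rewrite ltnS leq_mdegree. Qed.

Lemma mfact_gt0 k : (0 < mfact k)%N.
Proof. by apply: prodn_gt0 => i; apply: fact_gt0. Qed.

Lemma mcoef_eq0 k l N : k \in box N -> l \notin box N -> mcoef k l = 0.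
Proof.
rewrite !mem_box => /forallP lt_kN /forallPn[i]; rewrite -leqNgt => le_N.
rewrite /mcoef (bigD1 i) //= /dcoef bin_small ?mulr0 ?mul0r //.
by rewrite (leq_trans (lt_kN i)).
Qed.

(** The mixed finite difference at 0, of order [k i] in the variable of index [i]. By [fdiff_box]
    any box containing [k] gives the same sum. *)
Definition fdiff (V : zmodType) k (F : {ffun 'I_d -> nat} -> V) : V :=
  \sum_(l <- box (mdegree k).+1) F l *~ mcoef k l.

Lemma fdiff_box (V : zmodType) k N (F : {ffun 'I_d -> nat} -> V) :
  k \in box N -> fdiff k F = \sum_(l <- box N) F l *~ mcoef k l.
Proof.
move=> kN; rewrite /fdiff; have kM := mem_box_mdegree k.
have E M : k \in box M -> (M <= maxn N (mdegree k).+1)%N ->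
    \sum_(l <- box M) F l *~ mcoef k l =
    \sum_(l <- box (maxn N (mdegree k).+1)) F l *~ mcoef k l.
  move=> kM' le_M; symmetry; apply: sum_box_widen => // l lM.
  by rewrite (mcoef_eq0 kM').
by rewrite !E // ?leq_maxl ?leq_maxr.
Qed.

Lemma fdiffB (V : zmodType) k (F1 F2 : {ffun 'I_d -> nat} -> V) :
  fdiff k (fun l => F1 l - F2 l) = fdiff k F1 - fdiff k F2.
Proof. by rewrite /fdiff -sumrB; apply: eq_bigr => l _; rewrite mulrzBl. Qed.

Lemma fdiff_additive (V W : zmodType) (f : {additive V -> W}) k F :
  f (fdiff k F) = fdiff k (fun l => f (F l)).
Proof. by rewrite raddf_sum; apply: eq_bigr => l _; rewrite raddfMz. Qed.

Lemma mbinZ l k : (mbin l k)%:Z = \prod_i 'C(l i, k i)%:Z.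
Proof. exact: (big_morph Posz PoszM (erefl _)). Qed.

Lemma prodz_delta l m : \prod_i (l i == m i)%:Z = (l == m)%:Z.
Proof.
case: eqP => [-> | /eqP ne_lm]; first by rewrite big1 // => i _; rewrite eqxx.
have /existsP[i ne_i] : [exists i, l i != m i].
  apply: contraR ne_lm => /existsPn E; apply/eqP/ffunP => i.
  by apply/eqP; rewrite -[_ == _]negbK E.
by rewrite (bigD1 i) //= (negPf ne_i) mul0r.
Qed.

Lemma newton (V : zmodType) N (F : {ffun 'I_d -> nat} -> V) l : l \in box N ->
  F l = \sum_(k <- box N) fdiff k F *+ mbin l k.
Proof.
move=> lN; transitivity (\sum_(m <- box N) F m *~ (l == m)).
  rewrite (bigD1_seq l) ?box_uniq //= eqxx mulr1z big1 ?addr0 // => m.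
  by rewrite eq_sym => /negPf->; rewrite mulr0z.
transitivity (\sum_(m <- box N) \sum_(k <- box N)
    F m *~ (mcoef k m * (mbin l k)%:Z)).
  rewrite !big_seq; apply: eq_bigr => m mN.
  rewrite -mulrz_sumr; congr (_ *~ _).
  rewrite -prodz_delta.
  have /forallP lt_lN : [forall i, l i < N]%N by rewrite -mem_box.
  under eq_bigr => i _ do rewrite -(bin_dcoef _ (lt_lN i)).
  rewrite (prod_sum_box N (fun i j => 'C(l i, j)%:Z * dcoef j (m i))).
  apply: eq_bigr => k _.
  by rewrite big_split /= mulrC mbinZ.
rewrite exchange_big; rewrite !big_seq; apply: eq_bigr => k kN.
rewrite (fdiff_box _ kN) -sumrMnl; apply: eq_bigr => m _.
by rewrite mulrzA pmulrn.
Qed.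

(** The bridge between the group ring and analysis: a linear functional takes on an ordered monomial
    in the x i - 1 the finite difference of its values on the ordered products of powers. *)
Lemma prod_expr_sub1 (R : pzRingType) (x : 'I_d -> R) k :
  \prod_i (x i - 1) ^+ k i = fdiff k (fun l => \prod_i x i ^+ l i).
Proof.
have lt_k i : (k i < (mdegree k).+1)%N by rewrite ltnS leq_mdegree.
under eq_bigr => i _ do rewrite (expr_sub1 _ (lt_k i)).
rewrite (prod_sum_box _ (fun i j => x i ^+ j *~ dcoef (k i) j)).
apply: eq_bigr => l _; rewrite /mcoef.
elim/big_rec3: _ => [|i a b c _ ->]; first by rewrite mulr1z.
by rewrite mulrzAl mulrzAr -mulrzA mulrC.
Qed.

Lemma fdiff_bin k m : fdiff k (fun l => (mbin l m)%:Z) = (k == m)%:Z.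
Proof.
have lt_k i : (k i < (mdegree k).+1)%N by rewrite ltnS leq_mdegree.
rewrite -prodz_delta.
under [RHS]eq_bigr => i _ do rewrite -(dcoef_bin (m i) (lt_k i)).
rewrite (prod_sum_box _ (fun i j => dcoef (k i) j * 'C(j, m i)%:Z)).
by apply: eq_bigr => l _; rewrite big_split /= mulrzz mulrC mbinZ.
Qed.

End MultiIndex.

(** * Nonarchimedean estimates *)

Section PadicField.
Local Open Scope classical_set_scope.
Variables (R : realType) (p : nat) (Qp : padicFieldType R p).
Hypothesis p_pr : prime p.
Implicit Types (x y : Qp) (n m : nat).
Local Notation abs := (@padic_abs R p Qp).

Lemma padic_abs0 : abs 0 = 0.
Proof. exact/padic_abs_eq0. Qed.

Lemma padic_abs1 : abs 1 = 1.
Proof. by rewrite -[1](@mulr1n Qp) padic_abs_nat // logn1 expr0 invr1. Qed.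

Lemma padic_absN x : abs (- x) = abs x.
Proof.
suff absN1 : abs (-1) = 1 by rewrite -mulN1r padic_absM absN1 mul1r.
have := padic_absM (-1 : Qp) (-1); rewrite mulrNN mulr1 padic_abs1.
move/esym/eqP; rewrite -expr2 sqrf_eq1 => /orP[/eqP //|/eqP E]; exfalso.
(* Positivity is not an axiom, so the value -1 for [abs (-1)] has to be excluded: it would force abs
   (- n) <= -1 for every n > 0, whereas abs (- p) would be -1/p. *)
have le_N1 n : abs (- n.+1%:R) <= -1.
  elim: n => [|n IHn]; first by rewrite E.
  rewrite -addn1 natrD opprD (le_trans (padic_absD _ _)) // ge_max IHn.
  by rewrite E lexx.
have := le_N1 p.-1; rewrite prednK ?prime_gt0 // -mulN1r padic_absM E mulN1r.
rewrite padic_abs_nat ?prime_gt0 // lerN2 logn_prime // eqxx expr1.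
have p_gt1 : (1 : R) < p%:R by rewrite ltr1n prime_gt1.
by rewrite leNgt invf_lt1 ?p_gt1 // (lt_trans _ p_gt1).
Qed.

Lemma padic_abs_ge0 x : 0 <= abs x.
Proof.
by rewrite -padic_abs0 -(subrr x) (le_trans (padic_absD _ _)) // padic_absN maxxx.
Qed.

Lemma padic_abs_gt0 x : (0 < abs x) = (x != 0).
Proof.
rewrite lt_def padic_abs_ge0 andbT; congr (~~ _).
by apply/eqP/eqP => /padic_abs_eq0.
Qed.

Lemma padic_absX x n : abs (x ^+ n) = abs x ^+ n.
Proof.
elim: n => [|n IHn]; first by rewrite !expr0 padic_abs1.
by rewrite !exprS padic_absM IHn.
Qed.

Lemma padic_absV x : abs x^-1 = (abs x)^-1.
Proof.
have [->|nz_x] := eqVneq x 0; first by rewrite invr0 padic_abs0 invr0.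
apply: (mulfI (x := abs x)); first by rewrite gt_eqF ?padic_abs_gt0.
by rewrite -padic_absM !divff ?padic_abs1 // gt_eqF ?padic_abs_gt0.
Qed.

Lemma padic_abs_p : abs p%:R = p%:R^-1.
Proof. by rewrite padic_abs_nat ?prime_gt0 // logn_prime // eqxx expr1. Qed.

Lemma padic_abs_pX n : abs (p%:R ^+ n) = p%:R ^- n.
Proof. by rewrite padic_absX padic_abs_p exprVn. Qed.

Lemma pR_gt0 : (0 : R) < p%:R.
Proof. by rewrite ltr0n prime_gt0. Qed.

Lemma pR_gt1 : (1 : R) < p%:R.
Proof. by rewrite ltr1n prime_gt1. Qed.

Lemma pVX_gt0 n : (0 : R) < p%:R ^- n.
Proof. by rewrite invr_gt0 exprn_gt0 ?pR_gt0. Qed.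

Lemma pVX_le m n : (m <= n)%N -> (p%:R ^- n : R) <= p%:R ^- m.
Proof.
move=> le_mn; rewrite lef_pV2 ?posrE ?exprn_gt0 ?pR_gt0 //.
by rewrite ler_weXn2l // ltW ?pR_gt1.
Qed.

Lemma pVX_small (e : R) : 0 < e -> exists n : nat, p%:R ^- n < e.
Proof.
move=> e_gt0; exists (Num.bound e^-1).
rewrite invf_plt ?posrE ?exprn_gt0 ?pR_gt0 //.
apply: (@lt_trans _ _ (Num.bound e^-1)%:R).
  by rewrite archi_boundP // invr_ge0 ltW.
by rewrite -natrX ltr_nat ltn_expl ?prime_gt1.
Qed.

Lemma padic_natr_neq0 n : (0 < n)%N -> (n%:R : Qp) != 0.
Proof.
by move=> n_gt0; rewrite -padic_abs_gt0 padic_abs_nat // invr_gt0 exprn_gt0 ?pR_gt0.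
Qed.

Lemma pQ_neq0 : (p%:R : Qp) != 0.
Proof. by rewrite padic_natr_neq0 ?prime_gt0. Qed.

Lemma padic_abs_nat_dvd n m : (p ^ m %| n)%N -> abs n%:R <= p%:R ^- m.
Proof.
case: n => [_|n dvd]; first by rewrite padic_abs0 ltW ?pVX_gt0.
by rewrite padic_abs_nat // pVX_le // -pfactor_dvdn.
Qed.

Lemma padic_abs_nat_le1 n : abs n%:R <= 1.
Proof.
by have := @padic_abs_nat_dvd n 0; rewrite expr0 invr1; apply; rewrite dvd1n.
Qed.

Lemma padic_abs_int_dvd (z : int) m :
  ((p ^ m)%N %| z)%Z -> abs z%:~R <= p%:R ^- m.
Proof.
case: z => n /= => [|dvd]; rewrite ?NegzE ?mulrNz ?padic_absN;
  exact: padic_abs_nat_dvd.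
Qed.

Lemma padic_abs_int_le1 (z : int) : abs z%:~R <= 1.
Proof.
by case: z => n; rewrite ?NegzE ?mulrNz ?padic_absN; apply: padic_abs_nat_le1.
Qed.

Section Ultranorm.
Variables (V : lmodType Qp) (nu : V -> R).

Definition ultranorm : Prop :=
  (forall (a : Qp) v, nu (a *: v) = abs a * nu v) /\
  (forall v w, nu (v + w) <= Num.max (nu v) (nu w)).

Hypothesis nuP : ultranorm.

Lemma ultranormZ a v : nu (a *: v) = abs a * nu v.
Proof. by case: nuP. Qed.

Lemma ultranormD v w : nu (v + w) <= Num.max (nu v) (nu w).
Proof. by case: nuP. Qed.

Lemma ultranorm0 : nu 0 = 0.
Proof. by rewrite -(scale0r 0) ultranormZ padic_abs0 mul0r. Qed.

Lemma ultranormN v : nu (- v) = nu v.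
Proof. by rewrite -scaleN1r ultranormZ padic_absN padic_abs1 mul1r. Qed.

Lemma ultranorm_ge0 v : 0 <= nu v.
Proof.
by rewrite -ultranorm0 -(subrr v) (le_trans (ultranormD _ _)) // ultranormN maxxx.
Qed.

Lemma ultranormD_le v w c : nu v <= c -> nu w <= c -> nu (v + w) <= c.
Proof. by move=> le_v le_w; rewrite (le_trans (ultranormD _ _)) // ge_max le_v. Qed.

Lemma ultranormB_le v w c : nu v <= c -> nu w <= c -> nu (v - w) <= c.
Proof. by move=> le_v le_w; apply: ultranormD_le; rewrite ?ultranormN. Qed.

Lemma ultranorm_trans u v w c :
  nu (u - v) <= c -> nu (v - w) <= c -> nu (u - w) <= c.
Proof. by move=> h1 h2; rewrite -(subrK v u) -addrA; apply: ultranormD_le. Qed.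

Lemma ultranorm_sum (I : Type) (r : seq I) (P : pred I) (F : I -> V) c :
  0 <= c -> (forall i, P i -> nu (F i) <= c) -> nu (\sum_(i <- r | P i) F i) <= c.
Proof.
move=> c0 Fc; elim/big_rec: _ => [|i x Pi IH]; first by rewrite ultranorm0.
by apply: ultranormD_le; first exact: Fc.
Qed.

Lemma ultranormZ_le a v b c : abs a <= b -> nu v <= c -> nu (a *: v) <= b * c.
Proof.
by move=> ab vc; rewrite ultranormZ ler_pM // ?padic_abs_ge0 ?ultranorm_ge0.
Qed.

Lemma ultranormMz_le (v : V) (z : int) c : nu v <= c -> nu (v *~ z) <= c.
Proof.
move=> vc; rewrite -scaler_int -[c]mul1r; apply: ultranormZ_le => //.
exact: padic_abs_int_le1.
Qed.

Lemma ultranorm_pX n v : nu (p%:R ^+ n *: v) = p%:R ^- n * nu v.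
Proof. by rewrite ultranormZ padic_abs_pX. Qed.

Lemma ultranorm_pX_le n v : (nu (p%:R ^+ n *: v) <= p%:R ^- n) = (nu v <= 1).
Proof. by rewrite ultranorm_pX ger_pMr ?pVX_gt0. Qed.

Lemma ultranorm_pVX_le n v : (nu (p%:R ^- n *: v) <= 1) = (nu v <= p%:R ^- n).
Proof.
rewrite -(ultranorm_pX_le n) scalerA divff ?scale1r //.
by rewrite expf_neq0 ?pQ_neq0.
Qed.

End Ultranorm.

Lemma padic_ultranorm : @ultranorm Qp^o abs.
Proof. by split; [exact: padic_absM | exact: padic_absD]. Qed.

Lemma padic_nbhsP x (A : set Qp) :
  nbhs x A <-> exists n : nat, [set y | abs (x - y) <= p%:R ^- n] `<=` A.
Proof.
rewrite -nbhs_entourageE /nbhs_ padic_entourageE; split.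
  case=> E [r /= r0 rE] EA; have [n n_r] := pVX_small r0; exists n => y /= xy.
  apply: EA; apply/xsectionP; apply: rE => /=; exact: le_lt_trans n_r.
case=> n nA; exists [set xy | abs (xy.1 - xy.2) < p%:R ^- n].
  by exists (p%:R ^- n) => //=; apply: pVX_gt0.
by move=> y /xsectionP /= /ltW; apply: nA.
Qed.

(** By density some rational [r] is close to [x]. As abs r <= 1, its reduced denominator is prime to
    [p], and inverting that denominator modulo p^n yields an integer. *)
Lemma padic_nat_dense x n :
  abs x <= 1 -> exists m : nat, abs (x - m%:R) <= p%:R ^- n.
Proof.
move=> x1.
have [r xr] : exists r : rat, abs (x - ratr r) <= p%:R ^- n.
  pose B := [set y : Qp | abs (x - y) <= p%:R ^- n].
  have xB : (B^°)%classic x by apply/padic_nbhsP; exists n.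
  have [|y [yB [r _ Er]]] :=
      @padic_rat_dense R p Qp (B^°)%classic _ (@open_interior _ B).
    by exists x.
  by exists r; rewrite Er; apply: (@interior_subset _ B).
have r1 : abs (ratr r : Qp) <= 1.
  rewrite -[X in abs X](subKr x); apply: (ultranormB_le padic_ultranorm) => //.
  by rewrite (le_trans xr) // invf_le1 ?exprn_gt0 ?pR_gt0 // exprn_ege1 ?ltW ?pR_gt1.
have D0 : (0 < `|denq r|)%N by rewrite absz_gt0 denq_neq0.
have absz_abs (z : int) : abs z%:~R = abs (`|z|%N)%:R.
  by case: z => k; rewrite ?NegzE ?mulrNz ?padic_absN ?abszN.
have denE : (denq r)%:~R = (`|denq r|%N)%:R :> Qp.
  by rewrite -[in LHS](gtz0_abs (denq_gt0 r)).
have Er : ratr r = (numq r)%:~R / (denq r)%:~R :> Qp by [].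
have pD : ~~ (p %| `|denq r|)%N.
  apply/negP => pD; have := coprime_num_den r.
  have [pN | pN] := boolP (p %| `|numq r|)%N.
    have : (p %| gcdn `|numq r| `|denq r|)%N by rewrite dvdn_gcd pN pD.
    rewrite /coprime => + /eqP E; rewrite E dvdn1 => /eqP p1.
    by have := prime_gt1 p_pr; rewrite p1.
  move=> _; move: r1; rewrite Er padic_absM padic_absV ler_pdivrMr ?mul1r; last first.
    by rewrite padic_abs_gt0 denE padic_natr_neq0.
  rewrite !absz_abs => le_nd.
  have N0 : (0 < `|numq r|)%N by case: (`|numq r|)%N pN; rewrite ?dvdn0.
  have := le_trans le_nd (@padic_abs_nat_dvd _ 1 pD).
  rewrite padic_abs_nat // lognE (negPf pN) !andbF expr0 invr1 expr1.
  by rewrite leNgt invf_lt1 ?pR_gt0 ?pR_gt1.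
have cop : coprime (p ^ n) `|denq r| by rewrite coprimeXl // prime_coprime.
(* [e] is 1 modulo p^n and divisible by the denominator, so the quotient of [e] by the denominator
   is an inverse of the latter modulo p^n. *)
pose e := chinese (p ^ n) `|denq r| 1 0.
have De : (`|denq r| %| e)%N.
  by rewrite /dvdn (chinese_modr cop) mod0n.
have pe : ((p ^ n)%N %| (e%:Z - 1))%Z.
  by rewrite -eqz_mod_dvd !modz_nat (chinese_modl cop).
have De1 : abs ((denq r)%:~R : Qp) = 1.
  by rewrite absz_abs padic_abs_nat // lognE (negPf pD) !andbF expr0 invr1.
pose z := numq r * (e %/ `|denq r|)%:Z.
have rz : abs (ratr r - z%:~R : Qp) <= p%:R ^- n.
  have -> : ratr r - z%:~R = (numq r)%:~R / (denq r)%:~R * - (e%:Z - 1)%:~R :> Qp.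
    have Ee : (e%:Z)%:~R = (e %/ `|denq r|)%:R * (denq r)%:~R :> Qp.
      by rewrite denE -natrM divnK.
    have -> : z%:~R = (numq r)%:~R * (e %/ `|denq r|)%:R :> Qp by rewrite rmorphM.
    rewrite Er rmorphB /= Ee; field.
    by rewrite -padic_abs_gt0 De1.
  rewrite -Er padic_absM padic_absN -[X in _ <= X]mul1r.
  apply: ler_pM => //; try exact: padic_abs_ge0.
  exact: padic_abs_int_dvd.
exists `|(z %% (p ^ n)%N)%Z|%N.
apply: (ultranorm_trans padic_ultranorm xr).
apply: (ultranorm_trans padic_ultranorm rz).
have pn0 : (p ^ n)%N != 0 :> int.
  by rewrite eqz_nat expn_eq0 negb_and -lt0n prime_gt0.
rewrite -[X in z%:~R - X]/(((`|(z %% (p ^ n)%N)%Z|%N)%:Z)%:~R) gez0_abs ?modz_ge0 //.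
rewrite {1}(divz_eq z (p ^ n)%N) -rmorphB /= addrK.
by apply: padic_abs_int_dvd; apply: dvdz_mull.
Qed.

End PadicField.

(** * Analytic functions with values in an ultrametric space *)

Lemma sum_triangle (V : zmodType) M (f : nat -> nat -> V) :
  \sum_(n < M) \sum_(i <- iota 0 n.+1) f i (n - i)%N =
  \sum_(i < M) \sum_(j < M - i) f i j.
Proof.
elim: M => [|M IHM]; first by rewrite !big_ord0.
rewrite big_ord_recr IHM -[iota 0 _.+1]/(index_iota 0 M.+1) big_mkord /=.
have -> : \sum_(i < M.+1) \sum_(j < M.+1 - i) f i j =
    \sum_(i < M.+1) (\sum_(j < M - i) f i j + f i (M - i)%N).
  by apply: eq_bigr => i _; rewrite subSn ?big_ord_recr // -ltnS.
by rewrite big_split /= [in RHS]big_ord_recr /= subnn big_ord0 addr0.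
Qed.

Section Analytic.
Local Open Scope classical_set_scope.
Variables (R : realType) (p : nat) (Qp : padicFieldType R p) (d : nat).
Hypothesis p_pr : prime p.
Local Notation abs := (@padic_abs R p Qp).
Local Notation vec := 'rV[Qp]_d.
Local Notation index := (multi_index d).

Definition fall (x : Qp) k : Qp := \prod_(j < k) (x - j%:R).

Definition mfall (z : vec) (k : index) : Qp := \prod_i fall (z 0 i) (k i).

Definition natvec (l : index) : vec := \row_i (l i)%:R.

Lemma natvec_Zp l : Zp_vec (natvec l).
Proof. by move=> i; rewrite /Defs.Zp /natvec /= mxE; apply: padic_abs_nat_le1. Qed.

Lemma fall_nat n k : fall n%:R k = (n ^_ k)%:R.
Proof.
rewrite /fall; case: (leqP k n) => [le_kn | lt_nk]; last first.
  by rewrite ffact_small // (bigD1 (Ordinal lt_nk)) //= subrr mul0r.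
rewrite ffact_prod natr_prod; apply: eq_bigr => j _.
by rewrite natrB // (leq_trans (ltnW (ltn_ord j))).
Qed.

Lemma mfall_nat l k : mfall (natvec l) k = (mbin l k * mfact k)%:R.
Proof.
rewrite /mfall /mbin /mfact -big_split natr_prod; apply: eq_bigr => i _.
by rewrite /natvec mxE fall_nat /= bin_ffact.
Qed.

Lemma fallS x k : fall x k.+1 = (x - k%:R) * fall x k.
Proof. by rewrite /fall big_ord_recr mulrC. Qed.

Definition delta_index (i : 'I_d) : index := [ffun j => (j == i : nat)].

Definition incr_index (k : index) i : index := [ffun j => k j + (j == i)]%N.

Lemma mfallS z k i : mfall z (incr_index k i) = (z 0 i - (k i)%:R) * mfall z k.
Proof.
rewrite /mfall (bigD1 i) //= [in RHS](bigD1 i) //= ffunE eqxx addn1 fallS.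
rewrite mulrA; congr (_ * _); apply: eq_bigr => j /negPf ne_ji.
by rewrite ffunE ne_ji addn0.
Qed.

Lemma mfall0 z : mfall z [ffun=> 0%N] = 1.
Proof. by rewrite /mfall big1 // => i _; rewrite ffunE /fall big_ord0. Qed.

Lemma mfall_delta z i : mfall z (delta_index i) = z 0 i.
Proof.
rewrite (_ : delta_index i = incr_index [ffun=> 0%N] i); last first.
  by apply/ffunP => j; rewrite !ffunE.
by rewrite mfallS mfall0 ffunE subr0 mulr1.
Qed.

Section Valued.
Variables (V : lmodType Qp) (nu : V -> R).
Hypothesis nuP : ultranorm nu.

Definition poly_ball (T : vec -> V) : Prop := exists s : seq (index * V),
  (forall x, x \in s -> nu x.2 <= 1) /\
  (forall z, T z = \sum_(x <- s) mfall z x.1 *: x.2).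

(* The unit ball of the completed tensor product of [V] with the convergent
   power series in [d] variables, as functions on [Zp_vec]. Falling factorials
   replace monomials because their coefficients, see [fcoef], are finite
   differences at 0 over factorials: they are unique and commute with linear
   maps. *)
Definition tate_ball (F : vec -> V) : Prop := exists T : nat -> vec -> V,
  (forall i, poly_ball (T i)) /\
  forall z, Zp_vec z -> forall e, exists M0, forall M, (M0 <= M)%N ->
    nu (F z - \sum_(i < M) p%:R ^+ i *: T i z) <= p%:R ^- e.

Lemma eq_poly_ball S T : (forall z, S z = T z) -> poly_ball S -> poly_ball T.
Proof. by move=> E [s [s1 Es]]; exists s; split=> // z; rewrite -E Es. Qed.

Lemma poly_ball_mfall k v : nu v <= 1 -> poly_ball (fun z => mfall z k *: v).
Proof.
move=> v1; exists [:: (k, v)]; split=> [x|z]; last by rewrite big_seq1.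
by rewrite inE => /eqP->.
Qed.

Lemma poly_ball0 : poly_ball (fun=> 0).
Proof. by exists [::]; split=> // z; rewrite big_nil. Qed.

Lemma poly_ballD S T : poly_ball S -> poly_ball T -> poly_ball (fun z => S z + T z).
Proof.
move=> [s [s1 Es]] [t [t1 Et]]; exists (s ++ t); split=> [x|z].
  by rewrite mem_cat => /orP[/s1|/t1].
by rewrite big_cat Es Et.
Qed.

Lemma poly_ball_sum (I : eqType) (r : seq I) (F : I -> vec -> V) :
  (forall i, i \in r -> poly_ball (F i)) -> poly_ball (fun z => \sum_(i <- r) F i z).
Proof.
elim: r => [|i r IHr] Fr.
  by apply: eq_poly_ball poly_ball0 => z; rewrite big_nil.
apply: (@eq_poly_ball (fun z => F i z + \sum_(j <- r) F j z)) => [z|].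
  by rewrite big_cons.
by apply: poly_ballD; [apply: Fr; rewrite mem_head|
  apply: IHr => j rj; apply: Fr; rewrite inE rj orbT].
Qed.

Lemma poly_ballZ a T : abs a <= 1 -> poly_ball T -> poly_ball (fun z => a *: T z).
Proof.
move=> a1 [s [s1 Es]]; exists [seq (x.1, a *: x.2) | x <- s]; split=> [x|z].
  case/mapP => y /s1 y1 -> /=; rewrite -[X in _ <= X]mulr1.
  exact: (ultranormZ_le p_pr nuP).
rewrite big_map Es scaler_sumr; apply: eq_bigr => x _ /=.
by rewrite !scalerA mulrC.
Qed.

(** From x * fall x k = fall x (k + 1) + k * fall x k, where the new coefficient [k] is integral. *)
Lemma poly_ball_mulX i T : poly_ball T -> poly_ball (fun z => z 0 i *: T z).
Proof.
move=> [s [s1 Es]].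
apply: (@eq_poly_ball (fun z => \sum_(x <- s) (mfall z (incr_index x.1 i) *: x.2
    + mfall z x.1 *: ((x.1 i)%:R *: x.2)))) => [z|].
  rewrite Es scaler_sumr; apply: eq_bigr => x _.
  rewrite mfallS !scalerA -scalerDl [mfall z x.1 * _]mulrC -mulrDl.
  by rewrite subrK.
apply: poly_ball_sum => x /s1 x1; apply: poly_ballD; apply: poly_ball_mfall => //.
rewrite -[X in _ <= X]mulr1; apply: (ultranormZ_le p_pr nuP) => //.
exact: padic_abs_nat_le1.
Qed.

Lemma poly_ball_mul_mfall k T : poly_ball T -> poly_ball (fun z => mfall z k *: T z).
Proof.
move=> PT; rewrite /mfall; elim: (index_enum _) => [|i r IHr].
  by apply: eq_poly_ball PT => z; rewrite big_nil scale1r.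
apply: (@eq_poly_ball (fun z => fall (z 0 i) (k i) *:
   (\prod_(j <- r) fall (z 0 j) (k j) *: T z))) => [z|].
  by rewrite big_cons scalerA.
elim: (k i) => [|n IHn].
  by apply: eq_poly_ball IHr => z; rewrite /fall big_ord0 scale1r.
apply: (@eq_poly_ball (fun z => z 0 i *: (fall (z 0 i) n *:
    (\prod_(j <- r) fall (z 0 j) (k j) *: T z))
    + - n%:R *: (fall (z 0 i) n *:
    (\prod_(j <- r) fall (z 0 j) (k j) *: T z)))) => [z|].
  by rewrite fallS -scalerDl scalerA.
apply: poly_ballD; first exact: poly_ball_mulX.
by apply: poly_ballZ => //; rewrite padic_absN // padic_abs_nat_le1.
Qed.

Lemma fall_le1 x k : abs x <= 1 -> abs (fall x k) <= 1.
Proof.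
move=> x1; rewrite /fall; elim/big_ind: _ => [|a b a1 b1|j _].
- by rewrite padic_abs1.
- by rewrite padic_absM mulr_ile1 // padic_abs_ge0.
- apply: (ultranormB_le p_pr (padic_ultranorm Qp)) => //.
  exact: padic_abs_nat_le1.
Qed.

Lemma mfall_le1 z k : Zp_vec z -> abs (mfall z k) <= 1.
Proof.
move=> z1; rewrite /mfall; elim/big_ind: _ => [|a b a1 b1|j _].
- by rewrite padic_abs1.
- by rewrite padic_absM mulr_ile1 // padic_abs_ge0.
- exact/fall_le1/z1.
Qed.

Lemma poly_ball_le1 T z : poly_ball T -> Zp_vec z -> nu (T z) <= 1.
Proof.
move=> [s [s1 ->]] z1; rewrite big_seq; apply: (ultranorm_sum nuP) => // x xs.
rewrite -[X in _ <= X]mulr1; apply: (ultranormZ_le p_pr nuP); last exact: s1.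
exact: mfall_le1.
Qed.

(** The terms of index at least [M] are bounded by p^-M, so mere convergence already gives this
    explicit rate. *)
Lemma pseries_strong (T : nat -> vec -> V) F z : (forall i, poly_ball (T i)) ->
  Zp_vec z -> (forall e, exists M0, forall M, (M0 <= M)%N ->
    nu (F z - \sum_(i < M) p%:R ^+ i *: T i z) <= p%:R ^- e) ->
  forall M, nu (F z - \sum_(i < M) p%:R ^+ i *: T i z) <= p%:R ^- M.
Proof.
move=> PT z1 lim M; have [M0 hM0] := lim M.
apply: (ultranorm_trans nuP (hM0 (maxn M0 M) (leq_maxl _ _))).
rewrite -!(big_mkord xpredT (fun i => p%:R ^+ i *: T i z)).
rewrite (big_cat_nat (leq0n M) (leq_maxr M0 M)) /= addrAC subrr add0r big_nat.
apply: (ultranorm_sum nuP); first by rewrite ltW // pVX_gt0.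
move=> i /andP[le_Mi _]; rewrite -[p%:R ^- M]mulr1.
apply: (ultranormZ_le p_pr nuP); last exact: poly_ball_le1.
by rewrite padic_abs_pX // pVX_le.
Qed.

Lemma tate_ballP F : tate_ball F <-> exists T : nat -> vec -> V,
  (forall i, poly_ball (T i)) /\ forall z M, Zp_vec z ->
    nu (F z - \sum_(i < M) p%:R ^+ i *: T i z) <= p%:R ^- M.
Proof.
split=> -[T [PT lim]]; exists T; split=> //.
  by move=> z M z1; apply: pseries_strong => //; apply: lim.
move=> z z1 e; exists e => M le_eM; apply: le_trans (lim z M z1) _.
exact: pVX_le.
Qed.

Lemma eq_tate_ball F F' : (forall z, Zp_vec z -> F z = F' z) ->
  tate_ball F -> tate_ball F'.
Proof.
move=> E [T [PT lim]]; exists T; split=> // z z1 e.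
by have [M0 h] := lim z z1 e; exists M0 => M /h; rewrite E.
Qed.

Lemma tate_ball_le1 F z : tate_ball F -> Zp_vec z -> nu (F z) <= 1.
Proof.
move=> /tate_ballP[T [_ lim]] z1; have := lim z 0%N z1.
by rewrite big_ord0 subr0 expr0 invr1.
Qed.

(** The ball is p-adically complete: expand each [F i] and regroup the double series by the total
    power of [p]. *)
Lemma tate_ball_series (F : nat -> vec -> V) G : (forall i, tate_ball (F i)) ->
  (forall z, Zp_vec z -> forall e, exists M0, forall M, (M0 <= M)%N ->
    nu (G z - \sum_(i < M) p%:R ^+ i *: F i z) <= p%:R ^- e) ->
  tate_ball G.
Proof.
move=> AF lim.
have /choice[T hT] i : exists T : nat -> vec -> V,
  (forall j, poly_ball (T j)) /\ forall z M, Zp_vec z ->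
    nu (F i z - \sum_(j < M) p%:R ^+ j *: T j z) <= p%:R ^- M.
  exact/tate_ballP.
exists (fun n z => \sum_(i <- iota 0 n.+1) T i (n - i)%N z); split=> [n|z z1 e].
  by apply: poly_ball_sum => i _; apply: (hT i).1.
have [M0 hM0] := lim z z1 e; exists (maxn M0 e) => M.
rewrite geq_max => /andP[/hM0 hM le_eM].
apply: (ultranorm_trans nuP hM).
have -> : \sum_(n < M) p%:R ^+ n *: (\sum_(i <- iota 0 n.+1) T i (n - i)%N z)
   = \sum_(i < M) p%:R ^+ i *: (\sum_(j < M - i) p%:R ^+ j *: T i j z).
  rewrite (eq_bigr (fun n : 'I_M => \sum_(i <- iota 0 n.+1)
      p%:R ^+ (i + (n - i)) *: T i (n - i)%N z)); last first.
    move=> n _; rewrite scaler_sumr !big_seq; apply: eq_bigr => i.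
    by rewrite mem_iota /= => le_in; rewrite subnKC.
  rewrite (sum_triangle M (fun i j => p%:R ^+ (i + j) *: T i j z)).
  apply: eq_bigr => i _; rewrite scaler_sumr; apply: eq_bigr => j _.
  by rewrite scalerA exprD.
rewrite -sumrB; apply: (ultranorm_sum nuP); first by rewrite ltW // pVX_gt0.
move=> i _; rewrite -scalerBr ultranorm_pX //.
apply: (@le_trans _ _ (p%:R ^- i * p%:R ^- (M - i))).
  by rewrite ler_pM2l ?pVX_gt0 //; apply: (hT i).2.
by rewrite -invfM -exprD subnKC ?pVX_le // ltnW.
Qed.

Lemma tate_ball_poly_ball T : poly_ball T -> tate_ball T.
Proof.
move=> PT; exists (fun i => if i == 0%N then T else fun=> 0); split=> [[|i]|z _ e] //.
  exact: poly_ball0.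
exists 1%N => -[//|M] _; rewrite big_ord_recl expr0 scale1r big1 ?addr0.
  by rewrite subrr (ultranorm0 nuP) ltW ?pVX_gt0.
by move=> i _; rewrite scaler0.
Qed.

Lemma tate_ballD F G : tate_ball F -> tate_ball G -> tate_ball (fun z => F z + G z).
Proof.
move=> /tate_ballP[S [PS hS]] /tate_ballP[T [PT hT]]; apply/tate_ballP.
exists (fun i z => S i z + T i z); split=> [i|z M z1]; first exact: poly_ballD.
have -> : \sum_(i < M) p%:R ^+ i *: (S i z + T i z) =
    \sum_(i < M) p%:R ^+ i *: S i z + \sum_(i < M) p%:R ^+ i *: T i z.
  by rewrite -big_split; apply: eq_bigr => i _; rewrite scalerDr.
by rewrite opprD addrACA; apply: (ultranormD_le nuP); [apply: hS | apply: hT].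
Qed.

Lemma tate_ball_sum (I : eqType) (r : seq I) (F : I -> vec -> V) :
  (forall i, i \in r -> tate_ball (F i)) ->
  tate_ball (fun z => \sum_(i <- r) F i z).
Proof.
elim: r => [|i r IHr] Fr.
  apply: (@eq_tate_ball (fun=> 0)) => [z _|]; first by rewrite big_nil.
  exact/tate_ball_poly_ball/poly_ball0.
apply: (@eq_tate_ball (fun z => F i z + \sum_(j <- r) F j z)) => [z _|].
  by rewrite big_cons.
by apply: tate_ballD; [apply: Fr; rewrite mem_head|
  apply: IHr => j rj; apply: Fr; rewrite inE rj orbT].
Qed.

Lemma tate_ballZ a F : abs a <= 1 -> tate_ball F -> tate_ball (fun z => a *: F z).
Proof.
move=> a1 /tate_ballP[S [PS hS]]; apply/tate_ballP.
exists (fun i z => a *: S i z); split=> [i|z M z1]; first exact: poly_ballZ.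
have -> : \sum_(i < M) p%:R ^+ i *: (a *: S i z) =
    a *: \sum_(i < M) p%:R ^+ i *: S i z.
  by rewrite scaler_sumr; apply: eq_bigr => i _; rewrite !scalerA mulrC.
rewrite -scalerBr -[_ ^- M]mul1r; apply: (ultranormZ_le p_pr nuP) => //.
exact: hS.
Qed.

Lemma tate_ball_split n F : tate_ball F -> exists T F', [/\ poly_ball T, tate_ball F' &
  forall z, F z = T z + p%:R ^+ n *: F' z].
Proof.
move=> [T [PT lim]]; exists (fun z => \sum_(i < n) p%:R ^+ i *: T i z).
have pn0 : (p%:R : Qp) ^+ n != 0 by rewrite expf_neq0 ?pQ_neq0.
exists (fun z => p%:R ^- n *: (F z - \sum_(i < n) p%:R ^+ i *: T i z)); split.
- have := @poly_ball_sum _ (index_enum 'I_n) (fun i z => p%:R ^+ i *: T i z).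
  apply=> i _; apply: poly_ballZ => //; rewrite padic_abs_pX // .
  by have := @pVX_le R p p_pr 0 i isT; rewrite expr0 invr1.
- exists (fun i => T (n + i)%N); split=> // z z1 e.
  have [M0 h] := lim z z1 (n + e)%N; exists M0 => M le_M.
  have := h (n + M)%N (leq_trans le_M (leq_addl _ _)).
  rewrite -!(big_mkord xpredT (fun i => p%:R ^+ i *: T i z)).
  rewrite (big_cat_nat (leq0n n) (leq_addr M n)) /= opprD addrA.
  have -> : \sum_(n <= i < n + M) p%:R ^+ i *: T i z =
      \sum_(0 <= i < M) p%:R ^+ (i + n) *: T (i + n)%N z.
    by rewrite -{1}[n]add0n big_addn addKn.
  move: (F z - _) => D hD.
  rewrite big_mkord in hD *.
  have -> : p%:R ^- n *: D - \sum_(i < M) p%:R ^+ i *: T (n + i)%N z =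
      p%:R ^- n *: (D - \sum_(0 <= i < M) p%:R ^+ (i + n) *: T (i + n)%N z).
    rewrite scalerBr scaler_sumr big_mkord; congr (_ - _); apply: eq_bigr => i _.
    by rewrite scalerA exprD mulrCA mulVf // mulr1 addnC.
  have -> : nu (p%:R ^- n *: (D - \sum_(0 <= i < M) p%:R ^+ (i + n) *: T (i + n)%N z))
      = p%:R ^+ n * nu (D - \sum_(0 <= i < M) p%:R ^+ (i + n) *: T (i + n)%N z).
    by rewrite (ultranormZ nuP) (padic_absV p_pr) (padic_abs_pX Qp p_pr) invrK.
  rewrite -(@ler_pM2l _ (p%:R ^- n)) ?pVX_gt0 // mulrA.
  rewrite mulVf ?mul1r ?expf_neq0 ?gt_eqF ?pR_gt0 //.
  by rewrite -invfM -exprD big_mkord.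
- by move=> z; rewrite scalerA divff // scale1r addrC subrK.
Qed.

Definition fcoef (k : index) (F : vec -> V) : V :=
  (mfact k)%:R^-1 *: fdiff k (fun l => F (natvec l)).

Lemma eq_fcoef k F G : (forall z, Zp_vec z -> F z = G z) -> fcoef k F = fcoef k G.
Proof.
move=> E; congr (_ *: _); apply: eq_bigr => l _.
by rewrite E //; apply: natvec_Zp.
Qed.

Lemma fcoefB k F G : fcoef k (fun z => F z - G z) = fcoef k F - fcoef k G.
Proof. by rewrite /fcoef fdiffB scalerBr. Qed.

Lemma fcoef_additive (f : V -> V) k F :
  (forall (a : Qp) v w, f (a *: v + w) = a *: f v + f w) ->
  fcoef k (fun z => f (F z)) = f (fcoef k F).
Proof.
move=> fl; pose f' : {linear V -> V} := HB.pack f (GRing.isLinear.Build _ _ _ _ f fl).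
rewrite -[f]/(f' : V -> V) /fcoef [in RHS]linearZ; congr (_ *: _).
by rewrite fdiff_additive.
Qed.

Lemma fcoefZ k a F : fcoef k (fun z => a *: F z) = a *: fcoef k F.
Proof.
apply: (fcoef_additive (f := fun v => a *: v)) => b v w.
by rewrite scalerDr !scalerA mulrC.
Qed.

Lemma fcoefD k F G : fcoef k (fun z => F z + G z) = fcoef k F + fcoef k G.
Proof.
rewrite /fcoef -scalerDr /fdiff -big_split; congr (_ *: _).
by apply: eq_bigr => l _; rewrite mulrzDl.
Qed.

Lemma fcoef_sum k (s : seq (index * V)) :
  fcoef k (fun z => \sum_(x <- s) mfall z x.1 *: x.2) =
  \sum_(x <- s | x.1 == k) x.2.
Proof.
elim: s => [|x s IHs].
  rewrite big_nil /fcoef /fdiff big1 ?scaler0 // => l _.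
  by rewrite big_nil mul0rz.
have -> : fcoef k (fun z => \sum_(y <- x :: s) mfall z y.1 *: y.2) =
   fcoef k (fun z => mfall z x.1 *: x.2 + \sum_(y <- s) mfall z y.1 *: y.2).
  by apply: eq_fcoef => z _; rewrite big_cons.
rewrite fcoefD IHs big_cons.
suff -> : fcoef k (fun z => mfall z x.1 *: x.2) = if x.1 == k then x.2 else 0.
  by case: eqP; rewrite ?add0r.
have -> : fcoef k (fun z => mfall z x.1 *: x.2) =
    (mfact k)%:R^-1 *: (((mfact x.1)%:R *: x.2) *~ (k == x.1)%:Z).
  rewrite -fdiff_bin /fdiff mulrz_sumr; congr (_ *: _).
  apply: eq_bigr => l _; rewrite mfall_nat mulrzz mulrzA; congr (_ *~ _).
  by rewrite natrM -scalerA scaler_nat pmulrn.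
rewrite eq_sym; case: eqP => [-> | _]; last by rewrite mulr0z scaler0.
rewrite mulr1z scalerA mulVf ?scale1r //.
by apply: padic_natr_neq0 => //; apply: mfact_gt0.
Qed.

Lemma poly_ball_fcoef T : poly_ball T -> exists r : seq index,
  forall z, T z = \sum_(k <- r) mfall z k *: fcoef k T.
Proof.
move=> [s [s1 Es]]; exists (undup [seq x.1 | x <- s]) => z.
rewrite Es; under [RHS]eq_bigr => k _.
  rewrite (eq_fcoef _ (fun z _ => Es z)) fcoef_sum scaler_sumr.
  over.
rewrite (exchange_big_dep xpredT) //= big_seq [RHS]big_seq; apply: eq_bigr => x xs.
rewrite (eq_bigl (pred1 x.1)) => [|k]; last by rewrite eq_sym.
rewrite big_mkcond (bigD1_seq x.1) ?undup_uniq ?mem_undup ?map_f //= eqxx.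
by rewrite big1 ?addr0 // => k /negPf->.
Qed.

Lemma fcoef_poly_ball_le1 k T : poly_ball T -> nu (fcoef k T) <= 1.
Proof.
move=> [s [s1 Es]]; rewrite (eq_fcoef _ (fun z _ => Es z)) fcoef_sum big_seq_cond.
by apply: (ultranorm_sum nuP) => // x /andP[/s1].
Qed.

Lemma fcoef_le1 k F : tate_ball F -> nu (fcoef k F) <= 1.
Proof.
(* Cutting at the valuation of k! lets the factor p^n of the remainder cancel the denominator in
   [fcoef]. *)
move=> AF; have [T [G [PT AG E]]] := tate_ball_split (logn p (mfact k)) AF.
rewrite (eq_fcoef _ (fun z _ => E z)) fcoefD.
apply: (ultranormD_le nuP); first exact: fcoef_poly_ball_le1.
rewrite fcoefZ scalerA -[X in _ <= X]mulr1; apply: (ultranormZ_le p_pr nuP).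
  rewrite padic_absM (padic_absV p_pr) (padic_abs_pX Qp p_pr).
  rewrite padic_abs_nat ?mfact_gt0 // invrK mulVf //.
  by rewrite expf_neq0 // gt_eqF ?pR_gt0.
apply: (ultranorm_sum nuP) => // l _; apply: (ultranormMz_le p_pr nuP).
exact/(tate_ball_le1 AG)/natvec_Zp.
Qed.

(** Modulo p^n the function is a polynomial whose coefficients agree with those of [F], hence are
    divisible by p^n. This is how congruences between coefficients become congruences modulo p^n in
    the lattice. *)
Lemma tate_ball_div n F : tate_ball F ->
  (forall k, nu (fcoef k F) <= p%:R ^- n) -> tate_ball (fun z => p%:R ^- n *: F z).
Proof.
move=> AF Fn; have [T [G [PT AG E]]] := tate_ball_split n AF.
have pn0 : (p%:R : Qp) ^+ n != 0 by rewrite expf_neq0 ?pQ_neq0.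
have [r Er] := poly_ball_fcoef PT.
apply: (@eq_tate_ball (fun z => \sum_(k <- r) mfall z k *: (p%:R ^- n *: fcoef k T)
    + G z)) => [z _|].
  rewrite E Er scalerDr scalerA mulVf // scale1r scaler_sumr; congr (_ + _).
  by apply: eq_bigr => k _; move: (fcoef k T) => c; rewrite !scalerA mulrC.
apply: tate_ballD => //; apply: tate_ball_poly_ball; apply: poly_ball_sum => k _.
apply: poly_ball_mfall; rewrite ultranorm_pVX_le //.
have -> : fcoef k T = fcoef k F - p%:R ^+ n *: fcoef k G.
  by rewrite (eq_fcoef _ (fun z _ => E z)) fcoefD fcoefZ addrK.
apply: (ultranormB_le p_pr nuP) => //; rewrite ultranorm_pX_le //.
exact: fcoef_le1.
Qed.

(** The coefficients of norm in ]p^-(M+1), p^-M] are finitely many and form the term of index [M] of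
    the series. The functions [P] are left open to serve both for monomials and for falling
    factorials. *)
Lemma tate_ball_null (c : index -> V) (P : index -> vec -> Qp) F :
  (forall k v, nu v <= 1 -> poly_ball (fun z => P k z *: v)) ->
  null_family (fun k => nu (c k)) -> (forall k, nu (c k) <= 1) ->
  (forall (M : nat) (A : {fset index}) z, Zp_vec z ->
    (forall k, k \in A = (p%:R ^- M < nu (c k))) ->
    nu (F z - \sum_(k <- A) P k z *: c k) <= p%:R ^- M) ->
  tate_ball F.
Proof.
move=> PP c0 c1 lim.
have fin M : finite_set [set k | p%:R ^- M < nu (c k)].
  apply: sub_finite_set (c0 _ (pVX_gt0 R p_pr M)) => k /=; exact: ltW.
pose A M := fset_set [set k | p%:R ^- M < nu (c k)].
have AE M k : k \in A M = (p%:R ^- M < nu (c k)).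
  rewrite in_fset_set //; apply/idP/idP => [/set_mem //|?]; exact/mem_set.
apply/tate_ballP; exists (fun M z =>
  \sum_(k <- A M.+1 | k \notin A M) P k z *: (p%:R ^- M *: c k)).
split=> [M|z M z1].
  apply: (@eq_poly_ball (fun z => \sum_(k <- [seq k <- A M.+1 | k \notin A M])
    P k z *: (p%:R ^- M *: c k))) => [z|]; first by rewrite big_filter.
  apply: poly_ball_sum => k; rewrite mem_filter AE -leNgt => /andP[le_M _].
  by apply: PP; rewrite ultranorm_pVX_le.
rewrite (_ : \sum_(i < M) _ = \sum_(k <- A M) P k z *: c k); first exact: lim.
elim: M => [|M IHM].
  rewrite big_ord0 big1_seq // => k /andP[_]; rewrite AE expr0 invr1.
  by rewrite ltNge c1.
rewrite big_ord_recr /= IHM [RHS](bigID (mem (A M))) /=; congr (_ + _).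
  rewrite -[RHS]big_filter; apply: perm_big; apply: uniq_perm => [||k].
  - exact: fset_uniq.
  - exact/filter_uniq/fset_uniq.
  rewrite mem_filter andb_idr // !AE; apply: le_lt_trans.
  by rewrite pVX_le.
rewrite scaler_sumr; apply: eq_bigr => k _.
rewrite !scalerA -mulrA mulrCA mulfV ?mulr1 //.
by rewrite expf_neq0 ?pQ_neq0.
Qed.

End Valued.

Section Product.
Variables (V : lmodType Qp) (nu : V -> R).
Hypothesis nuP : ultranorm nu.

Lemma poly_ball_mul (P : vec -> Qp^o) (T : vec -> V) :
  poly_ball (V := Qp^o) abs P -> poly_ball nu T -> poly_ball nu (fun z => P z *: T z).
Proof.
move=> [s [s1 Es]] PT.
apply: (@eq_poly_ball _ _ (fun z => \sum_(x <- s) x.2 *: (mfall z x.1 *: T z))) => [z|].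
  rewrite Es scaler_suml; apply: eq_bigr => x _.
  by rewrite !scalerA mulrC.
apply: poly_ball_sum => x /s1 x1; apply: poly_ballZ => //.
exact: poly_ball_mul_mfall.
Qed.

Lemma tate_ball_mul (f : vec -> Qp^o) (F : vec -> V) :
  tate_ball (V := Qp^o) abs f -> tate_ball nu F -> tate_ball nu (fun z => f z *: F z).
Proof.
move=> Af AF.
have AP P : poly_ball (V := Qp^o) abs P -> tate_ball nu (fun z => P z *: F z).
  move=> PP; have [T [PT lim]] := (tate_ballP nuP F).1 AF; apply/(tate_ballP nuP).
  exists (fun i z => P z *: T i z); split=> [i|z M z1]; first exact: poly_ball_mul.
  rewrite (_ : \sum_(i < M) _ = P z *: \sum_(i < M) p%:R ^+ i *: T i z).
    rewrite -scalerBr -[_ ^- M]mul1r; apply: (ultranormZ_le p_pr nuP) => //.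
      exact: (poly_ball_le1 (padic_ultranorm Qp) PP).
    exact: lim.
  by rewrite scaler_sumr; apply: eq_bigr => i _; rewrite !scalerA mulrC.
have [P [PP lim]] := (tate_ballP (padic_ultranorm Qp) f).1 Af.
apply: (tate_ball_series nuP (F := fun i z => P i z *: F z)) => [i|z z1 e].
  exact: AP.
exists e => M le_eM.
rewrite (_ : \sum_(i < M) _ = (\sum_(i < M) p%:R ^+ i *: P i z : Qp) *: F z).
  rewrite -scalerBl -[_ ^- e]mulr1; apply: (ultranormZ_le p_pr nuP).
    by apply: (le_trans (lim z M z1)); apply: pVX_le.
  exact: (tate_ball_le1 nuP).
by rewrite scaler_suml; apply: eq_bigr => i _; rewrite scalerA.
Qed.

End Product.

Lemma poly_ball_monomial (V : lmodType Qp) (nu : V -> R) k v : ultranorm nu ->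
  nu v <= 1 -> poly_ball nu (fun z : vec => monomial z k *: v).
Proof.
move=> nuP v1; rewrite /monomial; elim: (index_enum _) => [|i r IHr].
  apply: eq_poly_ball (poly_ball_mfall [ffun=> 0%N] v1) => z.
  by rewrite big_nil mfall0.
apply: (@eq_poly_ball _ _ (fun z =>
    (z 0 i ^+ k i * \prod_(j <- r) z 0 j ^+ k j) *: v)) => [z|].
  by rewrite big_cons.
elim: (k i) => [|n IHn].
  by apply: eq_poly_ball IHr => z; rewrite expr0 mul1r.
apply: eq_poly_ball (poly_ball_mulX nuP i IHn) => z.
by rewrite scalerA mulrA exprS.
Qed.

End Analytic.

(** * Differences of the coordinates modulo an open normal subgroup *)

Lemma prod_sorted (R : pzRingType) d (x : 'I_d -> R) (s : seq 'I_d) :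
  sorted leq (map val s) -> \prod_(i <- s) x i = \prod_i x i ^+ count_mem i s.
Proof.
have -> : \prod_i x i ^+ count_mem i s =
    \prod_(i <- enum 'I_d) x i ^+ count_mem i s.
  by rewrite enumT [index_enum _]unlock.
have : {subset s <= enum 'I_d}.
  by move=> i _; rewrite mem_enum inE.
have : sorted ltn (map val (enum 'I_d)) by rewrite val_enum_ord iota_ltn_sorted.
elim: (enum 'I_d) s => [|i r IHr] s Sr sr Ss.
  case: s sr {Ss} => [|j s] sr; first by rewrite !big_nil.
  by have := sr j (mem_head _ _).
have ir : i \notin r.
  apply/negP => ir; have /= := Sr; rewrite (path_sortedE ltn_trans) => /andP[/allP + _].
  by move/(_ (val i) (map_f _ ir)); rewrite ltnn.
have ltr j : j \in r -> (i < j)%N.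
  have /= := Sr; rewrite (path_sortedE ltn_trans) => /andP[/allP + _] jr.
  by apply; apply: map_f.
elim: s sr Ss => [|j t IHt] sr Ss.
  by rewrite big_nil big1.
have [Ej | ne_ji] := eqVneq j i.
  rewrite big_cons IHt; last exact: path_sorted Ss; last first.
    by move=> l lt; apply: sr; rewrite inE lt orbT.
  rewrite !big_cons /= Ej eqxx exprS mulrA; congr (_ * _).
  rewrite big_seq [RHS]big_seq; apply: eq_bigr => l lr.
  by rewrite (_ : (i == l) = false) //; apply: contraNF ir => /eqP->.
have i_t : i \notin j :: t.
  have jr : j \in r.
    by have := sr j (mem_head _ _); rewrite inE (negPf ne_ji).
  rewrite inE negb_or eq_sym ne_ji; apply/negP => it.
  have /= := Ss; rewrite (path_sortedE leq_trans) => /andP[/allP + _].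
  by move/(_ (val i) (map_f _ it)); rewrite leqNgt ltr.
rewrite [RHS]big_cons (count_memPn i_t) expr0 mul1r; apply: IHr => //.
  exact: path_sorted Sr.
move=> l ls; have := sr l ls; rewrite inE => /orP[/eqP El|//].
by rewrite El (negPf i_t) in ls.
Qed.

Lemma fdiff_morph d (V W : zmodType) (f : V -> W) (k : {ffun 'I_d -> nat}) F :
  (forall x y, f (x - y) = f x - f y) ->
  f (fdiff k F) = fdiff k (fun l => f (F l)).
Proof.
move=> fB; pose f' : {additive V -> W} :=
  HB.pack f (GRing.isZmodMorphism.Build _ _ f fB).
exact: (fdiff_additive f').
Qed.

Section FiniteLevel.
Variables (p m : nat) (H : {group 'S_m}).
Hypotheses (p_pr : prime p) (pH : (p.-group H)%g).

(** Modulo [p] the permutation matrices of [H] are unipotent, so every [N] consecutive letters of a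
    word contribute a factor [p]. *)
Lemma aug_dvd beta e : exists N, forall X : 'M[int]_m,
  aug H (fun s : 'S_m => perm_mx s : 'M[int]_m) p beta N X ->
  forall i j, ((p ^ e)%N %| X i j)%Z.
Proof.
pose u s : 'M[int]_m := perm_mx s.
have chp : p \in [pchar 'F_p] by apply: pchar_Fp.
have rP : mx_repr H (fun s : 'S_m => perm_mx s : 'M['F_p]_m).
  by split=> [|s t _ _]; rewrite ?perm_mx1 ?perm_mxM.
have [N hN] := pgroup_unipotent (MxRepresentation rP) chp pH.
have dvdN s : all (mem H) s -> (N <= size s)%N ->
    forall i j, (p%:Z %| aug_word u s i j)%Z.
  move=> Hs le_N i j; rewrite (dvdz_pcharf chp).
  have -> : (aug_word u s i j)%:~R = map_mx intr (aug_word u s) i j :> 'F_p by rewrite mxE.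
  have -> : map_mx intr (aug_word u s) = \prod_(h <- s) (perm_mx h - 1 : 'M['F_p]_m).
    rewrite /aug_word; elim/big_rec2: _ => [|h A B _ <-]; first by rewrite map_mx1.
    by rewrite map_mxM map_mxB map_mx1 map_perm_mx.
  by rewrite hN // mxE.
have dvdNe f s : all (mem H) s -> (N * f <= size s)%N ->
    forall i j, ((p ^ f)%N %| aug_word u s i j)%Z.
  elim: f s => [|f IHf] s Hs le_s i j; first by rewrite expn0 dvd1z.
  rewrite -(cat_take_drop N s) /aug_word big_cat /= mxE; apply: rpred_sum => l _.
  have le_N : (N <= size s)%N by apply: leq_trans le_s; rewrite mulnS leq_addr.
  move: Hs; rewrite -{1}(cat_take_drop N s) all_cat => /andP[Ht Hd].
  rewrite expnS PoszM; apply: dvdz_mul.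
    by apply: dvdN => //; rewrite size_take_min (minn_idPl le_N).
  by apply: IHf => //; rewrite size_drop; lia.
(* A generator of this weight has at least [N * e] letters, or else at least [e] explicit factors
   [p]. *)
exists (e + beta * (N * e))%N => X.
elim=> [_ [a [s [Hs le_a ->]]] i j||x y _ IHx _ IHy i j].
- rewrite -scaler_nat mxE natz -[_%:Z]intz.
  case: (leqP (N * e) (size s)) => [le_s | lt_s].
    by apply: dvdz_mull; apply: dvdNe.
  apply: dvdz_mulr; rewrite intz dvdzE /= dvdn_exp2l //; nia.
- by move=> i j; rewrite mxE dvdz0.
- by rewrite !mxE rpredB ?IHx ?IHy.
Qed.

Variables (R : realType) (Qp : padicFieldType R p).
Local Notation abs := (@padic_abs R p Qp).
Variables (beta d : nat) (g : 'I_d -> 'S_m).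
Hypotheses (beta_gt0 : (0 < beta)%N) (p_dvd : (p %| 'C(p ^ beta, 2))%N).
Hypothesis gH : forall i, g i \in H.
Hypothesis gen_g :
  forall x, x \in H -> exists n : 'I_d -> nat, x = (\prod_(i < d) g i ^+ n i)%g.
Hypothesis comm_q : forall x y, x \in H -> y \in H ->
  [~ x, y]%g \in <<[set (z ^+ (p ^ beta))%g | z in H]>>%g.
Variables (C : 'I_m -> Qp) (o : 'I_m) (i0 : 'I_d) (e : nat).
Hypothesis C_le1 : forall j, abs (C j) <= 1.
Hypothesis C_coord : forall l : multi_index d,
  abs (C ((\prod_(i < d) g i ^+ l i)%g o) - (l i0)%:R) <= p%:R ^- e.

Let u (s : 'S_m) : 'M[int]_m := perm_mx s.
(** The row [o] of the matrix of [s] has its only nonzero entry at [s o], so [ell] extends s |-> C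
    (s o) linearly. In the application [o] is the trivial coset and [C] an approximate coordinate on
    K / N. *)
Let ell (X : 'M[int]_m) : Qp := \sum_j (X o j)%:~R * C j.

Let ellB X Y : ell (X - Y) = ell X - ell Y.
Proof.
rewrite /ell -sumrB; apply: eq_bigr => j _.
by rewrite !mxE rmorphB mulrBl.
Qed.

Let ell_perm s : ell (u s) = C (s o).
Proof.
rewrite /ell (bigD1 (s o)) //= !mxE eqxx mul1r big1 ?addr0 // => j.
by rewrite !mxE eq_sym => /negPf->; rewrite mul0r.
Qed.

Let ell_mulrn X n : ell (X *+ n) = n%:R * ell X.
Proof.
rewrite /ell mulr_sumr; apply: eq_bigr => j _.
by rewrite mulmxnE rmorphMn /= mulrnAl mulr_natl.
Qed.

Let u1 : u 1%g = 1. Proof. exact: perm_mx1. Qed.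
Let uM : {morph u : x y / (x * y)%g >-> x * y}.
Proof. by move=> x y; rewrite /u perm_mxM. Qed.

Let u_prod (l : multi_index d) :
  \prod_i u (g i) ^+ l i = u (\prod_(i < d) g i ^+ l i)%g.
Proof.
rewrite (big_morph u uM u1); apply: eq_bigr => i _.
by elim: (l i) => [|n IHn]; rewrite ?expg0 ?expr0 ?u1 // expgS exprS uM IHn.
Qed.

Let padic_fdiff_le (k : multi_index d) F c : (forall l, abs (F l) <= c) -> 0 <= c ->
  abs (fdiff k F) <= c.
Proof.
move=> Fc c0; apply: (ultranorm_sum (padic_ultranorm Qp)) => // l _.
exact: (ultranormMz_le p_pr (padic_ultranorm Qp)).
Qed.

Let fdiff_coord (k : multi_index d) :
  fdiff k (fun l : multi_index d => (l i0)%:R : Qp) = (k == delta_index i0)%:R.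
Proof.
rewrite -[RHS]/((k == delta_index i0)%:Z%:~R) -fdiff_bin rmorph_sum; apply: eq_bigr => l _.
rewrite mulrzz rmorphM /= mulrzr; congr (_ *~ _); rewrite -[RHS]/((mbin l (delta_index i0))%:R).
congr (_%:R); rewrite /mbin (bigD1 i0) //= ffunE eqxx bin1 big1 ?muln1 // => i /negPf ne.
by rewrite ffunE ne bin0.
Qed.

(** By [prod_expr_sub1] the value on the word is a finite difference of a function within p^-e of l
    |-> l i0, whose only nonzero difference is the one of order [delta_index i0]. In that case the
    word has length one, and the first bound is p^-a. *)
Let ell_basis_word (s : seq 'I_d) a : sorted leq (map val s) ->
  (a + beta * size s >= beta)%N ->
  abs (ell (basis_word u g s *+ p ^ a))
    <= Num.max (p%:R ^- (a + beta * size s - beta)) (p%:R ^- e).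
Proof.
move=> Ss le_b; rewrite ell_mulrn /basis_word /aug_word big_map.
rewrite (prod_sorted (fun i => u (g i) - 1) Ss).
pose k : multi_index d := [ffun i => count_mem i s].
rewrite (eq_bigr (fun i => (u (g i) - 1) ^+ k i)) => [|i _]; last by rewrite ffunE.
rewrite prod_expr_sub1 (fdiff_morph _ _ ellB).
have -> : fdiff k (fun l => ell (\prod_i u (g i) ^+ l i)) =
   (k == delta_index i0)%:R + fdiff k (fun l : multi_index d =>
     C ((\prod_(i < d) g i ^+ l i)%g o) - (l i0)%:R).
  rewrite fdiffB -fdiff_coord addrC subrK; apply: eq_bigr => l _.
  by rewrite u_prod ell_perm.
rewrite mulrDr; apply: (le_trans (padic_absD _ _)).
rewrite ge_max !le_max; apply/andP; split; last first.
  apply/orP; right; rewrite padic_absM -[_ ^- e]mul1r.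
  apply: ler_pM; rewrite ?padic_abs_ge0 ?padic_abs_nat_le1 //.
  by apply: padic_fdiff_le => //; rewrite ltW ?pVX_gt0.
apply/orP; left; case: eqP => [Ek | _]; last first.
  by rewrite mulr0 padic_abs0 ltW ?pVX_gt0.
have -> : size s = 1%N.
  have Ec i : count_mem i s = (i == i0).
    by have := congr1 (fun f : multi_index d => f i) Ek; rewrite !ffunE.
  have : all (pred1 i0) s.
    apply/allP => i; rewrite -has_pred1 has_count Ec.
    by case: eqP => // ->; rewrite /= eqxx.
  by rewrite all_count => /eqP<-; rewrite Ec eqxx.
by rewrite muln1 addnK mulr1 natrX padic_abs_pX.
Qed.

(* The difference is the value of the coordinate functional [ell] on
   [(h - 1) * \prod_i (g i - 1) ^+ k i]. This has weight at least
   [beta * (mdegree k).+1], and [ell] sees only the words of length one among the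
   ordered words. *)
Lemma fdiff_translate h (k : multi_index d) : h \in H -> (beta * mdegree k <= e)%N ->
  abs (fdiff k (fun l => C ((h * \prod_(i < d) g i ^+ l i)%g o)
                       - C ((\prod_(i < d) g i ^+ l i)%g o)))
    <= p%:R ^- (beta * mdegree k).
Proof.
move=> Hh le_e.
pose X : 'M[int]_m := (u h - 1) * \prod_i (u (g i) - 1) ^+ k i.
have JX : aug H u p beta (beta * (mdegree k).+1) X.
  rewrite mulnS /X; apply: augM; first exact: (augB1 u p beta Hh).
  rewrite /mdegree big_distrr /=; elim/big_rec2: _ => [|i n A _ JA]; first exact: aug1.
  apply: augM JA; elim: (k i) => [|c IHc]; first by rewrite muln0; apply: aug1.
  by rewrite mulnS exprS; apply: augM => //; exact: (augB1 u p beta (gH i)).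
(* Beyond weight [N] the error left by the straightening has all its entries divisible by p^e. *)
have [N hN] := aug_dvd beta e.
have [y [z [Sy Jz EX]]] := aug_straighten u1 uM beta_gt0 p_dvd gH gen_g comm_q N JX.
have -> : fdiff k (fun l => C ((h * \prod_(i < d) g i ^+ l i)%g o)
                       - C ((\prod_(i < d) g i ^+ l i)%g o)) = ell X.
  rewrite /X prod_expr_sub1 (fdiff_morph (f := fun Y => (u h - 1) * Y)); last first.
    by move=> A B; rewrite mulrBr.
  rewrite (fdiff_morph _ _ ellB); apply: eq_bigr => l _.
  by rewrite u_prod mulrBl mul1r -uM ellB !ell_perm.
have -> : ell X = ell y - (- ell z).
  rewrite EX -[z in LHS]opprK ellB -[- z]sub0r ellB.
  rewrite /ell [in X in _ - (X - _)]big1 ?sub0r // => j _.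
  by rewrite mxE mul0r.
apply: (ultranormB_le p_pr (padic_ultranorm Qp)).
  elim: Sy => [_ [a [s [Ss le_s ->]]]||A B _ IHA _ IHB].
  - have le_b : (beta <= a + beta * size s)%N.
      by apply: leq_trans le_s; rewrite mulnS leq_addr.
    apply: (le_trans (ell_basis_word Ss le_b)).
    rewrite ge_max !pVX_le //; move: le_s; rewrite mulnS; lia.
  - rewrite /ell big1 ?padic_abs0 ?ltW ?pVX_gt0 // => j _.
    by rewrite mxE mul0r.
  - by rewrite ellB; apply: (ultranormB_le p_pr (padic_ultranorm Qp)).
rewrite padic_absN //; apply: (ultranorm_sum (padic_ultranorm Qp)).
  by rewrite ltW ?pVX_gt0.
move=> j _; rewrite padic_absM -[_ ^- _]mulr1; apply: ler_pM; rewrite ?padic_abs_ge0 //.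
apply: le_trans (pVX_le R p_pr le_e); apply: padic_abs_int_dvd => //.
by apply: hN; apply: aug_leq Jz; apply: leq_addl.
Qed.

End FiniteLevel.

Local Open Scope classical_set_scope.

(** * The completed tensor product *)

Section Tensor.
Variables (R : realType) (p : nat) (Qp : padicFieldType R p) (d : nat).
Hypothesis p_pr : prime p.
Local Notation abs := (@padic_abs R p Qp).
Local Notation vec := 'rV[Qp]_d.
Local Notation index := (multi_index d).

Lemma partial_sumE (V : zmodType) (I : choiceType) (u : I -> V) (A : {fset I}) :
  partial_sum u A = \sum_(k <- A) u k.
Proof. by rewrite /partial_sum [RHS]big_seq_fsetE. Qed.

Lemma has_sum_tail (I : choiceType) (u : I -> Qp) (s : Qp) M (A : {fset I}) :
  has_sum u s -> (forall k, k \notin A -> abs (u k) <= p%:R ^- M) ->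
  abs (s - \sum_(k <- A) u k) <= p%:R ^- M.
Proof.
move=> us uA; have nbs : nbhs s [set y : Qp | abs (s - y) <= p%:R ^- M].
  by apply/(padic_nbhsP p_pr); exists M.
have [B _ hB] := us _ nbs; have := hB (A `|` B)%fset (fsubsetUr _ _).
rewrite /= partial_sumE => h.
apply: (ultranorm_trans (padic_ultranorm Qp) h).
have -> : \sum_(k <- (A `|` B)%fset) u k =
    \sum_(k <- A) u k + \sum_(k <- (A `|` B)%fset | k \notin A) u k.
  rewrite (bigID (mem A)) /=; congr (_ + _).
  rewrite -big_filter; apply: perm_big; apply: uniq_perm => [||k].
  - exact/filter_uniq/fset_uniq.
  - exact: fset_uniq.
  by rewrite mem_filter in_fsetU; case: (k \in A).
by rewrite addrAC subrr add0r; apply: (ultranorm_sum (padic_ultranorm Qp)).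
Qed.

Lemma monomial_le1 (z : vec) k : Zp_vec z -> abs (monomial z k) <= 1.
Proof.
move=> z1; rewrite /monomial; elim/big_ind: _ => [|a b a1 b1|j _].
- by rewrite padic_abs1.
- by rewrite padic_absM mulr_ile1 // padic_abs_ge0.
- by rewrite padic_absX exprn_ile1 ?padic_abs_ge0 //; apply: z1.
Qed.

(** Serves the change of basis opposite to [poly_ball_monomial]: [Can_ball] speaks of monomials, so
    falling factorials have to be integral combinations of them. *)
Definition mono_span (f : vec -> Qp) : Prop := exists s : seq (index * Qp),
  (forall x, x \in s -> abs x.2 <= 1) /\
  (forall z, f z = \sum_(x <- s) x.2 * monomial z x.1).

Lemma eq_mono_span f h : (forall z, f z = h z) -> mono_span f -> mono_span h.
Proof. by move=> E [s [s1 Es]]; exists s; split=> // z; rewrite -E Es. Qed.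

Lemma monomialS (z : vec) k i : monomial z (incr_index k i) = z 0 i * monomial z k.
Proof.
rewrite /monomial (bigD1 i) //= [in RHS](bigD1 i) //= ffunE eqxx addn1 exprS.
rewrite mulrA; congr (_ * _); apply: eq_bigr => j /negPf ne_ji.
by rewrite ffunE ne_ji addn0.
Qed.

Lemma mono_span_mul i (c : Qp) f : abs c <= 1 -> mono_span f ->
  mono_span (fun z => (z 0 i - c) * f z).
Proof.
move=> c1 [s [s1 Es]].
exists ([seq (incr_index x.1 i, x.2) | x <- s] ++ [seq (x.1, - c * x.2) | x <- s]).
split=> [x|z].
  rewrite mem_cat => /orP[|] /mapP[y /s1 y1 ->] //=.
  by rewrite padic_absM padic_absN // mulr_ile1 // padic_abs_ge0.
rewrite big_cat !big_map /= -big_split Es mulr_sumr; apply: eq_bigr => x _ /=.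
by rewrite monomialS; ring.
Qed.

Lemma mono_span_mfall k : mono_span (fun z : vec => mfall z k).
Proof.
rewrite /mfall; elim: (index_enum _) => [|i r IHr].
  exists [:: ([ffun=> 0%N], 1)]; split=> [x|z].
    by rewrite inE => /eqP-> /=; rewrite padic_abs1.
  rewrite big_seq1 big_nil mul1r /monomial big1 // => i _.
  by rewrite ffunE expr0.
apply: (@eq_mono_span (fun z =>
    fall (z 0 i) (k i) * \prod_(j <- r) fall (z 0 j) (k j))) => [z|].
  by rewrite big_cons.
elim: (k i) => [|n IHn].
  by apply: eq_mono_span IHr => z; rewrite /fall big_ord0 mul1r.
apply: eq_mono_span (mono_span_mul i (@padic_abs_nat_le1 R p Qp p_pr n) IHn) => z.
by rewrite fallS mulrA.
Qed.

Section Coordinates.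
Variables (G : topologicalGroupType) (g : 'I_d -> G) (K : set G).
Hypothesis gK : set_bij (@Zp_vec R p Qp d) K (coordinates g).

Definition coord_of (x : G) : vec :=
  xget 0 [set z : vec | Zp_vec z /\ coordinates g z = x].

Lemma coordinatesK (z : vec) : Zp_vec z -> coord_of (coordinates g z) = z.
Proof.
move=> z1; have [_ gI _] := gK; rewrite /coord_of.
case: xgetP => [y _ [y1 E]|/(_ z) []//].
by apply: gI => //; apply/mem_set.
Qed.

Lemma coord_of_Zp x : K x -> Zp_vec (coord_of x).
Proof.
by have [_ _ gS] := gK; move=> /gS[z z1 <-]; rewrite coordinatesK.
Qed.

Lemma coord_ofK x : K x -> coordinates g (coord_of x) = x.
Proof.
by have [_ _ gS] := gK; move=> /gS[z z1 <-]; rewrite coordinatesK.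
Qed.

Lemma coordinates_K (z : vec) : Zp_vec z -> K (coordinates g z).
Proof. by have [gf _ _] := gK; apply: gf. Qed.

Lemma Can_ball_an f : Can_ball g f ->
  tate_ball (d := d) (V := Qp^o) abs (fun z => f (coordinates g z)).
Proof.
move=> [c [c0 c1] hc].
apply: (tate_ball_null p_pr (padic_ultranorm Qp) (c := c)
  (P := fun k (z : vec) => monomial z k)) => //.
  by move=> k v; apply: (poly_ball_monomial p_pr k (padic_ultranorm Qp)).
move=> M A z z1 AE.
have := has_sum_tail (M := M) (A := A) (hc z z1).
rewrite (eq_bigr (fun k => monomial z k *: (c k : Qp^o))) => [|k _]; last first.
  by rewrite mulrC.
apply=> k; rewrite AE -leNgt => ck; rewrite padic_absM -[_ ^- M]mulr1.
by apply: ler_pM; rewrite ?padic_abs_ge0 // monomial_le1.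
Qed.

Lemma mfall_Can k : Can_ball g (fun x => mfall (coord_of x) k).
Proof.
have [s [s1 Es]] := mono_span_mfall k.
pose c m := \sum_(x <- s | x.1 == m) x.2.
pose keys := [fset x.1 | x in s]%fset.
have cE z (A : {fset index}) : (keys `<=` A)%fset ->
    \sum_(m <- A) c m * monomial z m = mfall z k.
  move=> /fsubsetP kA; rewrite Es; under eq_bigr => m _ do rewrite mulr_suml.
  rewrite (exchange_big_dep xpredT) //= big_seq [RHS]big_seq; apply: eq_bigr => x xs.
  rewrite big_mkcond (bigD1_seq x.1) ?fset_uniq //=; last first.
    by apply: kA; apply/imfsetP; exists x.
  rewrite eqxx big1 ?addr0 // => m; rewrite eq_sym => /negPf ->//.
exists c; first split.
- move=> e e0; apply: (sub_finite_set _ (finite_fset keys)) => m /= cm.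
  apply/negPn/negP => mk; move: cm; rewrite leNgt => /negP; apply.
  rewrite /c big1_seq ?padic_abs0 // => x /andP[/eqP E xs].
  by case/negP: mk; apply/imfsetP; exists x.
- move=> m; rewrite /Defs.Zp /= /c big_seq_cond.
  by apply: (ultranorm_sum (padic_ultranorm Qp)) => // x /andP[/s1].
move=> z z1 U /nbhs_singleton Uz; exists keys => // A /= kA.
by rewrite /= partial_sumE cE //; move: Uz; rewrite coordinatesK.
Qed.

Section Banach.
Variable W : padicBanachType Qp.

Lemma bnorm_ultranorm : @ultranorm R p Qp W (@bnorm R p Qp W).
Proof. by split; [exact: bnormZ | exact: bnormD]. Qed.

Lemma tensor_ball_an (F : G -> W) : tensor_ball g K F ->
  tate_ball (d := d) (@bnorm R p Qp W) (fun z => F (coordinates g z)).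
Proof.
move=> [m [f [w [fC w1 FE]]]].
apply: (@eq_tate_ball _ _ _ _ _ _
  (fun z => \sum_(j <- index_enum 'I_m) f j (coordinates g z) *: w j)) => [z z1|].
  by rewrite FE //; apply: coordinates_K.
apply: (tate_ball_sum p_pr bnorm_ultranorm
  (F := fun j z => f j (coordinates g z) *: w j)) => j _.
apply: (tate_ball_mul p_pr bnorm_ultranorm (Can_ball_an (fC j))).
apply: (tate_ball_poly_ball p_pr bnorm_ultranorm).
apply: eq_poly_ball (poly_ball_mfall [ffun=> 0%N] (w1 j)) => z.
by rewrite mfall0 scale1r.
Qed.

Lemma poly_ball_tensor_ball (T : vec -> W) : poly_ball (@bnorm R p Qp W) T ->
  tensor_ball g K (fun x => T (coord_of x)).
Proof.
move=> [s [s1 Es]]; exists (size s).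
exists (fun j x => mfall (coord_of x) (tnth (in_tuple s) j).1).
exists (fun j => (tnth (in_tuple s) j).2); split=> [j|j|x _].
- exact: mfall_Can.
- by apply: s1; apply: mem_tnth.
- by rewrite Es big_tnth.
Qed.

(** The terms of the series are converted by [Can_ball_an] in one direction and by [mfall_Can] in
    the other, so both completions give the same functions. *)
Lemma ctensor_ballP (F : G -> W) : ctensor_ball g K F <->
  tate_ball (d := d) (@bnorm R p Qp W) (fun z => F (coordinates g z)).
Proof.
split=> [[t tB lim] | [T [PT lim]]].
  apply: (tate_ball_series p_pr bnorm_ultranorm
     (F := fun i z => t i (coordinates g z))) => [i|z z1 e].
    exact: tensor_ball_an.
  have /cvgrPdist_le /(_ _ (pVX_gt0 R p_pr e)) [M0 _ hM0] :=
    lim _ (coordinates_K z1).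
  exists M0 => M /hM0 /=; rewrite sub0r normrN big_mkord => h.
  by apply: le_trans h; apply: ler_norm.
exists (fun i x => T i (coord_of x)) => [i|x Kx]; first exact: poly_ball_tensor_ball.
apply/cvgrPdist_lt => e e0; have [n n_e] := pVX_small p_pr e0.
have [M0 hM0] := lim _ (coord_of_Zp Kx) n; exists M0 => // M /= /hM0.
rewrite coord_ofK // sub0r normrN big_mkord ger0_norm.
  by move=> h; apply: le_lt_trans n_e.
exact: (ultranorm_ge0 p_pr bnorm_ultranorm).
Qed.

End Banach.
End Coordinates.
End Tensor.

(** * Pro-p groups and their coordinates *)

Section TopologicalGroup.
Variable G : topologicalGroupType.
Implicit Types (N K U : set G) (x y h : G).
Local Open Scope group_scope.

Lemma nbhs_mulgl x N : nbhs (1 : G) N -> nbhs x [set y | N (x^-1 * y)].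
Proof.
move=> N1; have := @mulg_continuous G (x^-1, x); rewrite /continuous_at /= mulVg.
move=> /(_ _ N1) [[A B] /= [A1 B1] AB].
apply: filterS B1 => y By /=; apply: (AB (x^-1, y)); split=> //=.
exact: nbhs_singleton.
Qed.

Lemma subgroup1 K : subgroup K -> K 1.
Proof. by case. Qed.

Lemma subgroupM K : subgroup K -> forall x y, K x -> K y -> K (x * y).
Proof. by case. Qed.

Lemma subgroupV K : subgroup K -> forall x, K x -> K x^-1.
Proof. by case. Qed.

Lemma subgroupX K x n : subgroup K -> K x -> K (x ^+ n).
Proof.
move=> [K1 KM _] Kx; elim: n => [|n IHn]; first by rewrite expg0.
by rewrite expgS; apply: KM.
Qed.

Lemma open_subgroup N : subgroup N -> nbhs (1 : G) N -> open N.
Proof.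
move=> [N1 NM NV] nbN; rewrite openE => x Nx.
apply: filterS (nbhs_mulgl x nbN) => y /= Ny.
by rewrite -(mulKVg x y); apply: NM.
Qed.

Lemma conjg_continuous1 x U : nbhs (1 : G) U ->
  \forall k \near x & y \near (1 : G), U (y ^ k).
Proof.
move=> U1; have c1 := @invg_continuous G x.
have := @mulg_continuous G (x^-1, (1 * x)); rewrite /continuous_at /= mul1g mulVg.
move=> /(_ _ U1) [[A B] /= [A1 B1] AB].
have := @mulg_continuous G (1, x); rewrite /continuous_at /= mul1g.
move=> /(_ _ B1) [[C D] /= [C1 D1] CD].
have A' := c1 _ A1; exists ([set k | A k^-1 /\ D k], C) => /=.
  by split=> //; apply: filterI.
move=> [k y] /= [[Ak Dk] Cy]; rewrite conjgE.
by apply: (AB (k^-1, y * k)); split=> //=; apply: (CD (y, k)).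
Qed.

(** Compactness of [K] makes the intersection of all the K-conjugates of [N] a neighbourhood of
    1. *)
Lemma normal_core K N : subgroup K -> open K -> compact K -> subgroup N ->
  nbhs (1 : G) N -> exists M, [/\ subgroup M, open M, M `<=` N, M `<=` K &
    forall x y, M x -> K y -> M (x ^ y)].
Proof.
move=> [K1 KM KV] oK cK [N1 NM NV] nbN.
pose M := [set y | K y /\ forall k, K k -> N (y ^ k)].
have nbM : nbhs (1 : G) M.
  have := (compact_near_coveringP K).1 cK G (nbhs (1 : G))
    (fun y k => N (y ^ k)) _ (fun x _ => conjg_continuous1 x nbN).
  move=> /(_ (nbhs_filter _)) hN; have hK := open_nbhs_nbhs (conj oK K1).
  by apply: filterS (filterI hK hN) => y [Ky hy]; split=> // k /hy.
have sM : subgroup M.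
  split=> [|x y [Kx Nx] [Ky Ny]|x [Kx Nx]].
  - by split=> // k _; rewrite conj1g.
  - by split=> [|k Kk]; [apply: KM | rewrite conjMg; apply: NM; auto].
  - by split=> [|k Kk]; [apply: KV | rewrite conjVg; apply: NV; auto].
exists M; split=> //; first exact: open_subgroup.
- by move=> x [_ /(_ 1 K1)]; rewrite conjg1.
- by move=> x [].
- move=> x y [Kx Nx] Ky; split=> [|k Kk].
    by rewrite conjgE; apply: (KM _ _ (KV _ Ky)); apply: KM.
  by rewrite -conjgM; apply: Nx; apply: KM.
Qed.

(** * The permutation action of K on a finite quotient K / N *)

Section Quotient.
Variables (K N : set G) (p r : nat).
Hypotheses (p_pr : prime p) (sK : subgroup K) (sN : subgroup N).
Hypothesis N_open : open N.
Hypothesis N_normal : forall x y, N x -> K y -> N (x ^ y).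
Hypothesis card_KN : (left_cosets N K #= `I_(p ^ r))%card.

Let m := (p ^ r)%N.

Let K1 : K 1 := subgroup1 sK.
Let KM : forall x y, K x -> K y -> K (x * y) := subgroupM sK.
Let KV : forall x, K x -> K x^-1 := subgroupV sK.

Lemma coset_indexP : exists f : G -> 'I_m,
  (forall x y, K x -> K y -> (f x = f y <-> N (x^-1 * y))) /\
  (forall j, exists x, K x /\ f x = j).
Proof.
have /card_set_bijP[f [f1 fI fS]] := card_KN.
pose cos x : set G := [set x * y | y in N].
have cosK x : K x -> left_cosets N K (cos x) by move=> Kx; exists x.
have m_gt0 : (0 < m)%N by rewrite expn_gt0 prime_gt0.
exists (fun x => insubd (Ordinal m_gt0) (f (cos x))); split=> [x y Kx Ky|j].
  have fE z : K z -> val (insubd (Ordinal m_gt0) (f (cos z))) = f (cos z).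
    by move=> Kz; rewrite val_insubd; have /= -> := f1 _ (cosK z Kz).
  have <- : cos x = cos y <-> N (x^-1 * y).
    split=> [E | Nxy].
      have [n Nn <-] : cos x y by rewrite E; exists 1; [exact: subgroup1 | rewrite mulg1].
      by rewrite mulKg.
    apply/seteqP; split=> _ [n Nn <-].
      exists (y^-1 * x * n); last by rewrite -mulgA mulKVg.
      apply: (subgroupM sN) Nn; rewrite -[_ * x]invgK invMg invgK.
      exact: subgroupV.
    exists (x^-1 * y * n); last by rewrite -mulgA mulKVg.
    exact: (subgroupM sN).
  split=> [E | ->//]; apply: fI; try exact/mem_set/cosK.
  by rewrite -fE // E fE.
have [_ [x Kx <-] Ej] := fS j (ltn_ord j).
by exists x; split=> //; apply: val_inj; rewrite val_insubd /= [f _]Ej ltn_ord.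
Qed.

(* [K] acts on [K / N] by right multiplication, because permutations compose
   from left to right. *)
Lemma coset_permP : exists (pi : G -> 'S_m) (f : G -> 'I_m), [/\
  forall x y, K x -> K y -> (f x = f y <-> N (x^-1 * y)),
  forall j, exists x, K x /\ f x = j,
  forall x h, K x -> K h -> pi h (f x) = f (x * h) &
  forall h k, K h -> K k -> pi (h * k) = pi h * pi k].
Proof.
have [f [fE fS]] := coset_indexP.
have /choice[rep repP] : forall j, exists x, K x /\ f x = j by [].
have repK j : K (rep j) by case: (repP j).
have frep j : f (rep j) = j by case: (repP j).
have fM x h : K x -> K h -> f (rep (f x) * h) = f (x * h).
  move=> Kx Kh; apply/(fE _ _ (KM (repK _) Kh) (KM Kx Kh)).
  have /(fE _ _ (repK _) Kx) Nx : f (rep (f x)) = f x by [].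
  have := N_normal Nx Kh; rewrite conjgE invMg !mulgA.
  by rewrite -!mulgA.
have piP h : exists s : 'S_m, K h -> forall j, s j = f (rep j * h).
  have [Kh | nKh] := pselect (K h); last by exists 1.
  have inj : injective (fun j => f (rep j * h)).
    move=> i j /(fE _ _ (KM (repK i) Kh) (KM (repK j) Kh)) Nij.
    rewrite -(frep i) -(frep j); apply/(fE _ _ (repK i) (repK j)).
    have := N_normal Nij (KV Kh); rewrite conjgE invgK invMg.
    by rewrite !mulgA mulgV mul1g mulgK.
  by exists (perm inj) => _ j; rewrite permE.
have /choice[pi piE] := piP; exists pi, f; split=> // [x h Kx Kh|h k Kh Kk].
  by rewrite (piE _ Kh) fM.
apply/permP => j; rewrite permM (piE _ Kh) (piE _ Kk) (piE _ (KM Kh Kk)).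
by rewrite fM ?mulgA //; exact: KM.
Qed.

Variables (pi : G -> 'S_m) (f : G -> 'I_m).
Hypothesis fE : forall x y, K x -> K y -> (f x = f y <-> N (x^-1 * y)).
Hypothesis f_surj : forall j, exists x, K x /\ f x = j.
Hypothesis pi_f : forall x h, K x -> K h -> pi h (f x) = f (x * h).
Hypothesis piM : forall h k, K h -> K k -> pi (h * k) = pi h * pi k.

Lemma pi_eq h k : K h -> K k -> N (h^-1 * k) -> pi h = pi k.
Proof.
move=> Kh Kk Nhk; apply/permP => j; have [x [Kx <-]] := f_surj j.
rewrite !pi_f //; apply/fE; try exact: KM.
by rewrite invMg -mulgA mulKg.
Qed.

Lemma pi_1 : pi 1 = 1.
Proof. by apply: (mulgI (pi 1)); rewrite -piM ?mulg1 //; exact: K1. Qed.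

Lemma pi_V h : K h -> pi h^-1 = (pi h)^-1.
Proof.
move=> Kh; apply: (mulgI (pi h)).
by rewrite -piM ?mulgV ?pi_1 //; apply: KV.
Qed.

Lemma pi_X h n : K h -> pi (h ^+ n) = (pi h) ^+ n.
Proof.
move=> Kh; elim: n => [|n IHn]; first by rewrite !expg0 pi_1.
by rewrite !expgS piM ?IHn //; apply: subgroupX.
Qed.

Lemma pi_eq1 h : K h -> pi h = 1 -> N h.
Proof.
move=> Kh Eh; have := pi_f K1 Kh; rewrite Eh perm1 mul1g => /(fE K1 Kh).
by rewrite invg1 mul1g.
Qed.

Definition coset_perms : {set 'S_m} := [set s | `[< exists2 h, K h & s = pi h >]].

Lemma coset_permsP s : reflect (exists2 h, K h & s = pi h) (s \in coset_perms).
Proof. by rewrite inE; apply: asboolP. Qed.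

Lemma coset_perms_group_set : group_set coset_perms.
Proof.
apply/group_setP; split.
  by apply/coset_permsP; exists 1; [exact: K1 | rewrite pi_1].
move=> _ _ /coset_permsP[h Kh ->] /coset_permsP[k Kk ->].
by apply/coset_permsP; exists (h * k); [exact: KM | rewrite piM].
Qed.
Canonical coset_perms_group := Group coset_perms_group_set.

(** The action on cosets is regular: a permutation of the group is determined by the image of the
    trivial coset, which is arbitrary. *)
Lemma card_coset_perms : #|coset_perms| = (p ^ r)%N.
Proof.
have inj : {in coset_perms &, injective (fun s : 'S_m => s (f 1))}.
  move=> _ _ /coset_permsP[h Kh ->] /coset_permsP[k Kk ->].
  rewrite !pi_f ?mul1g //; try exact: K1.
  by move=> /(fE Kh Kk); apply: pi_eq.
rewrite -(card_in_imset inj) -[RHS]card_ord -cardsT; congr #|pred_of_set _|.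
apply/setP => j; rewrite inE; apply/imsetP; have [x [Kx <-]] := f_surj j.
exists (pi x); first by apply/coset_permsP; exists x.
by rewrite pi_f ?mul1g //; exact: K1.
Qed.

Lemma coset_perms_pgroup : p.-group coset_perms.
Proof. by rewrite /pgroup card_coset_perms pnatX pnat_id. Qed.

Lemma expg_pr_in h : K h -> N (h ^+ (p ^ r)).
Proof.
move=> Kh; apply: pi_eq1; first exact: subgroupX.
rewrite pi_X // -card_coset_perms; apply: expg_cardG.
by apply/coset_permsP; exists h.
Qed.

(** The closure in [generated] disappears in the quotient: the open coset of the commutator modulo
    [N] meets the abstract subgroup generated by the powers. *)
Lemma coset_perms_comm q (x y : 'S_m) :
  (forall x y, K x -> K y -> Defs.generated [set z ^+ q | z in K] [~ x, y]) ->
  x \in coset_perms -> y \in coset_perms ->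
  [~ x, y] \in <<[set z ^+ q | z in coset_perms]%SET>>%g.
Proof.
move=> powK /coset_permsP[h Kh ->] /coset_permsP[k Kk ->].
set Y := <<_>>%g; pose T := [set x | K x /\ pi x \in Y].
have Khk : K [~ h, k].
  by rewrite commgEl conjgE; do ![apply: KM | apply: KV].
have -> : [~ pi h, pi k] = pi [~ h, k].
  rewrite !commgEl !conjgE !piM ?pi_V //; do ?[apply: KM | apply: KV] => //.
have sT : smallest (@subgroup G) [set z ^+ q | z in K] `<=` T.
  move=> x' /(_ T); apply; split=> [|_ [z Kz <-]].
    split=> [|a b [Ka Ya] [Kb Yb]|a [Ka Ya]].
    - by split=> //; rewrite pi_1 group1.
    - by split; [apply: KM | rewrite piM ?groupM].
    - by split; [apply: KV | rewrite pi_V ?groupV].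
  split; first exact: subgroupX.
  rewrite pi_X // mem_gen //; apply/imsetP; exists (pi z) => //.
  by apply/coset_permsP; exists z.
have [s [Ss Ns]] := powK h k Kh Kk _ (nbhs_mulgl [~ h, k]
  (open_nbhs_nbhs (conj N_open (subgroup1 sN)))).
have [Ks Ys] := sT s Ss.
by rewrite (pi_eq Khk Ks Ns).
Qed.

End Quotient.
End TopologicalGroup.

(** * Powers with p-adic exponents in a pro-p group *)

Section PadicExp.
Variables (R : realType) (p : nat) (Qp : padicFieldType R p).
Hypothesis p_pr : prime p.
Local Notation abs := (@padic_abs R p Qp).
Variables (G : topologicalGroupType) (K : set G).
Hypotheses (hausG : hausdorff_space G) (proK : open_pro_p p K).

Let sK : subgroup K. Proof. by case: proK. Qed.

Lemma pro_p_normal_base U : nbhs (1%g : G) U -> exists N r,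
  [/\ subgroup N, open N, N `<=` U `&` K,
    forall x y, N x -> K y -> N (x ^ y)%g &
    (left_cosets N K #= `I_(p ^ r))%card].
Proof.
move=> U1; have [_ [oK cK] base delta_index] := proK.
have [N0 [oN0 sN0 N0U]] := base U U1.
have [|N [sN oN NN0 NK nN]] := @normal_core G K N0 sK oK cK sN0.
  by apply: open_nbhs_nbhs; split=> //; apply: subgroup1.
have [r cN] := delta_index N oN sN NK nN; exists N, r; split=> //.
by move=> x /NN0/N0U.
Qed.

Lemma pro_p_expg N r h : subgroup N -> open N -> N `<=` K ->
  (forall x y, N x -> K y -> N (x ^ y)%g) ->
  (left_cosets N K #= `I_(p ^ r))%card -> K h -> N (h ^+ (p ^ r))%g.
Proof.
move=> sN oN NK nN cN Kh.
have [pi [f [fE fS pif piM]]] := coset_permP p_pr sK sN nN cN.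
exact: (expg_pr_in sK fE fS pif piM Kh).
Qed.

Lemma padic_abs_dvd_nat n e : abs n%:R <= p%:R ^- e -> (p ^ e %| n)%N.
Proof.
case: n => [|n]; first by rewrite dvdn0.
rewrite padic_abs_nat // lef_pV2 ?posrE ?exprn_gt0 ?pR_gt0 //.
by rewrite ler_eXn2l ?pR_gt1 // pfactor_dvdn.
Qed.

Instance nat_near_filter n : ProperFilter (@nat_near R p Qp n%:R).
Proof.
split; first by move=> [U /nbhs_singleton Un /(_ n Un)].
apply: filter_from_filter; first by exists setT; exact: filterT.
move=> U V nU nV; exists (U `&` V); first exact: filterI.
by move=> k [].
Qed.

(** Naturals that are p-adically close differ by a multiple of p^r, and h^(p^r) lies in [N] because
    K / N has order p^r. The limit is unique as [G] is Hausdorff. *)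
Lemma padic_exp_nat h n : K h -> padic_exp h (n%:R : Qp) = (h ^+ n)%g.
Proof.
move=> Kh; have cvg_n : (h ^+ k)%g @[k --> nat_near (n%:R : Qp)] --> (h ^+ n)%g.
  move=> U nU.
  have U1 : nbhs (1%g : G) [set y | U (h ^+ n * y)%g].
    have := @mulg_continuous G ((h ^+ n)%g, 1%g); rewrite /continuous_at /= mulg1.
    move=> /(_ _ nU) [[A B] /= [A1 B1] AB].
    apply: filterS B1 => y By; apply: (AB ((h ^+ n)%g, y)); split=> //=.
    exact: nbhs_singleton.
  have [N [r [sN oN NUK nN cN]]] := pro_p_normal_base U1.
  have NK : N `<=` K by move=> x /NUK[].
  have Nr k : N (h ^+ (p ^ r * k))%g.
    by rewrite expgM; apply: subgroupX => //; apply: pro_p_expg.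
  exists [set y : Qp | abs (n%:R - y) <= p%:R ^- r].
    by apply/padic_nbhsP => //; exists r.
  move=> k /=; case: (leqP k n) => [le_kn | /ltnW le_nk].
    rewrite -natrB // => /padic_abs_dvd_nat/dvdnP[c Ec].
    have := Nr c; rewrite mulnC -Ec => /(subgroupV sN) /NUK[+ _] /=.
    rewrite /mkset.
    have -> : (h ^+ n * (h ^+ (n - k))^-1)%g = (h ^+ k)%g.
      by apply: (mulIg (h ^+ (n - k))%g); rewrite mulgKV -expgD subnKC.
    by [].
  rewrite -opprB padic_absN // -natrB // => /padic_abs_dvd_nat/dvdnP[c Ec].
  have := Nr c; rewrite mulnC -Ec => /NUK[+ _].
  by rewrite /mkset -expgD subnKC.
rewrite /padic_exp; case: xgetP => [y _ cvg_y|/(_ _ cvg_n)//].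
exact: (cvg_unique hausG cvg_y cvg_n).
Qed.

End PadicExp.

(** * Coordinates on K and the differences of their translates *)

Section Coordinates.
Variables (R : realType) (p : nat) (Qp : padicFieldType R p) (d : nat).
Hypothesis p_pr : prime p.
Local Notation abs := (@padic_abs R p Qp).
Local Notation vec := 'rV[Qp]_d.
Local Notation index := (multi_index d).
Variables (G : topologicalGroupType) (g : 'I_d -> G) (K : set G).
Local Notation crd := (@coord_of R p Qp d G g).
Hypotheses (hausG : hausdorff_space G) (proK : open_pro_p p K).
Hypothesis basis_g : ordered_basis Qp g K.

Let gKi i : K (g i). Proof. by case: basis_g. Qed.
Let homeo_g : homeomorphic_on (@Zp_vec R p Qp d) K (coordinates g).
Proof. by case: basis_g. Qed.
Let gK : set_bij (@Zp_vec R p Qp d) K (coordinates g).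
Proof. by case: homeo_g. Qed.
Let sK : subgroup K. Proof. by case: proK. Qed.

Definition basis_prod (l : index) : G := (\prod_(i < d) g i ^+ l i)%g.

Lemma coordinates_nat (l : index) : coordinates g (natvec Qp l) = basis_prod l.
Proof.
apply: eq_bigr => i _; rewrite /natvec mxE.
exact: (padic_exp_nat Qp p_pr hausG proK).
Qed.

Lemma basis_prod_K l : K (basis_prod l).
Proof.
by rewrite -coordinates_nat; apply: (coordinates_K gK); apply: natvec_Zp.
Qed.

Lemma coord_of_basis_prod l : crd (basis_prod l) = natvec Qp l.
Proof. by rewrite -coordinates_nat (coordinatesK gK) //; apply: natvec_Zp. Qed.

Lemma near_coord x e i : K x ->
  \forall y \near x, K y -> abs (crd y 0 i - crd x 0 i) <= p%:R ^- e.
Proof.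
move=> Kx; have [oZ oK _ homeo] := homeo_g.
pose B := [set z : vec | Zp_vec z /\ abs (crd x 0 i - z 0 i) <= p%:R ^- e].
have oB : open B.
  rewrite openE => z [Zz xz].
  have nZ : nbhs z (@Zp_vec R p Qp d) by apply: open_nbhs_nbhs.
  apply: filterI => //.
  exists (fun _ j => if j == i then [set y | abs (z 0 i - y) <= p%:R ^- e] else setT).
    move=> k j; rewrite (ord1 k); case: eqP => [-> | _]; last exact: filterT.
    by apply/padic_nbhsP => //; exists e.
  move=> y /(_ 0 i); rewrite eqxx /= => zy.
  exact: (ultranorm_trans (padic_ultranorm Qp) xz).
have oBK : open (coordinates g @` B) by apply/homeo => // z [].
have nB : nbhs x (coordinates g @` B).
  apply: open_nbhs_nbhs; split=> //; exists (crd x); last exact: (coord_ofK gK).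
  split; first exact: (coord_of_Zp gK).
  by rewrite subrr padic_abs0 ltW // pVX_gt0.
apply: filterS nB => _ [z [Zz xz] <-] _; rewrite (coordinatesK gK) //.
by rewrite -opprB padic_absN.
Qed.

Lemma near_coordinates z U : Zp_vec z -> nbhs (coordinates g z) U ->
  exists e : nat, forall z', Zp_vec z' ->
    (forall i, abs (z 0 i - z' 0 i) <= p%:R ^- e) -> U (coordinates g z').
Proof.
move=> Zz nU; have [oZ oK _ homeo] := homeo_g.
pose B := [set z' : vec | Zp_vec z' /\ (U°)%classic (coordinates g z')].
have oB : open B.
  apply/homeo; first by move=> ? [].
  have -> : coordinates g @` B = (U°)%classic `&` K.
    apply/seteqP; split=> [_ [z' [Zz' Uz'] <-]|x [Ux Kx]].
      by split=> //; apply: (coordinates_K gK).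
    exists (crd x); last exact: (coord_ofK gK).
    by split; [exact: (coord_of_Zp gK) | rewrite (coord_ofK gK)].
  by apply: openI => //; apply: open_interior.
have [P nP PB] : nbhs z B by apply: open_nbhs_nbhs.
have /choice[e eP] i : exists n : nat,
    [set y | abs (z 0 i - y) <= p%:R ^- n] `<=` P 0 i.
  exact/(padic_nbhsP p_pr)/nP.
exists (\max_i e i)%N => z' Zz' zz'; apply: interior_subset; apply: (PB z' _).2.
move=> k i; rewrite (ord1 k); apply: eP => /=; apply: le_trans (zz' i) _.
by apply: pVX_le => //; apply: leq_bigmax.
Qed.

Lemma nat_approx z e : Zp_vec z ->
  exists l : index, forall i, abs (z 0 i - natvec Qp l 0 i) <= p%:R ^- e.
Proof.
move=> Zz; have /choice[n nP] i : exists n : nat, abs (z 0 i - n%:R) <= p%:R ^- e.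
  by apply: padic_nat_dense => //; apply: Zz.
by exists [ffun i => n i] => i; rewrite /natvec mxE ffunE.
Qed.

(** Uniform continuity on the compact group [K]: up to p^-e the coordinate is a function on the
    finite quotient K / N, where group ring arguments apply. *)
Lemma coord_uniform e i : exists N r, [/\ [/\ subgroup N, open N & N `<=` K],
  forall x y, N x -> K y -> N (x ^ y)%g,
  (left_cosets N K #= `I_(p ^ r))%card &
  forall x y, K x -> N y -> abs (crd (x * y)%g 0 i - crd x 0 i) <= p%:R ^- e].
Proof.
have [_ [oK cK] _ _] := proK.
have nearK x : K x -> \forall x' \near x & y \near (1%g : G),
    K x' -> K y -> abs (crd (x' * y)%g 0 i - crd x' 0 i) <= p%:R ^- e.
  move=> Kx; have nx := near_coord e i Kx.
  have := @mulg_continuous G (x, 1%g); rewrite /continuous_at /= mulg1.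
  move=> /(_ _ nx) [[A B] /= [A1 B1] AB].
  exists (A `&` [set x' | K x' -> abs (crd x' 0 i - crd x 0 i) <= p%:R ^- e], B).
    by split=> //; apply: filterI.
  move=> [x' y] /= [[Ax' xx'] By] Kx' Ky.
  apply: (ultranorm_trans (padic_ultranorm Qp) (AB (x', y) _ _)) => //.
    exact: subgroupM.
  by rewrite -opprB padic_absN //; apply: xx'.
have := (compact_near_coveringP K).1 cK G (nbhs (1%g : G))
  (fun y x => K x -> K y -> abs (crd (x * y)%g 0 i - crd x 0 i) <= p%:R ^- e) _ nearK.
move=> /(_ (nbhs_filter _)) /(pro_p_normal_base proK) [N [r [sN oN NU nN cN]]].
exists N, r; split=> //; first by split=> // x /NU[].
by move=> x y Kx /NU[Uy Ky]; apply: Uy.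
Qed.

(* [p ^ powerful_exponent] is the exponent in the definition of [powerful]. *)
Definition powerful_exponent : nat := if p == 2%N then 2%N else 1%N.

Lemma powerful_exponentE : (if p == 2%N then 4%N else p) = (p ^ powerful_exponent)%N.
Proof. by rewrite /powerful_exponent; case: eqP => [->|]. Qed.

Lemma powerful_exponent_gt0 : (0 < powerful_exponent)%N.
Proof. by rewrite /powerful_exponent; case: ifP. Qed.

Lemma powerful_exponent_bin2 : (p %| 'C(p ^ powerful_exponent, 2))%N.
Proof.
rewrite /powerful_exponent; case: eqP => [->//|/eqP p2].
by rewrite expn1 prime_dvd_bin //= ltn_neqAle eq_sym p2 prime_gt1.
Qed.

(** The estimate [fdiff_translate] in K / N, with [N] fine enough for the target precision: [C]
    reads the coordinate on coset representatives, hence up to p^-e. *)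
Lemma fdiff_coord_translate (h : G) (k : index) i : K h -> powerful p K ->
  abs (fdiff k (fun l => crd (h * basis_prod l)%g 0 i - (l i)%:R))
    <= p%:R ^- (powerful_exponent * mdegree k).
Proof.
move=> Kh powK; set beta := powerful_exponent; set e := (beta * _)%N.
have [N [r [[sN oN NK] nN cN uN]]] := coord_uniform e i.
have [pi [f [fE fS pif piM]]] := coset_permP p_pr sK sN nN cN.
pose H := coset_perms_group sK piM.
have /choice[rep repP] := fS.
pose C j := crd (rep j) 0 i.
have Hpi x : K x -> pi x \in H by move=> Kx; apply/coset_permsP; exists x.
have CE x : K x -> abs (C (f x) - crd x 0 i) <= p%:R ^- e.
  move=> Kx; have [Kr Er] := repP (f x).
  have /(fE _ _ Kx Kr) Nx : f x = f (rep (f x)) by [].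
  by rewrite /C -{1}(mulKVg x (rep (f x))); apply: uN.
have piprod (l : index) : (\prod_(j < d) pi (g j) ^+ l j)%g = pi (basis_prod l).
  rewrite /basis_prod; suff [] : K (\prod_(j < d) g j ^+ l j)%g /\
      (\prod_(j < d) pi (g j) ^+ l j)%g = pi (\prod_(j < d) g j ^+ l j)%g by [].
  elim: (index_enum _) => [|j s [Ks IHs]].
    by rewrite !big_nil (pi_1 sK piM); split=> //; exact: subgroup1.
  have Kj := subgroupX (l j) sK (gKi j).
  rewrite !big_cons IHs -(pi_X sK piM) // -piM //; split=> //.
  exact: subgroupM.
have piE x : K x -> pi x (f 1%g) = f x.
  by move=> Kx; rewrite pif ?mul1g //; exact: subgroup1.
(* Natural exponents suffice in the quotient: naturals are dense in Zp, [coordinates] is continuous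
   and the cosets of [N] are open. *)
have gen x : x \in H ->
    exists n : 'I_d -> nat, x = (\prod_(j < d) pi (g j) ^+ n j)%g.
  move=> /coset_permsP[x' Kx' ->].
  have := @near_coordinates (crd x') [set y | N (x'^-1 * y)%g] (coord_of_Zp gK Kx').
  rewrite (coord_ofK gK Kx') => /(_ (nbhs_mulgl _ _)) [|e' he'].
    by apply: open_nbhs_nbhs; split=> //; apply: subgroup1.
  have [l hl] := nat_approx e' (coord_of_Zp gK Kx').
  exists l; rewrite piprod; apply: (pi_eq sK fE fS pif) => //.
    exact: basis_prod_K.
  rewrite -coordinates_nat; apply: he' => //; exact: natvec_Zp.
have comm x y : x \in H -> y \in H ->
    [~ x, y]%g \in <<[set (z ^+ (p ^ beta))%g | z in H]%SET>>%g.
  apply: (coset_perms_comm sK sN oN fE fS pif piM) => x' y' Kx' Ky'.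
  by rewrite -powerful_exponentE; apply: powK.
have C1 j : abs (C j) <= 1 by apply: (coord_of_Zp gK); case: (repP j).
have CC l : abs (C ((\prod_(j < d) pi (g j) ^+ (l : index) j)%g (f 1%g)) - (l i)%:R)
    <= p%:R ^- e.
  rewrite piprod piE; last exact: basis_prod_K.
  have := CE _ (basis_prod_K l); rewrite coord_of_basis_prod.
  by rewrite /natvec mxE.
have main := fdiff_translate p_pr
  (coset_perms_pgroup p_pr sK fE fS pif : (p.-group H)%g)
  powerful_exponent_gt0 powerful_exponent_bin2 (fun j => Hpi _ (gKi j)) gen comm C1 CC
  (Hpi _ Kh) (leqnn _).
(* Replacing [C] by the true coordinate changes each value by at most p^-e, and so does it for the
   difference, an integral combination of values. *)
set F := (fun l => _) in main.
rewrite -[X in abs X](subrK (fdiff k F)) -fdiffB.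
apply: (ultranormD_le (padic_ultranorm Qp)) => //.
apply: (ultranorm_sum (padic_ultranorm Qp)) => [|l _]; first by rewrite ltW ?pVX_gt0.
apply: (ultranormMz_le p_pr (padic_ultranorm Qp)).
have Khl : K (h * basis_prod l)%g by apply: subgroupM => //; apply: basis_prod_K.
rewrite /F piprod -piM //; last exact: basis_prod_K.
rewrite !piE //; last exact: basis_prod_K.
rewrite opprB addrACA [- _ + _]addrC addrACA.
apply: (ultranormD_le (padic_ultranorm Qp)).
  by rewrite -opprB padic_absN //; apply: CE.
have := CE _ (basis_prod_K l); rewrite coord_of_basis_prod /natvec mxE.
by [].
Qed.

End Coordinates.

(** * Mahler expansions and substitution *)

Lemma logn_fact_le p n : prime p -> (p.-1 * logn p n`! <= n)%N.
Proof.
move=> p_pr; rewrite logn_fact //.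
(* The added term makes the induction telescope: with q = n %/ p^(m+1), (p - 1) q + q <= n %/
   p^m. *)
suff : (p.-1 * (\sum_(1 <= k < n.+1) n %/ p ^ k) + n %/ p ^ n <= n)%N.
  by apply: leq_trans; apply: leq_addr.
elim: {1 4}n => [|m IHm]; first by rewrite big_geq // muln0 expn0 divn1.
rewrite big_nat_recr //= mulnDr -addnA; apply: leq_trans IHm.
rewrite leq_add2l -mulSnr prednK ?prime_gt0 // expnSr divnMA mulnC.
exact: leq_trunc_div.
Qed.

(** Here beta beats the factorials: the valuation of k! is at most |k|/(p - 1), which leaves beta
    |k| a surplus of |k|/2. Coefficients divided by k! thus tend to zero. *)
Lemma logn_mfact_le p d (k : {ffun 'I_d -> nat}) : prime p ->
  (2 * logn p (mfact k) + mdegree k <= 2 * (powerful_exponent p * mdegree k))%N.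
Proof.
move=> p_pr; rewrite /mfact /mdegree; elim: (index_enum _) => [|i r IHr].
  by rewrite !big_nil logn1 !muln0.
rewrite !big_cons lognM ?fact_gt0 ?prodn_gt0 // => [|j]; last exact: fact_gt0.
have := logn_fact_le (k i) p_pr; rewrite /powerful_exponent in IHr *.
case: eqP IHr => [-> /=|/eqP p2] IHr; first by lia.
have : (2 <= p.-1)%N by have := prime_gt1 p_pr; lia.
move: (logn p (k i)`!) => a le_2 le_a.
have : (2 * a <= p.-1 * a)%N by rewrite leq_mul2r le_2 orbT.
by lia.
Qed.

Section Mahler.
Variables (R : realType) (p : nat) (Qp : padicFieldType R p) (d : nat).
Hypothesis p_pr : prime p.
Local Notation abs := (@padic_abs R p Qp).
Local Notation vec := 'rV[Qp]_d.
Local Notation index := (multi_index d).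

Lemma padic_abs_mul_close (a b a' b' : Qp) e : abs a <= 1 -> abs b' <= 1 ->
  abs (a - a') <= e -> abs (b - b') <= e -> abs (a * b - a' * b') <= e.
Proof.
move=> a1 b1 aa bb; have -> : a * b - a' * b' = a * (b - b') + (a - a') * b' by ring.
apply: (ultranormD_le (padic_ultranorm Qp)); rewrite padic_absM.
  by rewrite -[e]mul1r; apply: ler_pM; rewrite ?padic_abs_ge0.
by rewrite -[e]mulr1; apply: ler_pM; rewrite ?padic_abs_ge0.
Qed.

Lemma mfall_close (z z' : vec) k e : 0 <= e -> Zp_vec z -> Zp_vec z' ->
  (forall i, abs (z 0 i - z' 0 i) <= e) -> abs (mfall z k - mfall z' k) <= e.
Proof.
move=> e0 Zz Zz' zz.
have fall_close i n : abs (fall (z 0 i) n - fall (z' 0 i) n) <= e.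
  elim: n => [|n IHn]; first by rewrite /fall !big_ord0 subrr padic_abs0.
  rewrite !fallS; apply: padic_abs_mul_close => //.
  - apply: (ultranormB_le p_pr (padic_ultranorm Qp)); first exact: Zz.
    exact: padic_abs_nat_le1.
  - by apply: fall_le1 => //; apply: Zz'.
  - by rewrite opprB addrA subrK.
rewrite /mfall; suff [] :
  abs (\prod_i fall (z 0 i) (k i) - \prod_i fall (z' 0 i) (k i)) <= e /\
  abs (\prod_i fall (z' 0 i) (k i)) <= 1 by [].
elim/big_rec2: _ => [|i x y _ [xy x1]].
  by rewrite subrr padic_abs0 padic_abs1.
split; last by rewrite padic_absM mulr_ile1 ?padic_abs_ge0 ?fall_le1 //; apply: Zz'.
by apply: padic_abs_mul_close => //; apply: fall_le1 => //; apply: Zz.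
Qed.

Lemma newton_mfall (psi : vec -> Qp^o) N l : l \in box d N ->
  psi (natvec Qp l) = \sum_(k <- box d N) mfall (natvec Qp l) k *: fcoef k psi.
Proof.
move=> lN; rewrite (newton (fun l => psi (natvec Qp l)) lN).
apply: eq_bigr => k _; rewrite mfall_nat /fcoef natrM -scalerA scaler_nat.
rewrite [X in _ *+ _ = X *+ _]scalerA mulfV ?scale1r //.
by apply: padic_natr_neq0 => //; apply: mfact_gt0.
Qed.

(** At a vector of naturals Newton's formula is a finite identity; density of these vectors and
    continuity extend it to Zp_vec. The decay is required after division by k!, which makes the sum
    analytic and not just continuous. *)
Lemma mahler (psi : vec -> Qp^o) :
  (forall z e, Zp_vec z -> exists e' : nat, forall z', Zp_vec z' ->
    (forall i, abs (z 0 i - z' 0 i) <= p%:R ^- e') ->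
    abs (psi z - psi z') <= p%:R ^- e) ->
  null_family (fun k => abs (fcoef k psi)) ->
  (forall k, abs (fcoef k psi) <= 1) ->
  tate_ball (V := Qp^o) abs psi.
Proof.
move=> cont c0 c1.
apply: (tate_ball_null p_pr (padic_ultranorm Qp) (c := fun k => fcoef k psi)
  (P := fun k (z : vec) => mfall z k)) => //.
  by move=> k v; apply: poly_ball_mfall.
move=> M A z Zz AE; have [e' he'] := cont z M Zz.
have [l hl] := nat_approx p_pr (maxn e' M) Zz.
have Zl := natvec_Zp Qp p_pr l.
pose N := (\max_(k <- l :: A) mdegree k).+1.
have inN k : k \in l :: A -> k \in box d N.
  move=> kA; rewrite mem_box; apply/forallP => i; rewrite ltnS.
  exact: leq_trans (leq_mdegree k i) (leq_bigmax_seq _ kA isT).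
have cA k : k \notin A -> abs (fcoef k psi) <= p%:R ^- M by rewrite AE -leNgt.
have pM0 : 0 <= p%:R ^- M :> R by rewrite ltW ?pVX_gt0.
apply: (@ultranorm_trans _ _ _ _ _ (padic_ultranorm Qp) _ (psi (natvec Qp l))).
  apply: he' => // i; apply: le_trans (hl i) _.
  by apply: pVX_le => //; apply: leq_maxl.
rewrite (newton_mfall psi (inN l (mem_head _ _))).
rewrite (bigID (mem A)) /=.
have -> : \sum_(k <- box d N | k \in A) mfall (natvec Qp l) k *: fcoef k psi =
   \sum_(k <- A) mfall (natvec Qp l) k *: fcoef k psi.
  rewrite -big_filter; apply: perm_big; apply: uniq_perm => [||k].
  - exact/filter_uniq/box_uniq.
  - exact: fset_uniq.
  by rewrite mem_filter andb_idr // => kA; apply: inN; rewrite inE kA orbT.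
rewrite addrAC -sumrB; apply: (ultranormD_le (padic_ultranorm Qp)).
  apply: (ultranorm_sum (padic_ultranorm Qp)) => // k _.
  rewrite -scalerBl -[_ ^- M]mulr1; apply: (ultranormZ_le p_pr (padic_ultranorm Qp)) => //.
  apply: mfall_close => // i; rewrite -opprB padic_absN //; apply: le_trans (hl i) _.
  by apply: pVX_le => //; apply: leq_maxr.
apply: (ultranorm_sum (padic_ultranorm Qp)) => // k /cA ck.
rewrite -[_ ^- M]mul1r; apply: (ultranormZ_le p_pr (padic_ultranorm Qp)) => //.
exact: mfall_le1.
Qed.

End Mahler.

(** * Translations near the identity and substitution *)

Section Translation.
Variables (R : realType) (p : nat) (Qp : padicFieldType R p) (d : nat).
Hypothesis p_pr : prime p.
Local Notation abs := (@padic_abs R p Qp).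
Local Notation vec := 'rV[Qp]_d.
Local Notation index := (multi_index d).
Variables (G : topologicalGroupType) (g : 'I_d -> G) (K : set G).
Local Notation crd := (@coord_of R p Qp d G g).
Hypotheses (hausG : hausdorff_space G) (proK : open_pro_p p K).
Hypotheses (powK : powerful p K) (basis_g : ordered_basis Qp g K).

Let sK : subgroup K. Proof. by case: proK. Qed.
Let gK : set_bij (@Zp_vec R p Qp d) K (coordinates g).
Proof. by case: basis_g => _ []. Qed.

Definition translate h (z : vec) : vec := crd (h * coordinates g z)%g.

Definition displacement h i (z : vec) : Qp^o := translate h z 0 i - z 0 i.

Lemma translate_Zp h z : K h -> Zp_vec z -> Zp_vec (translate h z).
Proof.
move=> Kh Zz; apply: (coord_of_Zp gK); apply: subgroupM => //.
exact: (coordinates_K gK).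
Qed.

Lemma fdiff_displacement h i k : K h ->
  abs (fdiff k (fun l => displacement h i (natvec Qp l)))
    <= p%:R ^- (powerful_exponent p * mdegree k).
Proof.
move=> Kh; have := fdiff_coord_translate p_pr hausG proK basis_g k i Kh powK.
congr (abs _ <= _); apply: eq_bigr => l _.
rewrite /displacement /translate (coordinates_nat p_pr hausG proK basis_g).
by rewrite /natvec mxE.
Qed.

Lemma fcoef_displacement_le h i k e : K h -> (2 * e <= mdegree k)%N ->
  abs (fcoef k (displacement h i)) <= p%:R ^- e.
Proof.
move=> Kh le_e; have le_k := logn_mfact_le k p_pr.
rewrite /fcoef padic_absM padic_absV // padic_abs_nat ?mfact_gt0 // invrK.
apply: (@le_trans _ _
  (p%:R ^+ logn p (mfact k) * p%:R ^- (powerful_exponent p * mdegree k))).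
  by rewrite ler_pM2l ?exprn_gt0 ?pR_gt0 //; apply: fdiff_displacement.
rewrite -ler_pdivlMl ?exprn_gt0 ?pR_gt0 // -invfM -exprD pVX_le //; lia.
Qed.

Lemma displacement_continuous h i z e : K h -> Zp_vec z ->
  exists e' : nat, forall z', Zp_vec z' ->
    (forall j, abs (z 0 j - z' 0 j) <= p%:R ^- e') ->
    abs (displacement h i z - displacement h i z') <= p%:R ^- e.
Proof.
move=> Kh Zz; have Khz : K (h * coordinates g z)%g.
  by apply: subgroupM => //; apply: (coordinates_K gK).
have nhz := near_coord p_pr basis_g e i Khz.
have := @mulg_continuous G (h, coordinates g z); rewrite /continuous_at /=.
move=> /(_ _ nhz) [[A B] /= [A1 B1] AB].
have [e' he'] := near_coordinates p_pr basis_g Zz B1.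
exists (maxn e e') => z' Zz' zz'.
have -> : displacement h i z - displacement h i z' =
   - ((translate h z' 0 i - translate h z 0 i) + (z 0 i - z' 0 i)).
  by rewrite /displacement; ring.
rewrite padic_absN //.
apply: (ultranormD_le (padic_ultranorm Qp)).
  apply: (AB (h, coordinates g z')); last first.
    by apply: subgroupM => //; apply: (coordinates_K gK).
  split=> /=; first exact: nbhs_singleton.
  by apply: he' => // j; apply: le_trans (zz' j) _; rewrite pVX_le // leq_maxr.
by apply: le_trans (zz' i) _; rewrite pVX_le // leq_maxl.
Qed.

Lemma near_fcoef_displacement i k e : \forall h \near (1%g : G), K h ->
  abs (fcoef k (displacement h i)) <= p%:R ^- e.
Proof.
(* The additional valuation pays for the division by k! in [fcoef]. *)
pose e1 := (e + logn p (mfact k))%N.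
have near_l l : \forall h \near (1%g : G), K h ->
    abs (displacement h i (natvec Qp l)) <= p%:R ^- e1.
  have Kl : K (basis_prod g l) := basis_prod_K p_pr hausG proK basis_g l.
  have nl := near_coord p_pr basis_g e1 i Kl.
  have := @mulg_continuous G (1%g, basis_prod g l); rewrite /continuous_at /= mul1g.
  move=> /(_ _ nl) [[A B] /= [A1 B1] AB]; apply: filterS A1 => h Ah Kh.
  rewrite /displacement /translate (coordinates_nat p_pr hausG proK basis_g).
  have := AB (h, basis_prod g l); rewrite /= (coord_of_basis_prod p_pr hausG proK basis_g).
  apply; last exact: subgroupM.
  by split=> //=; apply: nbhs_singleton.
have near_s (s : seq index) : \forall h \near (1%g : G), K h -> forall l, l \in s ->
    abs (displacement h i (natvec Qp l)) <= p%:R ^- e1.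
  elim: s => [|l s IHs]; first by apply: nearW.
  apply: filterS2 (near_l l) IHs => h hl hs Kh m.
  by rewrite inE => /orP[/eqP->|]; [apply: hl | apply: hs].
apply: filterS (near_s (box d (mdegree k).+1)) => h hs Kh.
rewrite /fcoef padic_absM padic_absV // padic_abs_nat ?mfact_gt0 // invrK.
rewrite -ler_pdivlMl ?exprn_gt0 ?pR_gt0 // -invfM -exprD addnC -/e1.
rewrite /fdiff big_seq; apply: (ultranorm_sum (padic_ultranorm Qp)).
  by rewrite ltW ?pVX_gt0.
by move=> l lk; apply: (ultranormMz_le p_pr (padic_ultranorm Qp)); apply: hs.
Qed.

(** Outside the box of side 2n the coefficients are small for every h in K, by
    [fcoef_displacement_le]; the finitely many others are small for h near 1, by continuity. *)
Lemma near_displacement n i : \forall h \near (1%g : G), K h ->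
  tate_ball (V := Qp^o) abs (fun z => p%:R ^- n *: displacement h i z).
Proof.
have near_s (s : seq index) : \forall h \near (1%g : G), K h -> forall k, k \in s ->
    abs (fcoef k (displacement h i)) <= p%:R ^- n.
  elim: s => [|l s IHs]; first by apply: nearW.
  apply: filterS2 (near_fcoef_displacement i l n) IHs => h hl hs Kh m.
  by rewrite inE => /orP[/eqP->|]; [apply: hl | apply: hs].
apply: filterS (near_s (box d (2 * n))) => h hs Kh.
have pn : abs (p%:R ^- n) = p%:R ^+ n by rewrite padic_absV // padic_abs_pX // invrK.
have box_mdegree k e : k \notin box d (2 * e) -> (2 * e <= mdegree k)%N.
  rewrite mem_box => /forallPn[j]; rewrite -leqNgt => le_e.
  exact: leq_trans (leq_mdegree k j).
have le_n k : abs (fcoef k (displacement h i)) <= p%:R ^- n.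
  have [/hs-/(_ Kh)//|/box_mdegree] := boolP (k \in box d (2 * n)).
  exact: fcoef_displacement_le.
apply: mahler => //.
- move=> z e Zz; have [e' he'] := displacement_continuous i (n + e) Kh Zz.
  exists e' => z' Zz' zz'; have := he' z' Zz' zz'.
  rewrite -scalerBr padic_absM pn exprD invfM.
  by rewrite -ler_pdivlMl ?exprn_gt0 ?pR_gt0.
- move=> e e0; have [M hM] := pVX_small p_pr e0.
  apply: (sub_finite_set _ (finite_seq (box d (2 * (n + M))))) => k /=.
  apply: contraTT => /box_mdegree /(fcoef_displacement_le i Kh) le_M.
  rewrite -ltNge fcoefZ padic_absM pn; apply: le_lt_trans hM.
  by rewrite -ler_pdivlMl ?exprn_gt0 ?pR_gt0 // -invfM -exprD.
- move=> k; rewrite fcoefZ padic_absM pn -ler_pdivlMl ?exprn_gt0 ?pR_gt0 //.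
  by rewrite mulr1.
Qed.

Section Substitution.
Variables (V : lmodType Qp) (nu : V -> R).
Hypothesis nuP : ultranorm nu.
Variables (n : nat) (tau : vec -> vec).
Hypothesis tau_Zp : forall z, Zp_vec z -> Zp_vec (tau z).
Hypothesis tau_close : forall i,
  tate_ball (V := Qp^o) abs (fun z => p%:R ^- n *: (tau z 0 i - z 0 i : Qp^o)).

Let pn0 : (p%:R : Qp) ^+ n != 0. Proof. by rewrite expf_neq0 ?pQ_neq0. Qed.
Let absP := padic_ultranorm Qp.

Definition close_under (f : vec -> Qp^o) : Prop :=
  tate_ball (V := Qp^o) abs f /\
  tate_ball (V := Qp^o) abs (fun z => p%:R ^- n *: (f (tau z) - f z)).

(** A product rule: the increment of f h is the increment of f times h o tau, plus f times the
    increment of h. The factor h o tau is in the ball as it is h plus p^n times an element of the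
    ball. *)
Lemma close_underM f h : close_under f -> close_under h ->
  close_under (fun z => f z * h z).
Proof.
move=> [Af Cf] [Ah Ch]; split; first exact: (tate_ball_mul p_pr absP Af Ah).
have Ahtau : tate_ball (V := Qp^o) abs
    (fun z => h z + p%:R ^+ n *: (p%:R ^- n *: (h (tau z) - h z))).
  apply: (tate_ballD p_pr absP Ah); apply: (tate_ballZ p_pr absP) Ch.
  by rewrite padic_abs_pX //; have := pVX_le R p_pr (leq0n n); rewrite expr0 invr1.
apply: (@eq_tate_ball _ _ _ _ _ _ (fun z =>
   (p%:R ^- n *: (f (tau z) - f z)) *:
     (h z + p%:R ^+ n *: (p%:R ^- n *: (h (tau z) - h z)) : Qp^o)
   + f z *: (p%:R ^- n *: (h (tau z) - h z) : Qp^o))) => [z _|].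
  rewrite [p%:R ^+ n *: _]scalerA divff // scale1r [h z + _]addrC subrK.
  by rewrite /GRing.scale /=; ring.
apply: (tate_ballD p_pr absP); first exact: (tate_ball_mul p_pr absP Cf Ahtau).
exact: (tate_ball_mul p_pr absP Af Ch).
Qed.

Lemma tate_ball_cst (c : Qp^o) :
  abs c <= 1 -> tate_ball (d := d) (V := Qp^o) abs (fun=> c).
Proof.
move=> c1; apply: (tate_ball_poly_ball p_pr absP).
apply: eq_poly_ball (poly_ball_mfall (nu := abs) (V := Qp^o) [ffun=> 0%N] c1) => z.
by rewrite mfall0 scale1r.
Qed.

Lemma close_under_cst (c : Qp^o) : abs c <= 1 -> close_under (fun=> c).
Proof.
move=> c1; split; first exact: tate_ball_cst.
apply: (@eq_tate_ball _ _ _ _ _ _ (fun=> 0)) => [z _|].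
  by rewrite subrr scaler0.
by apply: tate_ball_cst; rewrite padic_abs0.
Qed.

Lemma close_under_coord i c : abs c <= 1 -> close_under (fun z => z 0 i - c : Qp^o).
Proof.
move=> c1; split; last first.
  apply: eq_tate_ball (tau_close i) => z _; congr (_ *: _).
  by rewrite opprB addrA subrK.
apply: (tate_ballD p_pr absP); last by apply: tate_ball_cst; rewrite padic_absN.
apply: (tate_ball_poly_ball p_pr absP).
have v1 : abs 1 <= 1 by rewrite padic_abs1.
apply: eq_poly_ball (poly_ball_mfall (nu := abs) (V := Qp^o) (delta_index i) v1) => z.
by rewrite mfall_delta /GRing.scale /= mulr1.
Qed.

Lemma close_under_mfall k : close_under (fun z => mfall z k).
Proof.
rewrite /mfall; elim: (index_enum _) => [|i r IHr].
  have -> : (fun z : vec => \prod_(i <- [::]) fall (z 0 i) (k i)) = fun=> 1.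
    by apply/funext => z; rewrite big_nil.
  by apply: close_under_cst; rewrite padic_abs1.
have -> : (fun z : vec => \prod_(j <- i :: r) fall (z 0 j) (k j)) =
    fun z => fall (z 0 i) (k i) * \prod_(j <- r) fall (z 0 j) (k j).
  by apply/funext => z; rewrite big_cons.
apply: close_underM => //; elim: (k i) => [|m IHm].
  have -> : (fun z : vec => fall (z 0 i) 0) = fun=> 1.
    by apply/funext => z; rewrite /fall big_ord0.
  by apply: close_under_cst; rewrite padic_abs1.
have -> : (fun z : vec => fall (z 0 i) m.+1) =
    fun z => (z 0 i - m%:R) * fall (z 0 i) m.
  by apply/funext => z; rewrite fallS.
by apply: close_underM => //; apply: close_under_coord; apply: padic_abs_nat_le1.
Qed.

Lemma tate_ball_substitution F : tate_ball nu F ->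
  tate_ball nu (fun z => p%:R ^- n *: (F (tau z) - F z)).
Proof.
move=> /(tate_ballP p_pr nuP)[T [PT lim]].
apply: (tate_ball_series p_pr nuP
  (F := fun i z => p%:R ^- n *: (T i (tau z) - T i z))) => [i|z Zz e].
  have [s [s1 Es]] := PT i.
  apply: (@eq_tate_ball R p Qp d V nu (fun z => \sum_(x <- s)
     (p%:R ^- n *: (mfall (tau z) x.1 - mfall z x.1 : Qp^o)) *: x.2)) => [z _|].
    rewrite !Es -sumrB scaler_sumr; apply: eq_bigr => x _.
    by rewrite -scalerBl scalerA.
  apply: (tate_ball_sum p_pr nuP (F := fun x z =>
    (p%:R ^- n *: (mfall (tau z) x.1 - mfall z x.1 : Qp^o)) *: x.2)) => x /s1 x1.
  apply: (tate_ball_mul p_pr nuP (close_under_mfall x.1).2).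
  apply: (tate_ball_poly_ball p_pr nuP).
  by apply: eq_poly_ball (poly_ball_mfall [ffun=> 0%N] x1) => z; rewrite mfall0 scale1r.
exists (n + e)%N => M le_M.
have -> : p%:R ^- n *: (F (tau z) - F z)
    - \sum_(i < M) p%:R ^+ i *: (p%:R ^- n *: (T i (tau z) - T i z)) =
  p%:R ^- n *: ((F (tau z) - \sum_(i < M) p%:R ^+ i *: T i (tau z))
    - (F z - \sum_(i < M) p%:R ^+ i *: T i z)).
  have -> : \sum_(i < M) p%:R ^+ i *: (p%:R ^- n *: (T i (tau z) - T i z)) =
      p%:R ^- n *: (\sum_(i < M) p%:R ^+ i *: T i (tau z)
        - \sum_(i < M) p%:R ^+ i *: T i z).
    rewrite -sumrB scaler_sumr; apply: eq_bigr => i _.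
    by rewrite -scalerBr !scalerA mulrC.
  rewrite -scalerBr !opprB addrACA [in RHS]addrACA; congr (_ *: (_ + _)).
  exact: addrC.
rewrite (ultranormZ nuP) (padic_absV p_pr) (padic_abs_pX Qp p_pr) invrK.
rewrite -ler_pdivlMl ?exprn_gt0 ?pR_gt0 // -invfM -exprD.
apply: le_trans (pVX_le R p_pr le_M).
by apply: (ultranormB_le p_pr nuP); apply: lim => //; apply: tau_Zp.
Qed.

End Substitution.
End Translation.

(** * Analytic vectors *)

Section Absorption.
Variables (R : realType) (p : nat) (Qp : padicFieldType R p).
Hypothesis p_pr : prime p.
Local Notation abs := (@padic_abs R p Qp).
Variables (V : lmodType Qp) (nu : V -> R).
Hypothesis nuP : ultranorm nu.

Lemma ultranorm_absorb v : exists n : nat, nu (p%:R ^+ n *: v) <= 1.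
Proof.
have v0 : 0 < nu v + 1 by rewrite ltr_wpDl // (ultranorm_ge0 p_pr nuP).
have vV : 0 < (nu v + 1)^-1 by rewrite invr_gt0.
have [n hn] := pVX_small p_pr vV; exists n.
rewrite (ultranorm_pX p_pr nuP); apply: (@le_trans _ _ (p%:R ^- n * (nu v + 1))).
  by rewrite ler_pM2l ?pVX_gt0 // lerDl.
by rewrite -ler_pdivlMr // mul1r ltW.
Qed.

End Absorption.

Section Nonexpansive.
Variables (R : realType) (p : nat) (Qp : padicFieldType R p).
Hypothesis p_pr : prime p.
Local Notation abs := (@padic_abs R p Qp).
Variables (V : lmodType Qp) (nu : V -> R).
Hypothesis nuP : ultranorm nu.
Let pn0 n : (p%:R : Qp) ^+ n != 0. Proof. by rewrite expf_neq0 ?pQ_neq0. Qed.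

Variable f : V -> V.
Hypothesis fD : forall v w, f (v + w) = f v + f w.
Hypothesis f1 : forall v, nu v <= 1 -> nu (f v) <= 1.
Hypothesis nu_eq0 : forall v, nu v = 0 -> v = 0.

Let f0 : f 0 = 0.
Proof. by apply: (addrI (f 0)); rewrite -fD !addr0. Qed.

Let fZn n v : f (n%:R *: v) = n%:R *: f v.
Proof.
elim: n => [|n IHn]; first by rewrite !scale0r f0.
by rewrite -addn1 natrD !scalerDl !scale1r fD IHn.
Qed.

Let fZp n v : f (p%:R ^+ n *: v) = p%:R ^+ n *: f v.
Proof. by rewrite -natrX fZn. Qed.

Lemma additive_nonexpansive n v : nu v <= p%:R ^- n -> nu (f v) <= p%:R ^- n.
Proof.
move=> vn; have <- : p%:R ^+ n *: (p%:R ^- n *: v) = v.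
  by rewrite scalerA divff ?scale1r.
by rewrite fZp (ultranorm_pX_le p_pr nuP) f1 // (ultranorm_pVX_le p_pr nuP).
Qed.

(** A module structure over [A] provides only additive maps. Additivity gives natural scalars,
    density and preservation of the unit ball give Zp, and scaling by powers of [p] gives Qp. *)
Lemma additive_scaler (a : Qp) v : f (a *: v) = a *: f v.
Proof.
have small (b : Qp) w : abs b <= 1 -> nu w <= 1 -> f (b *: w) = b *: f w.
  move=> b1 w1; apply/eqP; rewrite -subr_eq0; apply/eqP/nu_eq0.
  apply/le_anti; rewrite (ultranorm_ge0 p_pr nuP) andbT.
  rewrite leNgt; apply/negP => /(pVX_small p_pr)[n].
  rewrite ltNge => /negP; apply; have [m hm] := padic_nat_dense p_pr n b1.
  have [c [E hc]] : exists c, b = m%:R + c /\ abs c <= p%:R ^- n.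
    by exists (b - m%:R); rewrite addrC subrK.
  rewrite E !scalerDl fD fZn opprD addrACA subrr add0r.
  apply: (ultranormB_le p_pr nuP).
    apply: additive_nonexpansive; rewrite -[_ ^- n]mulr1.
    exact: (ultranormZ_le p_pr nuP).
  by rewrite -[_ ^- n]mulr1; apply: (ultranormZ_le p_pr nuP) => //; apply: f1.
have [n hn] := ultranorm_absorb p_pr nuP v.
have [m hm] := ultranorm_absorb p_pr (padic_ultranorm Qp) a.
apply: (scalerI (pn0 (m + n))); rewrite -fZp.
have E : p%:R ^+ (m + n) *: (a *: v) = (p%:R ^+ m * a) *: (p%:R ^+ n *: v).
  by rewrite !scalerA exprD; congr (_ *: _); ring.
by rewrite E small // fZp !scalerA exprD; congr (_ *: _); ring.
Qed.

Lemma tate_ball_map d (F : 'rV[Qp]_d -> V) :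
  tate_ball nu F -> tate_ball nu (fun z => f (F z)).
Proof.
move=> /(tate_ballP p_pr nuP)[T [PT lim]]; apply/(tate_ballP p_pr nuP).
have f_sum (I : Type) (r : seq I) (c : I -> Qp) (x : I -> V) :
    f (\sum_(i <- r) c i *: x i) = \sum_(i <- r) c i *: f (x i).
  elim: r => [|i r IHr]; first by rewrite !big_nil f0.
  by rewrite !big_cons fD additive_scaler IHr.
exists (fun i z => f (T i z)); split=> [i|z M Zz].
  have [s [s1 Es]] := PT i; exists [seq (x.1, f x.2) | x <- s]; split=> [x|z].
    by case/mapP => y /s1 y1 ->; apply: f1.
  by rewrite Es f_sum big_map.
have fB v w : f (v - w) = f v - f w.
  by rewrite fD -scaleN1r additive_scaler scaleN1r.
by rewrite -f_sum -fB; apply: additive_nonexpansive; apply: lim.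
Qed.

End Nonexpansive.

Lemma open_subgroup_closed (G : topologicalGroupType) (N : set G) :
  subgroup N -> open N -> closed N.
Proof.
move=> sN oN; rewrite -openC openE => x Nx.
have N1 : nbhs (1%g : G) N by apply: open_nbhs_nbhs; split=> //; apply: subgroup1.
apply: filterS (nbhs_mulgl x N1) => y /= Nxy Ny; apply: Nx.
have -> : x = (y * (x^-1 * y)^-1)%g by rewrite invgM invgK mulVKg.
by apply: subgroupM => //; apply: subgroupV.
Qed.

(** * The action of A on the unit ball of analytic vectors *)

Section Main.
Variables (R : realType) (p : nat) (Qp : padicFieldType R p) (d : nat).
Variables (G : topologicalGroupType) (W : padicBanachType Qp).
Variables (rho : G -> W -> W) (A : pzRingType) (act : A -> W -> W).
Variables (K : set G) (g : 'I_d -> G).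
Hypothesis p_pr : prime p.
Hypotheses (hausG : hausdorff_space G) (rhoP : banach_representation rho).
Hypotheses (admW : admissible rho) (actP : module_action act).
Hypothesis act_rho : forall a h w, act a (rho h w) = rho h (act a w).
Hypothesis act_ball : stable_under act (unit_ball W).
Hypothesis rho_ball : subgroup_stable rho K (unit_ball W).
Hypotheses (proK : open_pro_p p K) (powK : powerful p K).
Hypothesis basis_g : ordered_basis Qp g K.

Local Notation abs := (@padic_abs R p Qp).
Local Notation nu := (@bnorm R p Qp W).
Local Notation vec := 'rV[Qp]_d.
Local Notation B := (analytic_vectors_ball rho g K).

Let nuP : ultranorm nu := bnorm_ultranorm W.
Let sK : subgroup K. Proof. by case: proK. Qed.
Let gK : set_bij (@Zp_vec R p Qp d) K (coordinates g).
Proof. by case: basis_g => _ []. Qed.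
Let pn0 n : (p%:R : Qp) ^+ n != 0. Proof. by rewrite expf_neq0 ?pQ_neq0. Qed.

Let rho_lin h (a : Qp) v w : rho h (a *: v + w) = a *: rho h v + rho h w.
Proof. by case: rhoP. Qed.
Let rhoM h k w : rho (h * k)%g w = rho h (rho k w).
Proof. by case: rhoP. Qed.
Let rhoD h v w : rho h (v + w) = rho h v + rho h w.
Proof. by have := rho_lin h 1 v w; rewrite !scale1r. Qed.
Let rho0 h : rho h 0 = 0.
Proof. by apply: (addrI (rho h 0)); rewrite -rhoD !addr0. Qed.
Let rhoZ h (a : Qp) v : rho h (a *: v) = a *: rho h v.
Proof. by rewrite -[a *: v]addr0 rho_lin rho0 addr0. Qed.
Let rhoB h v w : rho h (v - w) = rho h v - rho h w.
Proof. by rewrite rhoD -scaleN1r rhoZ scaleN1r. Qed.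

Let actD a v w : act a (v + w) = act a v + act a w.
Proof. by case: actP. Qed.
Let act1 a v : nu v <= 1 -> nu (act a v) <= 1.
Proof. exact: act_ball. Qed.
Let actZ a (c : Qp) v : act a (c *: v) = c *: act a v.
Proof. exact: (additive_scaler p_pr nuP (actD a) (act1 a) (@bnorm_eq0 _ _ _ _)). Qed.
Let actB a v w : act a (v - w) = act a v - act a w.
Proof. by rewrite actD -scaleN1r actZ scaleN1r. Qed.
Let act_le a n v : nu v <= p%:R ^- n -> nu (act a v) <= p%:R ^- n.
Proof. exact: (additive_nonexpansive p_pr nuP (actD a) (act1 a)). Qed.

Definition orbit w (z : vec) : W := rho (coordinates g z) w.

Lemma analytic_ballP w : B w <-> tate_ball nu (orbit w).
Proof. exact: (ctensor_ballP p_pr gK (fun x => rho x w)). Qed.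

Lemma analytic_vectorsP w :
  analytic_vectors rho g K w <-> exists n : nat, B (p%:R ^+ n *: w).
Proof.
split=> -[n Bn]; exists n.
  apply/analytic_ballP; move/(ctensor_ballP p_pr gK): Bn; apply: eq_tate_ball => z _.
  by rewrite /orbit rhoZ.
apply/(ctensor_ballP p_pr gK); move/analytic_ballP: Bn; apply: eq_tate_ball => z _.
by rewrite /orbit rhoZ.
Qed.

Lemma analytic_ballD v w : B v -> B w -> B (v + w).
Proof.
move=> /analytic_ballP Bv /analytic_ballP Bw; apply/analytic_ballP.
by apply: eq_tate_ball (tate_ballD p_pr nuP Bv Bw) => z _; rewrite /orbit rhoD.
Qed.

Lemma analytic_ballZ a w : abs a <= 1 -> B w -> B (a *: w).
Proof.
move=> a1 /analytic_ballP Bw; apply/analytic_ballP.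
by apply: eq_tate_ball (tate_ballZ p_pr nuP a1 Bw) => z _; rewrite /orbit rhoZ.
Qed.

Lemma analytic_ball0 : B 0.
Proof.
apply/analytic_ballP; apply: (tate_ball_poly_ball p_pr nuP).
by apply: eq_poly_ball (poly_ball0 _ _) => z; rewrite /orbit rho0.
Qed.

Lemma analytic_ball_lattice : open_bounded_lattice (analytic_vectors rho g K) B B.
Proof.
split; first split.
- by move=> w Bw; apply/analytic_vectorsP; exists 0%N; rewrite expr0 scale1r.
- exact: analytic_ball0.
- exact: analytic_ballD.
- by move=> a w; apply: analytic_ballZ.
- by move=> v /analytic_vectorsP[n Bn]; exists (p%:R ^+ n).
- move=> x Bx; exists 1; first exact: oner_neq0.
  by move=> b Bb; rewrite scale1r; apply: analytic_ballD.
- by exists 1 => x Bx; exists x => //; rewrite scale1r.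
Qed.

Lemma analytic_ball_stable : stable_under act B.
Proof.
move=> a w /analytic_ballP Bw; apply/analytic_ballP.
have := tate_ball_map p_pr nuP (actD a) (act1 a) (@bnorm_eq0 _ _ _ _) Bw.
by apply: eq_tate_ball => z _; rewrite /orbit act_rho.
Qed.

Lemma analytic_vectors_stable : stable_under act (analytic_vectors rho g K).
Proof.
move=> a w /analytic_vectorsP[n Bn]; apply/analytic_vectorsP; exists n.
by rewrite -actZ; apply: analytic_ball_stable.
Qed.

Definition invariant_mod (N : set G) n x : Prop :=
  nu x <= 1 /\ forall h, N h -> nu (rho h x - x) <= p%:R ^- n.

(** As [fcoef] commutes with [rho h], moving a coefficient by [h] amounts to translating the
    argument of the orbit map, and [tate_ball_substitution] applies. [N] comes from the
    displacements alone, so it suits all [w] and [k]. *)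
Lemma fcoef_orbit_invariant n : exists N, [/\ subgroup N, open N, N `<=` K &
  forall w k, B w -> invariant_mod N n (fcoef k (orbit w))].
Proof.
have near_s (s : seq 'I_d) : \forall h \near (1%g : G), K h -> forall i, i \in s ->
    tate_ball (V := Qp^o) abs (fun z => p%:R ^- n *: displacement g h i z : Qp^o).
  elim: s => [|j s IHs]; first by apply: nearW.
  apply: filterS2 (near_displacement p_pr hausG proK powK basis_g n j) IHs.
  move=> h hj hs Kh i.
  by rewrite inE => /orP[/eqP->|]; [apply: hj | apply: hs].
have [_ _ base _] := proK; have [N [oN sN NU]] := base _ (near_s (enum 'I_d)).
exists N; split=> //; first by move=> x /NU[].
move=> w k /analytic_ballP Bw; split; first exact: (fcoef_le1 p_pr nuP).
move=> h /NU[Uh Kh].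
have tauP i : tate_ball (V := Qp^o) abs
    (fun z => p%:R ^- n *: (translate g h z 0 i - z 0 i : Qp^o)).
  by apply: Uh => //; rewrite mem_enum.
have := tate_ball_substitution p_pr nuP
  (fun z => @translate_Zp _ _ Qp d _ _ _ proK basis_g h z Kh) tauP Bw.
move/(fcoef_le1 p_pr nuP k).
rewrite fcoefZ fcoefB (ultranorm_pVX_le p_pr nuP).
congr (nu (_ - _) <= _).
rewrite -(fcoef_additive k _ (rho_lin h)); apply: (eq_fcoef p_pr) => z Zz.
rewrite /orbit /translate (coord_ofK gK) ?rhoM //.
by apply: subgroupM => //; apply: (coordinates_K gK).
Qed.

Lemma invariant_modB N n x y :
  invariant_mod N n x -> invariant_mod N n y -> invariant_mod N n (x - y).
Proof.
move=> [x1 xN] [y1 yN]; split=> [|h Nh]; first exact: (ultranormB_le p_pr nuP).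
have -> : rho h (x - y) - (x - y) = (rho h x - x) - (rho h y - y).
  by rewrite rhoB !opprB addrACA [RHS]addrACA; congr (_ + _); exact: addrC.
by apply: (ultranormB_le p_pr nuP); [apply: xN | apply: yN].
Qed.

Lemma unit_ball_lattice : open_bounded_lattice setT (unit_ball W) (unit_ball W).
Proof.
split; first split=> //.
- by rewrite /unit_ball /= (ultranorm0 nuP).
- by move=> x y; apply: (ultranormD_le nuP).
- move=> a x a1 x1; rewrite /unit_ball /= -[X in _ <= X]mulr1.
  exact: (ultranormZ_le p_pr nuP).
- by move=> v _; have [n hn] := ultranorm_absorb p_pr nuP v; exists (p%:R ^+ n).
- move=> x x1; exists 1; first exact: oner_neq0.
  by move=> b b1; rewrite scale1r; apply: (ultranormD_le nuP).
- by exists 1 => x x1; exists x => //; rewrite scale1r.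
Qed.

Lemma residue_class_eq x y :
  residue_class (unit_ball W) 1 x = residue_class (unit_ball W) 1 y <->
  nu (x - y) <= p%:R ^- 1.
Proof.
have sub u v : nu (u - v) <= p%:R ^- 1 ->
    residue_class (unit_ball W) 1 u `<=` residue_class (unit_ball W) 1 v.
  move=> uv _ [w w1 <-]; exists (p%:R ^- 1 *: (u - v) + w).
    by apply: (ultranormD_le nuP) => //; rewrite (ultranorm_pVX_le p_pr nuP).
  by rewrite scalerDr scalerA divff // scale1r addrA [v + _]addrC subrK.
split=> [E | xy]; last first.
  by apply/seteqP; split; apply: sub => //; rewrite -opprB (ultranormN p_pr nuP).
have : residue_class (unit_ball W) 1 y x.
  by rewrite -E; exists 0; rewrite ?scaler0 ?addr0 // /unit_ball /= (ultranorm0 nuP).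
by move=> [w w1 <-]; rewrite addrAC subrr add0r (ultranorm_pX_le p_pr nuP).
Qed.

(* Admissibility is the case [n = 1]; an element invariant modulo [p ^ n.+1] is
   determined by its class modulo [p] and, after subtracting an invariant
   representative of that class, by an element invariant modulo [p ^ n]. *)
Lemma invariant_mod_finite (N : set G) n : subgroup N -> open N -> N `<=` K ->
  exists s : seq W, (forall y, y \in s -> invariant_mod N n y) /\
    forall x, invariant_mod N n x -> exists2 y, y \in s & nu (x - y) <= p%:R ^- n.
Proof.
move=> sN oN NK; have [_ [oK cK] _ _] := proK.
have cN : compact N := subclosed_compact (open_subgroup_closed sN oN) cK NK.
have N_ball : subgroup_stable rho N (unit_ball W).
  by move=> k w /NK; apply: rho_ball.
have [m [v [vI hv]]] := admW sN oN cN unit_ball_lattice N_ball.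
have inv0 e : invariant_mod N e 0.
  split=> [|h _]; first by rewrite (ultranorm0 nuP).
  by rewrite rho0 subrr (ultranorm0 nuP) ltW ?pVX_gt0.
elim: n => [|n [s [sI sP]]].
  exists [:: 0]; split=> [y|x [x1 _]]; first by rewrite inE => /eqP->.
  by exists 0; rewrite ?mem_head // subr0 expr0 invr1.
pose r (c : {ffun 'I_m -> 'I_p}) : W := \sum_(j < m) v j *+ c j.
(* A class modulo [p] may contain no vector invariant modulo p^(n+1); the default 0 is then still
   invariant, and such a class is never met below. *)
pose rep c := xget 0 [set x | invariant_mod N n.+1 x /\ nu (x - r c) <= p%:R ^- 1].
have repI c : invariant_mod N n.+1 (rep c).
  by rewrite /rep; case: xgetP => [y _ []|_].
exists [seq rep c + p%:R ^+ 1 *: y | c <- enum {ffun 'I_m -> 'I_p}, y <- s]; split.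
  move=> _ /allpairsP[[c y] [_ /sI yI ->]] /=; rewrite -[_ *: y]opprK.
  apply: invariant_modB => //; case: yI => y1 yN; split=> [|h Nh].
    rewrite (ultranormN p_pr nuP); apply: (@le_trans _ _ (p%:R ^- 1)).
      by rewrite (ultranorm_pX_le p_pr nuP).
    by have := pVX_le R p_pr (leq0n 1); rewrite expr0 invr1.
  rewrite -scalerN rhoZ -scalerBr (ultranorm_pX p_pr nuP) -[n.+1]add1n exprD invfM.
  rewrite ler_pM2l ?pVX_gt0 // -[- y]sub0r rhoB rho0 !sub0r -opprD.
  by rewrite (ultranormN p_pr nuP); apply: yN.
move=> x xI; have [x1 xN] := xI.
have [c hc] : exists c, nu (x - r c) <= p%:R ^- 1.
  have [|c /residue_class_eq hc] := hv x.
    split=> // k Nk; apply/residue_class_eq.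
    by apply: le_trans (xN k Nk) _; apply: pVX_le.
  exists [ffun j => Ordinal (ltn_pmod (c j) (prime_gt0 p_pr))].
  apply: (ultranorm_trans nuP hc); rewrite /r -sumrB.
  apply: (ultranorm_sum nuP) => [|j _]; first by rewrite ltW ?pVX_gt0.
  rewrite ffunE /= {1}(divn_eq (c j) p) mulrnDr addrK mulrnA -scaler_nat -[p%:R]expr1.
  rewrite (ultranorm_pX_le p_pr nuP) pmulrn; apply: (ultranormMz_le p_pr nuP).
  exact: (vI j).1.
have [_ hrep] : invariant_mod N n.+1 (rep c) /\ nu (rep c - r c) <= p%:R ^- 1.
  by rewrite /rep; case: xgetP => [y _ //|/(_ x)]; case.
pose y := p%:R ^- 1 *: (x - rep c).
have xrep : nu (x - rep c) <= p%:R ^- 1.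
  by apply: (ultranorm_trans nuP hc); rewrite -opprB (ultranormN p_pr nuP).
have [|z zs yz] := sP y.
  have [_ dN] := invariant_modB xI (repI c).
  split=> [|h Nh]; first by rewrite (ultranorm_pVX_le p_pr nuP).
  rewrite /y rhoZ -scalerBr (ultranormZ nuP) (padic_absV p_pr).
  rewrite (padic_abs_pX Qp p_pr) invrK.
  by rewrite -ler_pdivlMl ?exprn_gt0 ?pR_gt0 // -invfM -exprD; apply: dN.
exists (rep c + p%:R ^+ 1 *: z).
  by apply/allpairsP; exists (c, z); rewrite /= mem_enum.
have -> : x - (rep c + p%:R ^+ 1 *: z) = p%:R ^+ 1 *: (y - z).
  by rewrite scalerBr /y scalerA divff // scale1r opprD addrA.
rewrite (ultranorm_pX p_pr nuP) -[n.+1]add1n exprD invfM.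
by rewrite ler_pM2l ?pVX_gt0.
Qed.

(** The code of [a] records, for each of the finitely many representatives, a representative close
    to its image under [a]. Equal codes force agreement modulo p^n on all invariant vectors, hence
    on the coefficients of orbit maps, and [tate_ball_div] concludes. *)
Lemma act_congruence n : exists (T : finType) (code : A -> T), forall a a',
  code a = code a' -> forall w, B w ->
  exists2 u, B u & act a w - act a' w = p%:R ^+ n *: u.
Proof.
have [N [sN oN NK hN]] := fcoef_orbit_invariant n.
have [s [sI sP]] := invariant_mod_finite n sN oN NK.
have actI a y : invariant_mod N n y -> invariant_mod N n (act a y).
  move=> [y1 yN]; split=> [|h Nh]; first exact: act1.
  by rewrite -act_rho -actB; apply: act_le; apply: yN.
have /choice[code0 code0P] (ai : A * 'I_(size s)) : exists j : 'I_(size s),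
    nu (act ai.1 (tnth (in_tuple s) ai.2) - tnth (in_tuple s) j) <= p%:R ^- n.
  have [|y ys hy] := sP (act ai.1 (tnth (in_tuple s) ai.2)).
    by apply/actI/sI/mem_tnth.
  by have /tnthP[j Ej] : y \in in_tuple s by []; exists j; rewrite -Ej.
exists {ffun 'I_(size s) -> 'I_(size s)}, (fun a => [ffun i => code0 (a, i)]).
move=> a a' E w Bw.
have close x : invariant_mod N n x -> nu (act a x - act a' x) <= p%:R ^- n.
  move=> /sP[y ys xy]; have /tnthP[j Ej] : y \in in_tuple s by [].
  have Ec : code0 (a, j) = code0 (a', j) by have /ffunP/(_ j) := E; rewrite !ffunE.
  have hy : nu (act a y - act a' y) <= p%:R ^- n.
    apply: (ultranorm_trans nuP (v := tnth (in_tuple s) (code0 (a, j)))).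
      by have := code0P (a, j); rewrite /= -Ej.
    rewrite -opprB (ultranormN p_pr nuP) Ec.
    by have := code0P (a', j); rewrite /= -Ej.
  apply: (ultranorm_trans nuP (v := act a y)); first by rewrite -actB; apply: act_le.
  apply: (ultranorm_trans nuP hy); rewrite -actB; apply: act_le.
  by rewrite -opprB (ultranormN p_pr nuP).
exists (p%:R ^- n *: (act a w - act a' w)); last by rewrite scalerA divff // scale1r.
have BD : B (act a w - act a' w).
  rewrite -scaleN1r; apply: analytic_ballD; first exact: analytic_ball_stable.
  apply: analytic_ballZ; last exact: analytic_ball_stable.
  by rewrite padic_absN // padic_abs1.
have [/analytic_ballP AD fc] : B (act a w - act a' w) /\
    forall k, nu (fcoef k (orbit (act a w - act a' w))) <= p%:R ^- n.
  split=> // k.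
  have -> : fcoef k (orbit (act a w - act a' w)) =
      act a (fcoef k (orbit w)) - act a' (fcoef k (orbit w)).
    have lin b c v u : act b (c *: v + u) = c *: act b v + act b u by rewrite actD actZ.
    rewrite -(fcoef_additive k _ (lin a)) -(fcoef_additive k _ (lin a')) -fcoefB.
    by apply: (eq_fcoef p_pr) => z _; rewrite /orbit rhoB !act_rho.
  by apply: close; apply: hN.
apply/analytic_ballP; apply: eq_tate_ball (tate_ball_div p_pr nuP AD fc) => z _.
by rewrite /orbit rhoZ.
Qed.

Lemma induced_map_eq (L : set W) n (f1 f2 : W -> W) :
  lattice (analytic_vectors rho g K) L ->
  (forall w, L w -> exists2 u, L u & f1 w - f2 w = p%:R ^+ n *: u) ->
  @induced_map R p Qp W L n f1 = @induced_map R p Qp W L n f2.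
Proof.
move=> [_ L0 LD LZ _] f12; apply/funext => C.
have LC x : set_val C x -> L x.
  have [x0 Lx0 E] := set_valP C; rewrite [set_val C](_ : _ = residue_class L n x0) //.
  move=> [y Ly <-]; apply: LD => //; apply: LZ => //.
  rewrite /Defs.Zp /= padic_abs_pX //.
  by have := pVX_le R p_pr (leq0n n); rewrite expr0 invr1.
have sub u v y : L y -> u - v = p%:R ^+ n *: y ->
    residue_class L n u `<=` residue_class L n v.
  move=> Ly E _ [x Lx <-]; exists (y + x); first exact: LD.
  by rewrite scalerDr -E addrA [v + _]addrC subrK.
apply/seteqP; split=> y [x Cx xy]; exists x => //; have [u Lu E] := f12 x (LC x Cx).
  exact: sub Lu E y xy.
apply: (sub _ _ (- u)) xy; last by rewrite scalerN -E opprB.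
by rewrite -scaleN1r; apply: LZ => //; rewrite /Defs.Zp /= padic_absN // padic_abs1.
Qed.

Lemma analytic_vectors_locally_analytic :
  locally_analytic_action act (analytic_vectors rho g K) B.
Proof.
split; first exact: analytic_vectors_stable.
exists B; split; [exact: analytic_ball_lattice | exact: analytic_ball_stable |].
move=> n _; have [T [code hcode]] := act_congruence n.
(* One element of [A] is chosen for each code; the default 0 concerns only the codes that are not
   attained. *)
pose Phi (t : T) := @induced_map R p Qp W B n (act (xget 0 [set a | code a = t])).
apply: (@sub_finite_set _ _ (Phi @` setT)); last first.
  by apply: finite_image; apply: finite_finset.
move=> _ [a _ <-]; exists (code a) => //; apply: induced_map_eq.
  by have [] := analytic_ball_lattice.
apply: hcode; case: xgetP => [b _ //|/(_ a)]; by case.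
Qed.

End Main.

Theorem theorem6p1 (R : realType) (p : nat) (Qp : padicFieldType R p)
    (d : nat) (G : topologicalGroupType) (W : padicBanachType Qp)
    (rho : G -> W -> W) (A : pzRingType) (act : A -> W -> W)
    (K0 K : set G) (g : 'I_d -> G) :
  prime p ->
  padic_lie_group Qp d G ->
  banach_representation rho ->
  admissible rho ->
  module_action act ->
  (forall a h w, act a (rho h w) = rho h (act a w)) ->
  subgroup K0 -> open K0 ->
  stable_under act (unit_ball W) ->
  subgroup_stable rho K0 (unit_ball W) ->
  subgroup K -> open K ->
  subgroup_stable rho K (unit_ball W) ->
  open_uniform p K ->
  ordered_basis Qp g K ->
  locally_analytic_action act
    (analytic_vectors rho g K) (analytic_vectors_ball rho g K).
Proof.
move=> p_pr [hausG _] rhoP admW actP act_rho _ _ act_ball _ _ _ rho_ball.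
move=> [proK _ powK _] basis_g.
exact: analytic_vectors_locally_analytic.
Qed.
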